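(* Consider the longitudinal setting of the context with univariate instruments, and assume: (consistency) $Y=Y(\overline{A})$; (latent ignorability) for every $t$, $\{Z_t,A_t\}$ is conditionally independent of $Y(\underline{a}_t)$ given $(H_t,\overline{U}_t)$; (IV independence) for every $t$, $Z_t$ is conditionally independent of $\overline{U}_t$ given $H_t$. Fix $\overline{a}=[a_0,\dots,a_T]$ and suppose that for each $t=0,\dots,T$, $\pi_t(Z_t,H_t)=Z_t$ is a regular weighting function for $A_t=a_t$. Let $$\psi^o_{\overline a}:=\mathbb{E}\left[\prod_{t=0}^T\frac{(Z_t-\mathbb{E}[Z_t\mid H_t])\,I\{A_t=a_t\}}{\mathrm{Cov}\{I\{A_t=a_t\},Z_t\mid H_t\}}\,Y\right].$$ Then, in the nonparametric model for the law of $O$, the efficient influence function for $\psi^o_{\overline a}$ is $\varphi_{\overline a}(O;\psi_{\overline a}^o,\alpha_{\overline a}^o)$, where $$\varphi_{\overline a}(O;\psi_{\overline a},\alpha_{\overline a}):=\prod_{t=0}^T\frac{\{Z_t-\rho_t(H_t)\}A_t^{(a_t)}}{\kappa_{t,a_t}(H_t)}Y-\psi_{\overline a}+\sum_{t=0}^T\left(\prod_{s=0}^{t-1}\frac{\{Z_s-\rho_s(H_s)\}A_s^{(a_s)}}{\kappa_{s,a_s}(H_s)}\right)\left\{\left(1-\frac{\{Z_t-\rho_t(H_t)\}\{A_t^{(a_t)}-\delta_{t,a_t}(H_t)\}}{\kappa_{t,a_t}(H_t)}\right)\gamma_{t,\underline a_t}(H_t)-\frac{(Z_t-\rho_t(H_t))\eta_{t,\underline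 a_t}(H_t)}{\kappa_{t,a_t}(H_t)}\right\}.$$
   Context: Times $t=0,\dots,T$. At time $t$: $L_t$ observed confounders, $U_t$ unobserved confounders, $Z_t\in\mathbb{R}$ an instrument, $A_t\in\mathcal{A}_t$ a discrete treatment; $Y\in\mathbb{R}$ is an outcome observed at time $T+1$. Notation: $\overline{x}_t=[x_0,\dots,x_t]$, $\underline{x}_t=[x_t,\dots,x_T]$, $\overline{x}=\overline{x}_T$; empty products equal 1; $A_t^{(a_t)}=I\{A_t=a_t\}$. $H_t=[\overline{Z}_{t-1},\overline{A}_{t-1},\overline{L}_t]\in\mathcal{H}_t$ for $0\le t\le T$, $H_{T+1}=O=[\overline{Z}_T,\overline{A}_T,\overline{L}_T,Y]$. $Y(\overline a)$ is the potential outcome under treatment history $\overline a$; $Y(\underline a_t)=Y(\overline A_{t-1},\underline a_t)$. $Z_t$ is a regular weighting function for $A_t=a_t$ if it is uniformly bounded and there is $\epsilon_0>0$ with $|\mathrm{Cov}\{I\{A_t=a_t\},Z_t\mid H_t=h_t\}|\ge\epsilon_0$ for all $h_t\in\mathcal{H}_t$. True nuisance functions: $\gamma^o_{T+1,\underline a_{T+1}}(H_{T+1}):=Y$, and recursively for $t=T,\dots,0$: $\kappa^o_{t,a_t}(H_t)=\mathrm{Cov}\{A_t^{(a_t)},Z_t\mid H_t\}$, $\delta^o_{t,a_t}(H_t)=\mathbb{E}[A_t^{(a_t)}\mid H_t]$, $\rho^o_t(H_t)=\mathbb{E}[Z_t\mid H_t]$, $\eta^o_{t,\underline a_t}(H_t)=\mathbb{E}[A_t^{(a_t)}\gamma^o_{t+1,\underline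 a_{t+1}}(H_{t+1})\mid H_t]$, $\gamma^o_{t,\underline a_t}(H_t)=\mathrm{Cov}\{A_t^{(a_t)}\gamma^o_{t+1,\underline a_{t+1}}(H_{t+1}),Z_t\mid H_t\}/\mathrm{Cov}\{A_t^{(a_t)},Z_t\mid H_t\}$. $\alpha^o_{\overline a}=\{\alpha^o_{t,\underline a_t}\}_{t=0}^T$ with $\alpha^o_{t,\underline a_t}=[\delta^o_{t,a_t},\kappa^o_{t,a_t},\rho^o_t,\eta^o_{t,\underline a_t},\gamma^o_{t,\underline a_t}]$; $\alpha_{\overline a}$ without superscript denotes a generic such vector. The semiparametric analysis is in the fully nonparametric model for the observed data (tangent space equal to all mean-zero square-integrable functions of $O$), so the efficient influence function is the unique mean-zero square-integrable $\varphi$ with $\frac{d}{d\theta}\psi_{\overline a}(P_\theta)|_{\theta=0}=\mathbb{E}[\varphi(O)s(O)]$ for every regular parametric submodel $P_\theta$ through the true law with score $s$ at $\theta=0$, where $\psi_{\overline a}(P)$ is the displayed functional evaluated under $P$.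
   Formalization: Assumes E[Y²] finite under the true law, without which φ need not be square-integrable; regular submodels are differentiable in quadratic mean with |Z_t| bounded, |κ_t| bounded away from 0 and E[Y²] bounded uniformly near θ=0. *)

(* Defs.v *)
From HB Require Import structures.
From mathcomp Require Import all_boot all_order all_algebra.
From mathcomp Require Import all_classical all_reals all_analysis.

Set Implicit Arguments.
Unset Strict Implicit.
Unset Printing Implicit Defensive.

Import Order.TTheory GRing.Theory Num.Theory.
Import numFieldNormedType.Exports.

Local Open Scope classical_set_scope.
Local Open Scope ring_scope.

(* Dependent product of measurable spaces, with the sigma-algebra generated by
   the coordinate projections. *)
Definition cylinder (I : Type) (d : I -> measure_display)
    (X : forall i, measurableType (d i)) : set (set (forall i, X i)) :=
  [set S | exists i, exists2 B : set (X i),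
     measurable B & S = [set f | B (f i)]].

Definition prod_space (I : Type) (d : I -> measure_display)
    (X : forall i, measurableType (d i)) :=
  g_sigma_algebraType (@cylinder I d X).

Section conditioning.
Context {d d' : measure_display} {W : measurableType d} {V : measurableType d'}
        {R : realType}.
Variables (Q : probability W R) (H : W -> V).

Definition is_condE (X : W -> R) (g : V -> R) : Prop :=
  [/\ measurable_fun setT g,
      Q.-integrable setT (EFin \o (g \o H)) &
      forall B : set V, measurable B ->
        (\int[Q]_(w in H @^-1` B) (g (H w))%:E =
         \int[Q]_(w in H @^-1` B) (X w)%:E)%E].

(* [condE X v] is E[X | H = v], for an arbitrarily chosen version. Versions
   agree almost everywhere for the law of H, so only statements that do not
   depend on the version are meaningful. *)
Definition condE (X : W -> R) : V -> R := xget (cst 0) (is_condE X).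

Definition condCov (X Z : W -> R) : V -> R :=
  condE (fun w => (X w - condE X (H w)) * (Z w - condE Z (H w))).

End conditioning.

Definition cond_indep d d' d1 d2 (W : measurableType d) (V : measurableType d')
    (S1 : measurableType d1) (S2 : measurableType d2) (R : realType)
    (P : probability W R) (X1 : W -> S1) (X2 : W -> S2) (H : W -> V) : Prop :=
  forall (B1 : set S1) (B2 : set S2), measurable B1 -> measurable B2 ->
    {ae P, forall w,
       condE P H (\1_(X1 @^-1` B1 `&` X2 @^-1` B2) : W -> R) (H w) =
       condE P H (\1_(X1 @^-1` B1) : W -> R) (H w) *
       condE P H (\1_(X2 @^-1` B2) : W -> R) (H w)}.

Definition discrete_space d (X : measurableType d) : Prop :=
  countable [set: X] /\ forall B : set X, measurable B.

(* The time t ranges over 'I_T.+1 = {0, ..., T}. *)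
Definition before (T : nat) (t : 'I_T.+1) (s : 'I_t) : 'I_T.+1 :=
  widen_ord (ltnW (ltn_ord t)) s.

Definition upto (T : nat) (t : 'I_T.+1) (s : 'I_t.+1) : 'I_T.+1 :=
  widen_ord (ltn_ord t) s.

Section observed_data.
Context {R : realType} {T : nat} {dA dL : 'I_T.+1 -> measure_display}.
Variables (calA : forall t, measurableType (dA t))
          (calL : forall t, measurableType (dL t)).

(* Values of O = (Z_0..Z_T, A_0..A_T, L_0..L_T, Y). *)
Definition obs :=
  (prod_space (fun _ : 'I_T.+1 => measurableTypeR R) *
   prod_space calA * prod_space calL * measurableTypeR R)%type.

(* Values of H_t = (Z_0..Z_(t-1), A_0..A_(t-1), L_0..L_t). *)
Definition hist (t : 'I_T.+1) :=
  (prod_space (fun _ : 'I_t => measurableTypeR R) *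
   prod_space (fun s : 'I_t => calA (before s)) *
   prod_space (fun s : 'I_t.+1 => calL (upto s)))%type.

Definition obsZ (t : 'I_T.+1) (o : obs) : R := o.1.1.1 t.
Definition obsA (t : 'I_T.+1) (o : obs) : calA t := o.1.1.2 t.
Definition obsL (t : 'I_T.+1) (o : obs) : calL t := o.1.2 t.
Definition obsY (o : obs) : R := o.2.

Definition obsH (t : 'I_T.+1) (o : obs) : hist t :=
  ((fun s : 'I_t => obsZ (before s) o), (fun s : 'I_t => obsA (before s) o),
   (fun s : 'I_t.+1 => obsL (upto s) o)).

Variable a : forall t, calA t.

Definition obsAind (t : 'I_T.+1) (o : obs) : R := \1_[set a t] (obsA t o).

(* The vector alpha_(t, a_t..a_T); the components are arbitrary functions, the
   ones derived from a law are in [nuisance_true]. *)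
Record nuisance (t : 'I_T.+1) := Nuisance {
  delta : hist t -> R;
  kappa : hist t -> R;
  rho   : hist t -> R;
  eta   : hist t -> R;
  gamma : hist t -> R }.

Section functionals_of_the_law.
Variable Q : probability obs R.

Definition kappa_true (t : 'I_T.+1) : hist t -> R :=
  condCov Q (obsH t) (obsAind t) (obsZ t).

Definition gamma_step (t : 'I_T.+1) (g : obs -> R) : hist t -> R :=
  fun h => condCov Q (obsH t) (fun o => obsAind t o * g o) (obsZ t) h /
           kappa_true h.

(* [gamma_rv k] is the random variable gamma_u(H_u) for u = T + 1 - k. *)
Fixpoint gamma_rv (k : nat) : obs -> R :=
  if k is k'.+1 then
    let t : 'I_T.+1 := inord (T - k') in
    fun o => gamma_step (gamma_rv k') (obsH t o)
  else obsY.

Definition nuisance_true (t : 'I_T.+1) : nuisance t := {|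
  delta := condE Q (obsH t) (obsAind t);
  kappa := @kappa_true t;
  rho   := condE Q (obsH t) (obsZ t);
  eta   := condE Q (obsH t) (fun o => obsAind t o * gamma_rv (T - t) o);
  gamma := gamma_step (gamma_rv (T - t)) |}.

Definition psi : R :=
  \int[Q]_o
    ((\prod_(t < T.+1)
        ((obsZ t o - condE Q (obsH t) (obsZ t) (obsH t o)) * obsAind t o /
         condCov Q (obsH t) (obsAind t) (obsZ t) (obsH t o))) * obsY o).

Definition weighting_bounds (M eps : R) (t : 'I_T.+1) : Prop :=
  {ae Q, forall o, `|obsZ t o| <= M} /\
  {ae Q, forall o,
     eps <= `|condCov Q (obsH t) (obsAind t) (obsZ t) (obsH t o)|}.

(* Bounds hold almost surely: the conditional covariance given H_t = h is only
   determined up to null sets of the law of H_t. *)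
Definition regular_weighting (t : 'I_T.+1) : Prop :=
  exists M eps : R, 0 < eps /\ weighting_bounds M eps t.

End functionals_of_the_law.

Definition cov_weight (alpha : forall t, nuisance t) (t : 'I_T.+1) (o : obs) : R :=
  (obsZ t o - rho (alpha t) (obsH t o)) * obsAind t o /
  kappa (alpha t) (obsH t o).

Definition phi (psi0 : R) (alpha : forall t, nuisance t) (o : obs) : R :=
  (\prod_(t < T.+1) cov_weight alpha t o) * obsY o - psi0 +
  \sum_(t < T.+1)
    (\prod_(s < T.+1 | (s < t)%N) cov_weight alpha s o) *
    ((1 - (obsZ t o - rho (alpha t) (obsH t o)) *
          (obsAind t o - delta (alpha t) (obsH t o)) /
          kappa (alpha t) (obsH t o)) * gamma (alpha t) (obsH t o) -
     (obsZ t o - rho (alpha t) (obsH t o)) * eta (alpha t) (obsH t o) /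
     kappa (alpha t) (obsH t o)).

(* One-dimensional submodels P_theta through Q at theta = 0 with score s: a
   dominated family, differentiable in quadratic mean at 0, along which the
   conditions that make [psi] well defined (bounded instruments, conditional
   covariances away from 0, square-integrable outcome) hold uniformly near 0.
   The last point is needed because expectations of unbounded variables may
   fail to be differentiable along paths that are merely differentiable in
   quadratic mean. Only the germ of theta |-> P_theta at 0 matters. *)
Definition regular_submodel (Q : probability obs R) (s : obs -> R)
    (Pth : R -> probability obs R) : Prop :=
  [/\ forall B : set obs, measurable B -> Pth 0 B = Q B,
      s \in Lfun Q 2%:E,
      exists (nu : {measure set obs -> \bar R}) (p : R -> obs -> R),
        [/\ sigma_finite setT nu,
            \forall th \near (0 : R),
              [/\ measurable_fun setT (p th), (forall o, 0 <= p th o) &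
                  forall B : set obs, measurable B ->
                    Pth th B = (\int[nu]_(o in B) (p th o)%:E)%E] &
            (fun th : R => (th ^- 2)%:E *
               \int[nu]_o ((Num.sqrt (p th o) - Num.sqrt (p 0 o) -
                            th / 2 * s o * Num.sqrt (p 0 o)) ^+ 2)%:E)%E
              @ (0 : R)^' --> 0%E] &
      exists M eps C : R, 0 < eps /\
        \forall th \near (0 : R),
          (forall t, weighting_bounds (Pth th) M eps t) /\
          (\int[Pth th]_o ((obsY o) ^+ 2)%:E <= C%:E)%E].

(* f is mean zero, square integrable, and represents the pathwise derivative
   of Psi along all regular submodels through Q. *)
Definition influence_function (Q : probability obs R)
    (Psi : probability obs R -> R) (f : obs -> R) : Prop :=
  [/\ f \in Lfun Q 2%:E,
      \int[Q]_o f o = 0 &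
      forall (s : obs -> R) (Pth : R -> probability obs R),
        regular_submodel Q s Pth ->
        is_derive (0 : R) (1 : R) (fun th => Psi (Pth th))
          (\int[Q]_o (f o * s o))].

(* The model is nonparametric (the tangent space is the whole space of mean-zero
   square-integrable functions), so the efficient influence function is the
   unique influence function. *)
Definition efficient_influence_function (Q : probability obs R)
    (Psi : probability obs R -> R) (f : obs -> R) : Prop :=
  influence_function Q Psi f /\
  forall g, influence_function Q Psi g -> {ae Q, forall o, g o = f o}.

End observed_data.

(* Main.v *)
(* With the weights w_t = (Z_t - rho_t) A_t / kappa_t of a law, the definition
   of gamma gives E[w_0 ... w_(t-1) gamma_t] = E[w_0 ... w_t gamma_(t+1)], hence
   psi = E[gamma_0]. Along a path P_th, freeze the weights at their values for
   P_0 and telescope: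
     psi(P_th) = E_th[w_0 ... w_T Y]
       + sum_t E_th[w_0 ... w_(t-1) gamma_t] - E_th[w_0 ... w_t gamma_(t+1)],
   where only gamma depends on th. Each difference is a sum of terms
   E_th[g_th(H_t) X] in which X is one of Z_t - rho_t and
   (Z_t - rho_t) (A_t - delta_t) - kappa_t, and so is centered given H_t under
   P_0. The derivative of such a term at 0 is E_0[g_0(H_t) X s]: the family
   g_th need not be differentiable, closeness to g_0 in the mean is enough,
   because E_th[f(H_t) X] is O(th) uniformly for f bounded in L2, and o(th)
   when f is moreover small in the mean. Adding up gives E_0[phi s].
   Uniqueness: every bounded mean-zero function is, up to a factor, the score of
   a tilt (1 + th s) dQ, which is a regular submodel, and these scores determine
   a mean-zero function. *)
Require Import Defs.
From HB Require Import structures.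
From mathcomp Require Import all_boot all_order all_algebra.
From mathcomp Require Import all_classical all_reals all_analysis.
From mathcomp Require Import measurable_realfun ring lra.

Set Implicit Arguments.
Unset Strict Implicit.
Unset Printing Implicit Defensive.

Import Order.TTheory GRing.Theory Num.Theory.
Import numFieldNormedType.Exports.

Local Open Scope classical_set_scope.
Local Open Scope ring_scope.

(** * Measures with a density *)

(** Versions of conditional expectations are chosen separately for each law, so nothing relates
    [g_th] to [g_0] pointwise, and a null set of [Pth 0] need not be null for [Pth th]. Hence frozen
    weights are made bounded everywhere, and closeness is measured under the moving law, against a
    common bounded function. The outcome has only a second moment, so gamma and eta are controlled
    only in L2, and the O(th) bound for E_th[f X] must be uniform over L2 balls. It comes from the
    projection r of X on H under [Pth th]: E_th[r^2] = E_th[r X] - E_0[r X] is an increment of order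
    th times the norm of r, so r is O(th) in L2. The part of r on a set of small probability is even
    o(th), by absolute continuity of the integral of s^2; this gives o(th) for f small in the mean.
    Freezing the weights leaves no second-order remainder: given H_t, under [Pth th], the residual A
    G - eta - gamma (A - delta) is centered and uncorrelated with Z, where G is the next gamma. The
    telescoping differences are therefore exact sums of centered terms, one of which has coefficient
    proportional to delta_th - delta_0 and drops out of the derivative. *)

Section density.
Context d (T : measurableType d) (R : realType) (mu : {measure set T -> \bar R}).
Variables (p : T -> R) (mp : measurable_fun setT p) (p0 : forall x, 0 <= p x).
Local Open Scope ereal_scope.

Definition density_measure (A : set T) : \bar R := \int[mu]_(x in A) (p x)%:E.

Let density0 : density_measure set0 = 0.
Proof. exact: integral_set0. Qed.

Let density_ge0 A : 0 <= density_measure A.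
Proof. by apply: integral_ge0 => x _; rewrite lee_fin. Qed.

Let density_sigma : semi_sigma_additive density_measure.
Proof.
apply: semi_sigma_additive_nng_induced; first exact/measurable_EFinP.
by move=> x; rewrite lee_fin.
Qed.

HB.instance Definition _ :=
  isMeasure.Build _ _ _ density_measure density0 density_ge0 density_sigma.

Definition density_meas : {measure set T -> \bar R} := density_measure.

Import HBNNSimple.

(** Linearity settles simple functions; monotone convergence along [nnsfun_approx], on both sides,
    does the rest. *)
Lemma ge0_integral_density (f : T -> \bar R) : measurable_fun setT f ->
  (forall x, 0 <= f x) ->
  \int[density_measure]_x f x = \int[mu]_x (f x * (p x)%:E).
Proof.
move=> mf f0; have mp' : measurable_fun setT (EFin \o p) by exact/measurable_EFinP.
have mE := @measurableT _ T.
pose h := nnsfun_approx mE mf.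
have mh n : measurable_fun setT (EFin \o h n) by exact/measurable_EFinP.
have hf x : (EFin \o h n) x @[n --> \oo] --> f x by exact: cvg_nnsfun_approx.
have -> : \int[density_measure]_x f x =
    lim (\int[density_measure]_x (EFin \o h n) x @[n --> \oo]).
  under eq_integral => x _ do rewrite -(cvg_lim _ (hf x))//.
  apply: monotone_convergence => //.
  - by move=> n x _; rewrite /= lee_fin.
  - by move=> x _ a b ab; rewrite lee_fin; exact/lefP/nd_nnsfun_approx.
have -> : \int[mu]_x (f x * (p x)%:E) =
    lim (\int[mu]_x ((h n x)%:E * (p x)%:E) @[n --> \oo]).
  have hfp x : (fun n : nat => (h n x)%:E * (p x)%:E) @ \oo --> f x * (p x)%:E.
    by apply: cvgeZr; [|exact: hf].
  under eq_integral => x _ do rewrite -(cvg_lim _ (hfp x))//.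
  apply: monotone_convergence => //.
  - move=> n; apply: emeasurable_funM; [exact: (mh n)|exact: mp'].
  - by move=> n x _; rewrite mule_ge0// lee_fin.
  - move=> x _ a b ab; rewrite lee_wpmul2r ?lee_fin//.
    exact/lefP/nd_nnsfun_approx.
suff suf n : \int[density_measure]_x (EFin \o h n) x =
    \int[mu]_x ((h n x)%:E * (p x)%:E).
  by under eq_fun do rewrite suf.
transitivity (\int[density_measure]_x
   (\sum_(y \in range (h n)) (y * \1_(h n @^-1` [set y]) x)%:E)).
  by apply: eq_integral => t _; rewrite /= fimfunE -fsumEFin.
rewrite ge0_integral_fsum//; last 2 first.
- by move=> r; apply/measurable_EFinP; exact: measurable_funM.
- by move=> m y _; exact: nnfun_muleindic_ge0.
transitivity (\int[mu]_x (\sum_(y \in range (h n))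
    (y * \1_(h n @^-1` [set y]) x)%:E * (p x)%:E)); last first.
  apply: eq_integral => x _.
  rewrite -ge0_mule_fsuml => [|y]; last exact: nnfun_muleindic_ge0.
  by rewrite fsumEFin // -(fimfunE _ x).
rewrite ge0_integral_fsum//; last 2 first.
- move=> y; apply: emeasurable_funM => //.
  by apply/measurable_EFinP; exact: measurable_funM.
- by move=> m y _; rewrite mule_ge0 ?lee_fin// -lee_fin nnfun_muleindic_ge0.
apply: eq_fsbigr => r; rewrite inE => -[t _ <-].
have mS : measurable (h n @^-1` [set h n t]) by [].
under eq_integral do rewrite EFinM.
rewrite ge0_integralZl//; last 2 first.
- exact/measurable_EFinP.
- by rewrite lee_fin.
rewrite integral_indic// setIT.
under [RHS]eq_integral do rewrite EFinM -muleA.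
rewrite ge0_integralZl//; last 3 first.
- by apply: emeasurable_funM => //; exact/measurable_EFinP.
- by move=> x _; rewrite mule_ge0 ?lee_fin.
- by rewrite lee_fin.
congr (_ * _); rewrite [LHS]integral_mkcond.
by apply: eq_integral => x _; rewrite epatch_indic muleC.
Qed.

End density.

(** [nu] only has to agree with the image measure on measurable sets. With [H] the identity this is
    the change of density used for paths of laws. *)
Lemma ge0_integral_pushforward_density d1 d2 (T : measurableType d1)
    (V : measurableType d2) (R : realType) (mu : {measure set T -> \bar R})
    (nu : {measure set V -> \bar R}) (H : T -> V) (p : T -> R) (f : V -> \bar R) :
  measurable_fun setT H -> measurable_fun setT p -> (forall x, 0 <= p x) ->
  (forall B, measurable B -> nu B = (\int[mu]_(x in H @^-1` B) (p x)%:E)%E) ->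
  measurable_fun setT f -> (forall y, (0 <= f y)%E) ->
  (\int[nu]_y f y = \int[mu]_x (f (H x) * (p x)%:E))%E.
Proof.
move=> mH mp p0 nuE mf f0.
rewrite (eq_measure_integral (pushforward (density_measure mu p) H)); last first.
  by move=> A mA _; exact: nuE.
rewrite ge0_integral_pushforward// ge0_integral_density//=.
exact: (measurableT_comp mf mH).
Qed.

(** * Integrable, square-integrable and bounded functions *)

Section integrability.
Context d (T : measurableType d) (R : realType).
Implicit Types (mu : {measure set T -> \bar R}) (P : probability T R).
Implicit Types (f g h : T -> R) (a b k C K : R).

Definition int1 mu f := mu.-integrable setT (EFin \o f).

Definition sqint mu f :=
  measurable_fun setT f /\ int1 mu (fun w => f w ^+ 2).

Definition essbd mu f :=
  measurable_fun setT f /\ exists K : R, {ae mu, forall w, `|f w| <= K}.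

Lemma int1_meas mu f : int1 mu f -> measurable_fun setT f.
Proof. by move=> /measurable_int/measurable_EFinP. Qed.

Lemma int1_le_ae mu f g : measurable_fun setT f -> int1 mu g ->
  {ae mu, forall w, `|f w| <= g w} -> int1 mu f.
Proof.
move=> mf ig fg; apply/integrableP; split; first exact/measurable_EFinP.
have /integrableP[mg goo] := ig.
apply: le_lt_trans goo; apply: ae_ge0_le_integral => //.
- by apply: measurableT_comp => //; exact/measurable_EFinP.
- exact: measurableT_comp.
- apply: filterS fg => w fgw _; rewrite lee_fin.
  exact: (le_trans fgw (ler_norm _)).
Qed.

Lemma int1_le mu f g : measurable_fun setT f -> int1 mu g ->
  (forall w, `|f w| <= g w) -> int1 mu f.
Proof. by move=> mf ig fg; apply: (int1_le_ae mf ig); exact: aeW. Qed.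

Lemma int1D mu f g : int1 mu f -> int1 mu g -> int1 mu (fun w => f w + g w).
Proof. by move=> fi gi; exact: (integrableD measurableT fi gi). Qed.

Lemma int1B mu f g : int1 mu f -> int1 mu g -> int1 mu (fun w => f w - g w).
Proof. by move=> fi gi; exact: (integrableB measurableT fi gi). Qed.

Lemma int1Z mu k f : int1 mu f -> int1 mu (fun w => k * f w).
Proof. by move=> fi; exact: (integrableZl measurableT k fi). Qed.

Lemma int1_norm mu f : int1 mu f -> int1 mu (fun w => `|f w|).
Proof. exact: integrable_norm. Qed.

Lemma int1_cst P k : int1 P (fun=> k).
Proof. exact: finite_measure_integrable_cst. Qed.

Lemma int1_pos_neg mu f : int1 mu f ->
  [/\ int1 mu (fun w => Num.max (f w) 0), int1 mu (fun w => Num.max (- f w) 0) &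
      forall w, f w = Num.max (f w) 0 - Num.max (- f w) 0].
Proof.
move=> fi; have mf := int1_meas fi; split.
- apply: int1_le (int1_norm fi) _; first exact: measurable_maxr.
  by move=> w; rewrite ger0_norm ?le_max ?lexx ?orbT// ge_max normr_ge0 ler_norm.
- apply: int1_le (int1_norm fi) _.
    by apply: measurable_maxr => //; exact: measurableT_comp.
  by move=> w; rewrite ger0_norm ?le_max ?lexx ?orbT// ge_max normr_ge0 -normrN ler_norm.
- by move=> w; case: (leP (f w) 0) => h; [rewrite max_l|rewrite max_r]; lra.
Qed.

Lemma sqint_meas mu f : sqint mu f -> measurable_fun setT f.
Proof. by case. Qed.

Lemma sqint_int1M mu f g : sqint mu f -> sqint mu g ->
  int1 mu (fun w => f w * g w).
Proof.
move=> [mf f2] [mg g2]; apply: int1_le (int1D f2 g2) _; first exact: measurable_funM.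
move=> w; have := sqr_ge0 (`|f w| - `|g w|).
have := sqr_ge0 (`|f w| + `|g w|).
rewrite normrM -[f w ^+ 2]real_normK ?num_real// -[g w ^+ 2]real_normK ?num_real//.
nra.
Qed.

Lemma sqint_int1 P f : sqint P f -> int1 P f.
Proof.
move=> [mf f2]; apply: int1_le (int1D f2 (int1_cst P 1)) _ => // w.
rewrite -[f w ^+ 2]real_normK ?num_real//; have := normr_ge0 (f w); nra.
Qed.

Lemma sqintD mu f g : sqint mu f -> sqint mu g -> sqint mu (fun w => f w + g w).
Proof.
move=> fs gs; have [mf f2] := fs; have [mg g2] := gs.
split; first exact: measurable_funD.
have := int1D (int1D f2 g2) (int1Z 2 (sqint_int1M fs gs)).
by congr (int1 mu _); apply/funext => w; ring.
Qed.

Lemma sqintZ mu k f : sqint mu f -> sqint mu (fun w => k * f w).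
Proof.
move=> [mf f2]; split; first exact: measurable_funM.
by have := int1Z (k ^+ 2) f2; congr (int1 mu _); apply/funext => w; ring.
Qed.

Lemma sqintN mu f : sqint mu f -> sqint mu (fun w => - f w).
Proof.
by move=> /(sqintZ (-1)); congr (sqint mu _); apply/funext => w; rewrite mulN1r.
Qed.

Lemma sqintB mu f g : sqint mu f -> sqint mu g -> sqint mu (fun w => f w - g w).
Proof. by move=> fs gs; exact: sqintD fs (sqintN gs). Qed.

Lemma essbdM mu f g : essbd mu f -> essbd mu g -> essbd mu (fun w => f w * g w).
Proof.
move=> [mf [K fK]] [mg [L gL]]; split; first exact: measurable_funM.
exists (K * L); apply: filterS2 fK gL => w fK gL.
by rewrite normrM ler_pM.
Qed.

Lemma essbdD mu f g : essbd mu f -> essbd mu g -> essbd mu (fun w => f w + g w).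
Proof.
move=> [mf [K fK]] [mg [L gL]]; split; first exact: measurable_funD.
exists (K + L); apply: filterS2 fK gL => w fK gL.
by rewrite (le_trans (ler_normD _ _))// lerD.
Qed.

Lemma essbd_cst mu k : essbd mu (fun=> k).
Proof. by split; [exact: measurable_cst|exists `|k|; exact: aeW]. Qed.

Lemma essbdN mu f : essbd mu f -> essbd mu (fun w => - f w).
Proof.
move=> [mf [K fK]]; split; first exact: measurableT_comp.
by exists K; apply: filterS fK => w; rewrite normrN.
Qed.

Lemma essbdB mu f g : essbd mu f -> essbd mu g -> essbd mu (fun w => f w - g w).
Proof. by move=> fb gb; exact: essbdD fb (essbdN gb). Qed.

Lemma sqintM mu f g : essbd mu f -> sqint mu g -> sqint mu (fun w => f w * g w).
Proof.
move=> [mf [K fK]] [mg g2]; split; first exact: measurable_funM.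
apply: int1_le_ae (int1Z (K ^+ 2) g2) _.
  by apply: measurable_funX; exact: measurable_funM.
apply: filterS fK => w fK.
rewrite normrX normrM exprMn [`|g w| ^+ 2]real_normK ?num_real//.
by rewrite ler_wpM2r ?sqr_ge0// lerXn2r// nnegrE ?(le_trans _ fK).
Qed.

Lemma sqintMr mu f g : sqint mu f -> essbd mu g -> sqint mu (fun w => f w * g w).
Proof.
move=> fs gb; have := sqintM gb fs.
by congr (sqint mu _); apply/funext => w; rewrite mulrC.
Qed.

Lemma essbd_sqint P f : essbd P f -> sqint P f.
Proof.
move=> fb; have c1 : sqint P (fun=> 1).
  by split; [exact: measurable_cst|exact: int1_cst].
by have := sqintM fb c1; congr (sqint P _); apply/funext => w; rewrite mulr1.
Qed.

Lemma sqint_norm mu f : sqint mu f -> sqint mu (fun w => `|f w|).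
Proof.
move=> [mf f2]; split; first exact: measurableT_comp.
by move: f2; congr (int1 mu _); apply/funext => w; rewrite real_normK ?num_real.
Qed.

Lemma essbd_le mu f K : measurable_fun setT f -> (forall w, `|f w| <= K) ->
  essbd mu f.
Proof. by move=> mf fK; split=> //; exists K; exact: aeW. Qed.

Lemma essbd_indic mu (A : set T) : measurable A -> essbd mu (\1_A : T -> R).
Proof.
move=> mA; apply: (@essbd_le _ _ 1); first exact: measurable_indic.
by move=> w; rewrite indicE ger0_norm ?ler0n// lern1; case: (_ \in _).
Qed.

Lemma sqint_le mu f g : measurable_fun setT f -> sqint mu g ->
  (forall w, `|f w| <= `|g w|) -> sqint mu f.
Proof.
move=> mf [mg g2] fg; split => //; apply: int1_le g2 _; first exact: measurable_funX.
move=> w; rewrite normrX -[g w ^+ 2]real_normK ?num_real//.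
by rewrite lerXn2r ?nnegrE.
Qed.

Lemma ae_Rintegral mu f g : measurable_fun setT f -> measurable_fun setT g ->
  {ae mu, forall w, f w = g w} -> \int[mu]_w f w = \int[mu]_w g w.
Proof.
move=> mf mg fg; congr fine; apply: ae_eq_integral => //; try exact/measurable_EFinP.
by apply: filterS fg => w -> _.
Qed.

Lemma ae_le_Rintegral mu f g : int1 mu f -> int1 mu g ->
  {ae mu, forall w, f w <= g w} -> \int[mu]_w f w <= \int[mu]_w g w.
Proof.
move=> fi gi fg; rewrite -subr_ge0 -RintegralB//.
have mB : measurable_fun setT (fun w => g w - f w).
  by apply: int1_meas (int1B gi fi).
rewrite (@ae_Rintegral _ _ (fun w => `|g w - f w|))//.
- by apply: Rintegral_ge0 => w _.
- exact: measurableT_comp.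
- by apply: filterS fg => w fg; rewrite ger0_norm// subr_ge0.
Qed.

Lemma EFin_Rintegral mu f : int1 mu f ->
  ((\int[mu]_w f w)%:E = \int[mu]_w (f w)%:E)%E.
Proof. by move=> fi; rewrite fineK//; exact: integrable_fin_num. Qed.

Lemma int1_lty mu f C : measurable_fun setT f -> (forall w, 0 <= f w) ->
  (\int[mu]_w (f w)%:E <= C%:E)%E -> int1 mu f /\ \int[mu]_w f w <= C.
Proof.
move=> mf f0 fC; have fi : int1 mu f.
  apply/integrableP; split; first exact/measurable_EFinP.
  under eq_integral => w _ do rewrite /= ger0_norm//.
  exact: le_lt_trans fC (ltry _).
by split => //; rewrite -lee_fin EFin_Rintegral.
Qed.

Lemma Rintegral_sqr_eq0 mu f : sqint mu f -> \int[mu]_w (f w ^+ 2) <= 0 ->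
  {ae mu, forall w, f w = 0}.
Proof.
move=> [mf f2] f0; have : (\int[mu]_w `|(f w ^+ 2)%:E| = 0)%E.
  under eq_integral do rewrite /= ger0_norm ?sqr_ge0//.
  rewrite -EFin_Rintegral//; congr EFin; apply/eqP; rewrite eq_le f0 /=.
  by apply: Rintegral_ge0 => w _; exact: sqr_ge0.
have mf2 : measurable_fun setT (fun w => (f w ^+ 2)%:E).
  by apply/measurable_EFinP; exact: measurable_funX.
move/(ae_eq_integral_abs mu measurableT mf2).
by apply: filterS => w /(_ I)[] /eqP; rewrite sqrf_eq0 => /eqP.
Qed.

(** Young's inequality with weights b / (2 a) and a / (2 b), integrated. Positive bounds in place of
    the norms avoid square roots and the case of a zero norm. *)
Lemma Rintegral_CS mu f g a b : 0 < a -> 0 < b -> sqint mu f -> sqint mu g ->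
  \int[mu]_w (f w ^+ 2) <= a ^+ 2 -> \int[mu]_w (g w ^+ 2) <= b ^+ 2 ->
  \int[mu]_w `|f w * g w| <= a * b.
Proof.
move=> a0 b0 fs gs fa gb; have [mf f2] := fs; have [mg g2] := gs.
have fg := sqint_int1M fs gs.
have -> : a * b = (b / (2 * a)) * a ^+ 2 + (a / (2 * b)) * b ^+ 2.
  by field; rewrite !gt_eqF.
apply: (@le_trans _ _ (\int[mu]_w
    ((b / (2 * a)) * f w ^+ 2 + (a / (2 * b)) * g w ^+ 2))).
  apply: le_Rintegral => //; first exact: int1_norm.
    by apply: int1D; exact: int1Z.
  move=> w _; rewrite normrM -[f w ^+ 2]real_normK ?num_real//.
  rewrite -[g w ^+ 2]real_normK ?num_real// -subr_ge0.
  have -> : b / (2 * a) * `|f w| ^+ 2 + a / (2 * b) * `|g w| ^+ 2 - `|f w| * `|g w|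
    = (b * `|f w| - a * `|g w|) ^+ 2 / (2 * a * b) by field; rewrite !gt_eqF.
  by rewrite divr_ge0 ?sqr_ge0// !mulr_ge0// ltW.
rewrite RintegralD//; [|exact: int1Z..].
rewrite !RintegralZl// lerD// ler_wpM2l//; by rewrite divr_ge0 ?mulr_ge0// ltW.
Qed.

Lemma Rintegral_CS_norm mu f g a b : 0 < a -> 0 < b -> sqint mu f -> sqint mu g ->
  \int[mu]_w (f w ^+ 2) <= a ^+ 2 -> \int[mu]_w (g w ^+ 2) <= b ^+ 2 ->
  `|\int[mu]_w (f w * g w)| <= a * b.
Proof.
move=> a0 b0 fs gs fa gb; apply: le_trans (Rintegral_CS a0 b0 fs gs fa gb).
by apply: le_normr_Rintegral => //; exact: sqint_int1M.
Qed.

(** Eventual equality replaces convergence here and in [Rintegral_dominated_lim], because both are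
    applied to truncations, which reach their limit at a finite level. *)
Lemma int1_nondecreasing_lim mu (u_ : nat -> T -> R) u C :
  (forall n, int1 mu (u_ n)) -> (forall n w, 0 <= u_ n w) ->
  (forall w, {homo u_^~ w : n m / (n <= m)%N >-> n <= m}) ->
  (forall w, \forall n \near \oo, u_ n w = u w) ->
  (forall n, \int[mu]_w u_ n w <= C) -> int1 mu u.
Proof.
move=> iu u0 und ulim uC.
have cu w : (fun n => (u_ n w)%:E) @ \oo --> (u w)%:E.
  by apply: cvg_near_cst; apply: filterS (ulim w) => n ->.
have mcv := @cvg_monotone_convergence _ _ _ mu setT measurableT
  (fun n w => (u_ n w)%:E).
have {mcv}mcv : (\int[mu]_w (u_ n w)%:E)%E @[n --> \oo] -->
    (\int[mu]_w (u w)%:E)%E.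
  under [X in _ --> X]eq_integral do rewrite -(cvg_lim _ (cu _))//.
  apply: mcv => [n|n w _|w _ n m nm]; first exact: measurable_int (iu n).
    by rewrite lee_fin.
  by rewrite lee_fin und.
have mu' : measurable_fun setT (fun w => (u w)%:E).
  apply: (@emeasurable_fun_cvg _ _ _ _ (fun n w => (u_ n w)%:E)) => //.
  by move=> n; exact: measurable_int (iu n).
apply: (@int1_lty _ _ C _ _ _).1 => //.
- exact/measurable_EFinP.
- by move=> w; near \oo => n; rewrite -(_ : u_ n w = u w)//; near: n; exact: ulim.
- rewrite -(cvg_lim _ mcv)//; apply: lime_le; first by apply/cvg_ex; eexists; exact: mcv.
  by apply: nearW => n; rewrite -EFin_Rintegral// lee_fin.
Unshelve. all: by end_near. Qed.

Lemma Rintegral_dominated_lim mu (u_ : nat -> T -> R) u c :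
  (forall n, measurable_fun setT (u_ n)) -> int1 mu u ->
  (forall n w, `|u_ n w| <= `|u w|) ->
  (forall w, \forall n \near \oo, u_ n w = u w) ->
  (forall n, \int[mu]_w u_ n w = c) -> \int[mu]_w u w = c.
Proof.
move=> mu_ iu ule ulim uc.
have iu_ n : int1 mu (u_ n) by apply: int1_le (int1_norm iu) _.
have [|||||_ _] := @dominated_convergence _ _ _ mu setT measurableT
  (fun n w => (u_ n w)%:E) (fun w => (u w)%:E) (fun w => `|u w|%:E).
- by move=> n; exact/measurable_EFinP.
- exact: measurable_int iu.
- apply: aeW => w _; apply: cvg_near_cst.
  by apply: filterS (ulim w) => n ->.
- exact: int1_norm.
- by apply: aeW => w n _; rewrite lee_fin.
move=> h; have hc : (fun n => \int[mu]_w (u_ n w)%:E)%E @ \oo --> c%:E.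
  by apply: cvg_near_cst; apply: nearW => n; rewrite -EFin_Rintegral// uc.
by rewrite /Rintegral (cvg_unique _ h hc).
Qed.

Lemma measurable_norm_gt f K : measurable_fun setT f -> measurable [set w | K < `|f w|].
Proof.
move=> mf; have mnf : measurable_fun setT (fun w => `|f w|) by exact: measurableT_comp.
rewrite -[X in measurable X]setTI (_ : mkset _ = (fun w => `|f w|) @^-1` `]K, +oo[%classic).
  by apply: mnf => //; exact: measurable_itv.
by apply/seteqP; split => w /=; rewrite in_itv/= andbT.
Qed.

Lemma Rintegral_prob_cst P k : \int[P]_w k = k.
Proof. by rewrite Rintegral_cst// [X in fine X]probability_setT mulr1. Qed.

Lemma Lfun2P mu f : f \in Lfun mu 2%:E <-> sqint mu f.
Proof.
split => [fL|[mf f2]].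
  split; last exact: Lfun2_integrable_sqr.
  by have /set_mem := sub_Lfun_mfun fL.
apply/andP; split; rewrite inE//= /finite_norm unlock.
apply: poweR_lty; have /integrableP[_] := f2; apply: le_lt_trans.
apply: ge0_le_integral => //.
- move=> w _; exact: poweR_ge0.
- apply/measurable_EFinP.
  apply/(@measurableT_comp _ _ _ _ _ _ (fun x : R => x `^ 2)%R) => //.
  exact/measurableT_comp.
- by apply: measurableT_comp => //; apply/measurable_EFinP; exact: measurable_funX.
- by move=> t _ /=; rewrite lee_fin normrX powR_mulrn.
Qed.

End integrability.

(** * Conditional expectation as an orthogonal projection *)

Section conditional_expectation.
Context d d' (W : measurableType d) (V : measurableType d') (R : realType).
Variables (P : probability W R) (H : W -> V) (mH : measurable_fun setT H).
Implicit Types (X : W -> R) (f g : V -> R).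

Let mpre (B : set V) : measurable B -> measurable (H @^-1` B).
Proof. by move=> mB; rewrite -[X in measurable X]setTI; exact: mH. Qed.

(** The image under [H] of the charge with density [X] is dominated by the law of [H]; its
    Radon-Nikodym derivative is the version sought. *)
Lemma condE_exists X : int1 P X -> exists g, is_condE P H X g.
Proof.
move=> iX.
pose Hm : {mfun W >-> V} := mfun_Sub (mem_set mH).
pose mu : probability V R := distribution P Hm.
pose nu : {charge set V -> \bar R} :=
  measure_function_pushforward__canonical__charge_Charge (induced_charge iX) mH.
have numu : nu `<< mu.
  apply/null_content_dominatesP => A mA A0.
  apply: null_set_integral => //; first exact: mpre.
  by apply: measurable_funTS; exact: measurable_int iX.
pose g := fine \o Radon_Nikodym nu mu.
have gE y : (g y)%:E = Radon_Nikodym nu mu y.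
  by rewrite fineK// Radon_Nikodym_fin_num.
have iRN := Radon_Nikodym_integrable numu.
have mg : measurable_fun setT g.
  apply/measurable_EFinP; rewrite (_ : EFin \o g = Radon_Nikodym nu mu).
    exact: measurable_int iRN.
  exact/funext.
have ig : P.-integrable setT (EFin \o (g \o H)).
  apply/integrableP; split.
    by apply/measurable_EFinP; exact: measurableT_comp.
  have /integrableP[_] := iRN; rewrite /mu /distribution.
  rewrite ge0_integral_pushforward//; last first.
    by apply: measurableT_comp => //; exact: measurable_int iRN.
  apply: le_lt_trans; rewrite le_eqVlt; apply/orP; left; apply/eqP.
  by apply: eq_integral => w _; rewrite /= -gE.
exists g; split => // B mB.
have -> : (\int[P]_(w in H @^-1` B) (X w)%:E = nu B)%E by [].
rewrite (Radon_Nikodym_integral numu mB) /mu /distribution.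
rewrite integral_pushforward//.
- by apply: eq_integral => w _ /=; rewrite gE.
- apply: (@integrableS _ _ _ _ setT) => //; first exact: mpre.
  by move: ig; congr (_.-integrable _ _); apply/funext => w; rewrite /= gE.
Qed.

Lemma condEP X : int1 P X -> is_condE P H X (condE P H X).
Proof. by move=> /condE_exists; exact: xgetPex. Qed.

(* The positive and negative parts of [D] have the same image under [H]. *)
Lemma Rintegral_pull0 (D : W -> R) f (K : R) : int1 P D ->
  (forall B, measurable B -> \int[P]_(w in H @^-1` B) D w = 0) ->
  measurable_fun setT f -> (forall y, `|f y| <= K) ->
  \int[P]_w (f (H w) * D w) = 0.
Proof.
move=> iD D0 mf fK; have [iDp iDm DE] := int1_pos_neg iD.
pose Dp w : R := Num.max (D w) 0; pose Dm w : R := Num.max (- D w) 0.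
have Dp0 w : 0 <= Dp w by rewrite le_max lexx orbT.
have Dm0 w : 0 <= Dm w by rewrite le_max lexx orbT.
have mDp : measurable_fun setT Dp := int1_meas iDp.
have mDm : measurable_fun setT Dm := int1_meas iDm.
have eqnu B : measurable B ->
    pushforward (density_measure P Dp) H B = pushforward (density_measure P Dm) H B.
  move=> mB; rewrite /pushforward /density_measure.
  have iS (p : W -> R) : int1 P p -> P.-integrable (H @^-1` B) (EFin \o p).
    by move=> i; apply: integrableS i => //; exact: mpre.
  have := D0 _ mB; rewrite /Rintegral.
  under eq_integral do rewrite DE EFinB.
  rewrite integralB//; [|exact: mpre|exact: iS..].
  rewrite fineB; [|apply: integrable_fin_num; [exact: mpre|exact: iS]..].
  move=> /eqP; rewrite subr_eq0 => /eqP h.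
  rewrite -[LHS]fineK; last by apply: integrable_fin_num; [exact: mpre|exact: iS].
  rewrite -[RHS]fineK; last by apply: integrable_fin_num; [exact: mpre|exact: iS].
  by rewrite h.
have pull g : measurable_fun setT g -> (forall y, 0 <= g y) ->
    \int[P]_w (g (H w) * Dp w) = \int[P]_w (g (H w) * Dm w).
  move=> mg g0; rewrite /Rintegral; congr fine.
  have mg' : measurable_fun setT (EFin \o g) by exact/measurable_EFinP.
  have h (p : W -> R) : measurable_fun setT p -> (forall x, 0 <= p x) ->
      (\int[P]_x (g (H x) * p x)%:E =
       \int[pushforward (density_measure P p) H]_y (EFin \o g) y)%E.
    move=> mp p0.
    rewrite (@ge0_integral_pushforward_density _ _ _ _ _ P _ H p)//.
  rewrite h// h//; apply: eq_measure_integral => B mB _; exact: eqnu.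
have essf : essbd P (f \o H).
  by apply: (@essbd_le _ _ _ _ _ K) => [|w]; [exact: measurableT_comp|exact: fK].
have bdi g : measurable_fun setT g -> (exists L : R, forall y, `|g y| <= L) ->
    forall D', int1 P D' -> int1 P (fun w => g (H w) * D' w).
  move=> mg [L gL] D' iD'.
  apply: int1_le (int1Z L (int1_norm iD')) _.
    by apply: measurable_funM; [exact: measurableT_comp|exact: int1_meas iD'].
  by move=> w; rewrite normrM ler_wpM2r.
(* [pull] accepts only nonnegative functions, so [f] is written as [f + K] minus the constant
   [K]. *)
have mfK : measurable_fun setT (fun y => f y + K) by exact: measurable_funD.
have fKb : exists L : R, forall y, `|f y + K| <= L.
  by exists (K + `|K|) => y; rewrite (le_trans (ler_normD _ _))// lerD.
have fK0 y : 0 <= f y + K by move: (fK y); rewrite ler_norml => /andP[]; lra.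
pose cK : V -> R := cst K.
have cK0 y : 0 <= cK y by rewrite (le_trans _ (fK y)).
have cKb : exists L : R, forall y, `|cK y| <= L by exists `|K|.
have e1 := pull _ mfK fK0.
have e2 := pull _ (@measurable_cst _ _ _ _ setT K) cK0.
have -> : \int[P]_w (f (H w) * D w) =
    \int[P]_w (((f (H w) + K) * Dp w - (f (H w) + K) * Dm w) -
               (cK (H w) * Dp w - cK (H w) * Dm w)).
  by apply: eq_Rintegral => w _; rewrite [in LHS]DE -/(Dp w) -/(Dm w) /cK /=; ring.
rewrite !RintegralB//; try apply: int1B;
  try exact: (bdi _ mfK fKb); try exact: (bdi _ _ cKb).
by rewrite e1 e2 !subrr.
Qed.

(** E[X | H] as an L2 projection. Testing against all square-integrable functions of [H], and not
    only against the indicators of [is_condE], allows unbounded test functions such as gamma and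
    eta. *)
Definition cond_proj X g :=
  [/\ measurable_fun setT g, sqint P (g \o H) &
    forall f, measurable_fun setT f -> sqint P (f \o H) ->
      \int[P]_w (f (H w) * g (H w)) = \int[P]_w (f (H w) * X w)].

(** Zero beyond the level, rather than clipped there: this makes [trunc_sqr] an identity, on which
    the a priori bound in [condE_proj] rests. *)
Let trunc (f : V -> R) (n : nat) (y : V) : R :=
  f y * \1_([set y | `|f y| <= n%:R]) y.

Let mtrunc f n : measurable_fun setT f -> measurable_fun setT (trunc f n).
Proof.
move=> mf; apply: measurable_funM => //; apply: measurable_indic.
rewrite -[X in measurable X]setTI.
rewrite (_ : [set y | _] = (fun y => `|f y|) @^-1` `]-oo, n%:R]%classic).
  have : measurable_fun setT (fun y => `|f y|) by exact: measurableT_comp.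
  by apply => //; exact: measurable_itv.
by apply/seteqP; split => y /=; rewrite in_itv.
Qed.

Let trunc_le f n y : `|trunc f n y| <= n%:R.
Proof.
rewrite /trunc indicE; case: (boolP (y \in _)) => [|_]; last by rewrite mulr0 normr0.
by rewrite inE mulr1.
Qed.

Let trunc_norm f n y : `|trunc f n y| <= `|f y|.
Proof.
rewrite /trunc indicE; case: (boolP (y \in _)) => [|_]; last by rewrite mulr0 normr0.
by rewrite mulr1.
Qed.

Let trunc_eq f y : \forall n \near \oo, trunc f n y = f y.
Proof.
near=> n; rewrite /trunc indicE mem_set ?mulr1//=.
near: n; exact: nbhs_infty_ger.
Unshelve. all: by end_near. Qed.

Let trunc_sqr f n y : trunc f n y ^+ 2 = trunc f n y * f y.
Proof.
rewrite /trunc indicE; case: (boolP (y \in _)) => _ /=; last by rewrite mulr0 mul0r expr2 mul0r.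
by rewrite mulr1 expr2.
Qed.

(** Testing with truncations of [g] itself gives E[(trunc g)^2] = E[trunc g X], so the truncations
    have L2 norm at most that of [X], and monotone convergence puts [g \o H] in L2. The projection
    identity then passes from truncated to general [f] by dominated convergence. *)
Lemma condE_proj X : sqint P X -> cond_proj X (condE P H X).
Proof.
move=> sX; have iX := sqint_int1 sX; set g := condE P H X.
have [mg ig gX] := condEP iX.
have igH : int1 P (g \o H) by [].
pose D w := g (H w) - X w.
have iD : int1 P D by exact: int1B.
have D0 B : measurable B -> \int[P]_(w in H @^-1` B) D w = 0.
  move=> mB; rewrite RintegralB//; [|exact: mpre|..].
  - by rewrite /Rintegral gX// subrr.
  - by apply: integrableS igH => //; exact: mpre.
  - by apply: integrableS iX => //; exact: mpre.
have pull f n : measurable_fun setT f -> \int[P]_w (trunc f n (H w) * D w) = 0.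
  by move=> mf; apply: (@Rintegral_pull0 _ _ n%:R) => //; exact: mtrunc.
have sqtr f n : measurable_fun setT f -> sqint P (trunc f n \o H).
  move=> mf; apply: essbd_sqint; apply: (@essbd_le _ _ _ _ _ n%:R) => [|w].
    by apply: measurableT_comp => //; exact: mtrunc.
  exact: trunc_le.
have trg n : \int[P]_w (trunc g n (H w) ^+ 2) <= \int[P]_w (X w ^+ 2).
  have s1 := sqtr g n mg.
  have [_ i2] := s1; have [_ iX2] := sX.
  have iM := sqint_int1M s1 sX.
  have : \int[P]_w (trunc g n (H w) ^+ 2) = \int[P]_w (trunc g n (H w) * X w).
    apply/eqP; rewrite -subr_eq0 -RintegralB//; apply/eqP; rewrite -[RHS](pull g n mg).
    by apply: eq_Rintegral => w _; rewrite trunc_sqr /D; ring.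
  have : \int[P]_w (trunc g n (H w) * X w) <=
      \int[P]_w (2^-1 * (trunc g n (H w) ^+ 2 + X w ^+ 2)).
    apply: le_Rintegral => //; first by apply: int1Z; exact: int1D.
    move=> w _; have := sqr_ge0 (trunc g n (H w) - X w); nra.
  rewrite RintegralZl//; last exact: int1D.
  rewrite RintegralD//; lra.
have sg : sqint P (g \o H).
  split; first exact: measurableT_comp.
  apply: (@int1_nondecreasing_lim _ _ _ _ (fun n w => trunc g n (H w) ^+ 2) _
    (\int[P]_w (X w ^+ 2))).
  - by move=> n; have [] := sqtr g n mg.
  - by move=> n w; exact: sqr_ge0.
  - move=> w n m nm; rewrite -(real_normK (num_real (trunc g n _))).
    rewrite -(real_normK (num_real (trunc g m _))) lerXn2r ?nnegrE//.
    rewrite /trunc !indicE; case: (boolP (_ \in [set y | `|g y| <= n%:R])) => [|_].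
      rewrite inE /= => h; rewrite mem_set//=.
      by rewrite (le_trans h)// ler_nat.
    by rewrite mulr0 normr0.
  - by move=> w; apply: filterS (trunc_eq g (H w)) => n /= ->.
  - exact: trg.
split => // f mf sf.
apply/eqP; rewrite -subr_eq0 -RintegralB//; [|exact: sqint_int1M..].
apply/eqP; under eq_Rintegral do rewrite -mulrBr.
have sD : sqint P D by exact: sqintB.
have ifD : int1 P (fun w => f (H w) * D w) by exact: sqint_int1M sf sD.
have mD := sqint_meas sD.
apply: (@Rintegral_dominated_lim _ _ _ _ (fun n w => trunc f n (H w) * D w)).
- move=> n; apply: measurable_funM => //.
  by apply: measurableT_comp => //; exact: mtrunc.
- exact: ifD.
- move=> n w; rewrite normrM [leRHS]normrM; apply: ler_pM => //.
- by move=> w; apply: filterS (trunc_eq f (H w)) => n /= ->.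
- by move=> n; exact: pull.
Qed.

Lemma cond_projN X g : cond_proj X g -> cond_proj (fun w => - X w) (fun y => - g y).
Proof.
move=> [mg sg pg]; split; [exact: measurableT_comp|exact: sqintN|].
move=> f mf sf; have mfN : measurable_fun setT (fun y => - f y) by exact: measurableT_comp.
have sfN : sqint P ((fun y => - f y) \o H) := sqintN sf.
have := pg _ mfN sfN.
under eq_Rintegral do rewrite mulNr -mulrN.
by under [RHS]eq_Rintegral do rewrite mulNr -mulrN.
Qed.

(** The test function is the positive part h of g - K: E[h (g - X)] = 0, while h^2 <= h (g - X)
    where X <= K, so h vanishes almost surely. *)
Lemma cond_proj_le X g K : sqint P X -> cond_proj X g ->
  {ae P, forall w, X w <= K} -> {ae P, forall w, g (H w) <= K}.
Proof.
move=> sX [mg sg pg] XK; pose h y := Num.max (g y - K) 0.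
have mh : measurable_fun setT h.
  by apply: measurable_maxr => //; exact: measurable_funB.
have sgK : sqint P (fun w => g (H w) - K).
  exact: sqintB sg (essbd_sqint (essbd_cst _ _)).
have sh : sqint P (h \o H).
  apply: sqint_le sgK _; first exact: measurableT_comp.
  move=> w /=; rewrite ger0_norm ?le_max ?lexx ?orbT//.
  by rewrite ge_max normr_ge0 ler_norm.
have sgX : sqint P (fun w => g (H w) - X w) by exact: sqintB.
have h0 : \int[P]_w (h (H w) * (g (H w) - X w)) = 0.
  under eq_Rintegral do rewrite mulrBr.
  by rewrite RintegralB//; [rewrite pg// subrr|exact: sqint_int1M..].
have : {ae P, forall w, (h \o H) w = 0}.
  apply: Rintegral_sqr_eq0 => //; rewrite -h0.
  apply: ae_le_Rintegral; [by case: sh|exact: sqint_int1M sh sgX|].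
  apply: filterS XK => w XK; rewrite /h /=.
  by case: (leP (g (H w) - K) 0) => gK; [rewrite expr2 !mul0r|nra].
apply: filterS => w; rewrite /h /= => /eqP; rewrite eq_le => /andP[+ _].
by rewrite ge_max subr_le0 => /andP[].
Qed.

Lemma cond_proj_norm_le X g K : sqint P X -> cond_proj X g ->
  {ae P, forall w, `|X w| <= K} -> {ae P, forall w, `|g (H w)| <= K}.
Proof.
move=> sX gX XK.
have sXN : sqint P (fun w => - X w) := sqintN sX.
have h1 : {ae P, forall w, X w <= K}.
  by apply: filterS XK => w; rewrite ler_norml => /andP[].
have h2 : {ae P, forall w, - X w <= K}.
  by apply: filterS XK => w; rewrite ler_norml lerNl => /andP[].
apply: filterS2 (cond_proj_le sX gX h1) (cond_proj_le sXN (cond_projN gX) h2) => w.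
by rewrite ler_norml lerNl => -> ->.
Qed.

(** Testing with [g] itself gives E[g^2] = E[g X], which is at most the mean of E[g^2] and
    E[X^2]. *)
Lemma cond_proj_sqr_le X g : sqint P X -> cond_proj X g ->
  \int[P]_w (g (H w) ^+ 2) <= \int[P]_w (X w ^+ 2).
Proof.
move=> sX [mg sg pg]; have := pg g mg sg.
under eq_Rintegral do rewrite -expr2.
move=> e; have [_ ig2] := sg; have [_ iX2] := sX.
have := sqint_int1M sg sX => igX.
have : \int[P]_w (g (H w) * X w) <= \int[P]_w (2^-1 * (g (H w) ^+ 2 + X w ^+ 2)).
  apply: le_Rintegral => //; first by apply: int1Z; exact: int1D ig2 iX2.
  by move=> w _; have := sqr_ge0 (g (H w) - X w); nra.
rewrite RintegralZl//; last exact: int1D ig2 iX2.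
by rewrite RintegralD// -e; lra.
Qed.

End conditional_expectation.

(** * Paths of laws differentiable in quadratic mean *)

Section density_change.
Context d (W : measurableType d) (R : realType).
Variables (P nu : {measure set W -> \bar R}) (p : W -> R).
Hypotheses (mp : measurable_fun setT p) (p0 : forall w, 0 <= p w)
  (PE : forall B, measurable B -> P B = (\int[nu]_(w in B) (p w)%:E)%E).
Implicit Types f : W -> R.

Let ge0_density (f : W -> \bar R) : measurable_fun setT f -> (forall w, (0 <= f w)%E) ->
  (\int[P]_w f w = \int[nu]_w (f w * (p w)%:E))%E.
Proof.
move=> mf f0; apply: (ge0_integral_pushforward_density (H := id)) => //.
Qed.

Lemma int1_density f : int1 P f -> int1 nu (fun w => f w * p w).
Proof.
move=> fi; have mf := int1_meas fi.
apply/integrableP; split; first by apply/measurable_EFinP; exact: measurable_funM.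
have /integrableP[mf' foo] := fi.
apply: le_lt_trans foo.
rewrite (ge0_density (f := fun w => `|(EFin \o f) w|%E))//; last first.
  exact: measurableT_comp.
rewrite le_eqVlt; apply/orP; left; apply/eqP; apply: eq_integral => w _ /=.
by rewrite normrM EFinM (ger0_norm (p0 w)).
Qed.

Lemma Rintegral_density f : int1 P f -> \int[P]_w f w = \int[nu]_w (f w * p w).
Proof.
move=> fi; have [ifp ifm fE] := int1_pos_neg fi.
pose fp w : R := Num.max (f w) 0; pose fm w : R := Num.max (- f w) 0.
have fp0 w : 0 <= fp w by rewrite le_max lexx orbT.
have fm0 w : 0 <= fm w by rewrite le_max lexx orbT.
have mfp : measurable_fun setT fp := int1_meas ifp.
have mfm : measurable_fun setT fm := int1_meas ifm.
have h (g : W -> R) : measurable_fun setT g -> (forall w, 0 <= g w) ->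
    \int[P]_w g w = \int[nu]_w (g w * p w).
  move=> mg g0; rewrite /Rintegral (ge0_density (f := EFin \o g))//.
  exact/measurable_EFinP.
under eq_Rintegral do rewrite fE; under [RHS]eq_Rintegral do rewrite fE mulrBl.
by rewrite !RintegralB ?h//; exact: int1_density.
Qed.

End density_change.

Lemma near0_norm_lt (R : realType) (e : R) : 0 < e ->
  \forall th \near (0 : R), `|th| < e.
Proof. by move=> e0; exact: (@nbhs0_lt R R^o). Qed.

Section differentiable_path.
Context d (W : measurableType d) (R : realType).
Variables (Pth : R -> probability W R) (s : W -> R).
Implicit Types f : W -> R.

Definition path_linear := forall f (C : R),
  (\forall th \near (0 : R), sqint (Pth th) f /\ \int[Pth th]_w (f w ^+ 2) <= C) ->
  forall e : R, 0 < e -> \forall th \near (0 : R),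
    `|\int[Pth th]_w f w - \int[Pth 0]_w f w - th * \int[Pth 0]_w (f w * s w)|
      <= e * `|th|.

Definition lipschitz_at (C th : R) := forall f (u : R), 0 < u ->
  sqint (Pth th) f -> sqint (Pth 0) f ->
  \int[Pth th]_w (f w ^+ 2) <= u ^+ 2 -> \int[Pth 0]_w (f w ^+ 2) <= u ^+ 2 ->
  `|\int[Pth th]_w f w - \int[Pth 0]_w f w| <= C * `|th| * u.

Definition path_lipschitz := exists2 C : R, 0 < C &
  \forall th \near (0 : R), lipschitz_at C th.

Definition equicontinuous_at (e del th : R) := forall f (B : set W) (u : R),
  0 < u -> measurable B ->
  \int[Pth th]_w \1_B w <= del -> (forall w, ~ B w -> f w = 0) ->
  sqint (Pth th) f -> sqint (Pth 0) f ->
  \int[Pth th]_w (f w ^+ 2) <= u ^+ 2 -> \int[Pth 0]_w (f w ^+ 2) <= u ^+ 2 ->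
  `|\int[Pth th]_w f w - \int[Pth 0]_w f w| <= e * `|th| * u.

Definition path_equicontinuous := forall e : R, 0 < e -> exists2 del : R, 0 < del &
  \forall th \near (0 : R), equicontinuous_at e del th.

(** All that the rest of the proof uses of differentiability in quadratic mean: an expansion of the
    expectation of one fixed function, a Lipschitz bound uniform over L2 balls, and an arbitrarily
    small Lipschitz constant for functions carried by sets of small probability. Densities do not
    appear in these conditions. *)
Definition differentiable_path :=
  [/\ sqint (Pth 0) s, path_linear, path_lipschitz & path_equicontinuous].

(** * Consequences of differentiability in quadratic mean *)

Section dqm.
Variables (nu : {measure set W -> \bar R}) (p : R -> W -> R).
Hypothesis hs : sqint (Pth 0) s.

Definition has_density th := [/\ measurable_fun setT (p th), (forall w, 0 <= p th w) &
  forall B : set W, measurable B -> Pth th B = (\int[nu]_(w in B) (p th w)%:E)%E].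

Hypothesis hp : \forall th \near (0 : R), has_density th.
Hypothesis hd : (fun th : R => (th ^- 2)%:E *
   \int[nu]_w ((Num.sqrt (p th w) - Num.sqrt (p 0 w) -
                th / 2 * s w * Num.sqrt (p 0 w)) ^+ 2)%:E)%E
  @ (0 : R)^' --> 0%E.

Local Notation G := has_density.
Let q (th : R) w : R := Num.sqrt (p th w).
Let D (th : R) w : R := q th w - q 0 w.
Let Rm (th : R) w : R := D th w - th / 2 * s w * q 0 w.

Let G0 : G 0. Proof. exact: nbhs_singleton hp. Qed.

Let mq th : G th -> measurable_fun setT (q th).
Proof.
move=> [mp _ _]; apply: (@measurableT_comp _ _ _ _ _ _ (@Num.sqrt R)) => //.
by apply: continuous_measurable_fun; exact: sqrt_continuous.
Qed.

(** Multiplication by the root density embeds L2 of [Pth th] isometrically into L2 of [nu], where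
    different laws can be compared. *)
Let sq_q th f : G th -> sqint (Pth th) f ->
  sqint nu (fun w => f w * q th w) /\
  \int[nu]_w ((f w * q th w) ^+ 2) = \int[Pth th]_w (f w ^+ 2).
Proof.
move=> Gth [mf f2]; have [mp p0 PE] := Gth.
have e w : (f w * q th w) ^+ 2 = f w ^+ 2 * p th w by rewrite exprMn sqr_sqrtr.
split; last by rewrite (Rintegral_density mp p0 PE f2); apply: eq_Rintegral.
split; first by apply: measurable_funM => //; exact: mq.
by have := int1_density mp p0 PE f2; congr (int1 nu _); apply/funext => w; rewrite e.
Qed.

Let s0 := \int[Pth 0]_w (s w ^+ 2).

Let s0_ge0 : 0 <= s0.
Proof. by apply: Rintegral_ge0 => w _; exact: sqr_ge0. Qed.

Let Rm_small (t : R) : 0 < t -> \forall th \near (0 : R),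
  sqint nu (Rm th) /\ \int[nu]_w (Rm th w ^+ 2) <= t * th ^+ 2.
Proof.
move=> t0.
have hd' : \forall th \near (0 : R)^', ((th ^- 2)%:E *
    \int[nu]_w ((Rm th w) ^+ 2)%:E < t%:E)%E.
  have /hd : nbhs (0%E : \bar R) [set x | (x < t%:E)%E].
    by apply: open_nbhs_nbhs; split; [exact: open_ereal_lt_ereal|rewrite /= lte_fin].
  by [].
move: hd'; rewrite near_withinE => hd'.
near=> th.
have Gth : G th by near: th.
have mRm : measurable_fun setT (Rm th).
  apply: measurable_funB; first by apply: measurable_funB; exact: mq.
  apply: measurable_funM; last exact: mq.
  by apply: measurable_funM => //; have [] := hs.
have Rm0 w : 0 <= Rm th w ^+ 2 by exact: sqr_ge0.
have mRm2 : measurable_fun setT (fun w => Rm th w ^+ 2) by exact: measurable_funX.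
suff : (\int[nu]_w (Rm th w ^+ 2)%:E <= (t * th ^+ 2)%:E)%E.
  by move=> /(int1_lty mRm2 Rm0)[? ?]; split.
(* The limit in [hd] says nothing at [th = 0], but there the remainder vanishes identically. *)
have [th0|th0] := eqVneq th 0.
  rewrite integral0_eq ?lee_fin; first by rewrite mulr_ge0 ?sqr_ge0// ltW.
  move=> w _.
  by rewrite /Rm /D th0; congr EFin; ring.
have : ((th ^- 2)%:E * \int[nu]_w ((Rm th w) ^+ 2)%:E < t%:E)%E.
  by move: th0; near: th.
have th2 : 0 < th ^+ 2 by rewrite exprn_even_gt0.
move=> /ltW; rewrite -(@lee_pmul2l _ (th ^+ 2)%:E)// ?lte_fin//.
by rewrite muleA -EFinM divff ?gt_eqF// mul1e -EFinM mulrC.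
Unshelve. all: by end_near. Qed.

(** If the integral of Rm^2 is at most th^2, that of D^2 is at most (2 + s0 / 2) th^2, hence at most
    (CD th)^2. *)
Let CD := 2 + s0.
Let CD0 : 0 < CD. Proof. by rewrite /CD; move: s0_ge0; lra. Qed.

(** From D = Rm + th / 2 s q_0 and (x + y)^2 <= 2 x^2 + 2 y^2. The weight [f] is 1 when the full
    norm of [D] is wanted and an indicator when only its part on a small set is. *)
Let sqD (th : R) (f : W -> R) : measurable_fun setT f ->
  (forall w, `|f w| <= 1) -> G th -> sqint nu (Rm th) ->
  sqint nu (fun w => D th w * f w) /\
  \int[nu]_w ((D th w * f w) ^+ 2) <=
    2 * \int[nu]_w (Rm th w ^+ 2) + th ^+ 2 / 2 * \int[Pth 0]_w ((s w * f w) ^+ 2).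
Proof.
move=> mf f1 Gth sRm.
have ssf : sqint (Pth 0) (fun w => s w * f w).
  exact: sqintMr hs (essbd_le _ mf f1).
have [[msfq isfq] <-] := sq_q G0 ssf.
have [msq isq] := sq_q G0 hs.
have [mR iR] := sRm.
have mDf : measurable_fun setT (fun w => D th w * f w).
  by apply: measurable_funM => //; apply: measurable_funB; exact: mq.
have le w : (D th w * f w) ^+ 2 <=
    2 * (Rm th w ^+ 2) + th ^+ 2 / 2 * ((s w * f w * q 0 w) ^+ 2).
  have := f1 w; rewrite ler_norml => /andP[fl fu].
  have f2 : f w ^+ 2 <= 1 by nra.
  have -> : D th w = Rm th w + th / 2 * s w * q 0 w by rewrite /Rm; ring.
  set r := Rm th w; set v := th / 2 * s w * q 0 w.
  have -> : th ^+ 2 / 2 * (s w * f w * q 0 w) ^+ 2 = 2 * (v * f w) ^+ 2.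
    by rewrite /v; field.
  have rf : (r * f w) ^+ 2 <= r ^+ 2.
    by rewrite exprMn -[leRHS]mulr1 ler_wpM2l ?sqr_ge0.
  have := sqr_ge0 (r * f w - v * f w).
  have -> : ((r + v) * f w) ^+ 2 = 2 * (r * f w) ^+ 2 + 2 * (v * f w) ^+ 2 -
    (r * f w - v * f w) ^+ 2 by ring.
  lra.
have i1 : int1 nu (fun w => 2 * (Rm th w ^+ 2)) by exact: int1Z.
have i2 : int1 nu (fun w => th ^+ 2 / 2 * ((s w * f w * q 0 w) ^+ 2)) by exact: int1Z.
have i3 : int1 nu (fun w => (D th w * f w) ^+ 2).
  apply: int1_le (int1D i1 i2) _; first exact: measurable_funX.
  by move=> w; rewrite ger0_norm ?sqr_ge0//; exact: le.
split => //; rewrite -!RintegralZl// -RintegralD//.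
by apply: le_Rintegral => //; exact: int1D.
Qed.

Let D_bound : \forall th \near (0 : R), sqint nu (D th) /\
  \int[nu]_w (D th w ^+ 2) <= (CD * `|th|) ^+ 2.
Proof.
near=> th.
have Gth : G th by near: th.
have [sRm iRm] : sqint nu (Rm th) /\ \int[nu]_w (Rm th w ^+ 2) <= 1 * th ^+ 2.
  by near: th; exact: Rm_small.
pose f1 : W -> R := cst 1.
have f11 w : `|f1 w| <= 1 by rewrite normr1.
have mf1 : measurable_fun setT f1 by exact: measurable_cst.
have [sD iD] := sqD mf1 f11 Gth sRm.
have eD : (fun w => D th w * f1 w) = D th by apply/funext => w; rewrite mulr1.
split; first by rewrite -eD.
move: iD; rewrite (_ : (fun w => (D th w * f1 w) ^+ 2) = (fun w => D th w ^+ 2)).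
  rewrite (_ : (fun w => (s w * f1 w) ^+ 2) = (fun w => s w ^+ 2)).
    move=> /le_trans; apply.
    rewrite -/s0 exprMn real_normK ?num_real// /CD.
    by have := sqr_ge0 th; move: iRm s0_ge0; nra.
  by apply/funext => w; rewrite mulr1.
by apply/funext => w; rewrite mulr1.
Unshelve. all: by end_near. Qed.

Let indic1 (B : set W) w : `|\1_B w : R| <= 1.
Proof. by rewrite indicE ger0_norm ?ler0n// lern1; case: (_ \in _). Qed.

Let D_small (e del th : R) := forall B : set W, measurable B ->
  \int[Pth 0]_w \1_B w < del -> sqint nu (fun w => D th w * \1_B w) /\
  \int[nu]_w ((D th w * \1_B w) ^+ 2) <= (e * `|th|) ^+ 2.

(** Absolute continuity of the integral of s^2 makes the linear part of [D] small on sets of small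
    probability; the remainder is small on every set. *)
Let D_local (e : R) : 0 < e -> exists2 del : R, 0 < del &
  \forall th \near (0 : R), D_small e del th.
Proof.
move=> e0; have [ms is2] := hs.
have e20 : 0 < e ^+ 2 by rewrite exprn_gt0.
have [del [del0 hdel]] := integral_normr_continuous is2 e20.
exists del => //; near=> th => B mB PB.
have Gth : G th by near: th.
(* The share e^2 / 4 fits [sqD]: 2 e^2 / 4 from the remainder plus e^2 / 2 from the score give
   e^2. *)
have [sRm iRm] : sqint nu (Rm th) /\ \int[nu]_w (Rm th w ^+ 2) <= e ^+ 2 / 4 * th ^+ 2.
  by near: th; apply: Rm_small; rewrite divr_gt0.
have [sD iD] := sqD (measurable_indic mB) (indic1 B) Gth sRm.
split => //; apply: (le_trans iD).
have PBE : (Pth 0 B < del%:E)%E.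
  move: PB; rewrite -lte_fin EFin_Rintegral ?integral_indic ?setIT//.
  exact: sqint_int1 (essbd_sqint (essbd_indic _ mB)).
have := hdel B mB PBE.
have -> : \int[Pth 0]_(x in B) `|s x ^+ 2| = \int[Pth 0]_w ((s w * \1_B w) ^+ 2).
  rewrite Rintegral_mkcond; apply: eq_Rintegral => w _.
  rewrite /patch indicE; case: ifPn => _ /=; last by rewrite mulr0 expr2 mul0r.
  by rewrite mulr1 ger0_norm ?sqr_ge0.
rewrite exprMn real_normK ?num_real//.
have := sqr_ge0 th; move: iRm; nra.
Unshelve. all: by end_near. Qed.

(** The factorization p_th - p_0 = (q_th + q_0) (q_th - q_0); each product is then estimated by
    Cauchy-Schwarz. *)
Let diffE (th : R) f : G th -> sqint (Pth th) f -> sqint (Pth 0) f ->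
  sqint nu (D th) ->
  \int[Pth th]_w f w - \int[Pth 0]_w f w =
  \int[nu]_w ((f w * q th w) * D th w) + \int[nu]_w ((f w * q 0 w) * D th w).
Proof.
move=> Gth sf sf0 sD; have [mp p0 PE] := Gth; have [mp0 p00 P0E] := G0.
have [i1 i2] := (sqint_int1 sf, sqint_int1 sf0).
rewrite (Rintegral_density mp p0 PE i1) (Rintegral_density mp0 p00 P0E i2).
rewrite -RintegralB//; [|exact: int1_density i1|exact: int1_density i2].
have [s1 _] := sq_q Gth sf; have [s2 _] := sq_q G0 sf0.
rewrite -RintegralD//; [|exact: sqint_int1M s1 sD|exact: sqint_int1M s2 sD].
apply: eq_Rintegral => w _; rewrite -(@sqr_sqrtr _ (p th w))//.
by rewrite -(@sqr_sqrtr _ (p 0 w))// /D /q; ring.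
Qed.

Lemma dqm_path_lipschitz : path_lipschitz.
Proof.
exists (2 * CD); first by move: CD0; lra.
near=> th => f u u0 sf sf0 fu fu0.
have [->|th0] := eqVneq th 0.
  by rewrite subrr normr0 !mulr_ge0// ?ltW.
have Gth : G th by near: th.
have [sD iD] : sqint nu (D th) /\ \int[nu]_w (D th w ^+ 2) <= (CD * `|th|) ^+ 2.
  by near: th; exact: D_bound.
have Cth : 0 < CD * `|th| by rewrite mulr_gt0// normr_gt0.
rewrite (diffE Gth)//; apply: (le_trans (ler_normD _ _)).
have [s1 e1] := sq_q Gth sf; have [s2 e2] := sq_q G0 sf0.
have -> : 2 * CD * `|th| * u = u * (CD * `|th|) + u * (CD * `|th|) by ring.
by apply: lerD; apply: Rintegral_CS_norm => //; rewrite ?e1 ?e2.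
Unshelve. all: by end_near. Qed.

Lemma dqm_path_equicontinuous : path_equicontinuous.
Proof.
move=> e e0; have e20 : 0 < e / 2 by rewrite divr_gt0.
have [del del0 hdel] := D_local e20.
have [C C0 hC] := dqm_path_lipschitz.
exists (del / 2); first by rewrite divr_gt0.
near=> th => f B u u0 mB PB fB sf sf0 fu fu0.
have [->|th0] := eqVneq th 0.
  by rewrite subrr normr0 !mulr_ge0// ?ltW.
have Gth : G th by near: th.
have [sD _] : sqint nu (D th) /\ \int[nu]_w (D th w ^+ 2) <= (CD * `|th|) ^+ 2.
  by near: th; exact: D_bound.
have thsmall : `|th| < del / 2 / C.
  by near: th; apply: near0_norm_lt; rewrite !divr_gt0.
(* [D_small] wants a bound under [Pth 0], while the hypothesis is about [Pth th]. The Lipschitz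
   bound for the indicator of [B] moves it, at the cost of the other half of [del]. *)
have P0B : \int[Pth 0]_w \1_B w < del.
  have sB th' : sqint (Pth th') (\1_B : W -> R) by exact: essbd_sqint (essbd_indic _ mB).
  have B1 th' : \int[Pth th']_w (\1_B w ^+ 2 : R) <= 1 ^+ 2.
    rewrite expr1n -(Rintegral_prob_cst (Pth th') 1); apply: le_Rintegral => //.
    - by have [] := sB th'.
    - exact: int1_cst.
  have : `|\int[Pth th]_w \1_B w - \int[Pth 0]_w \1_B w| <= C * `|th| * 1.
    have h : lipschitz_at C th by near: th.
    exact: h ltr01 (sB th) (sB 0) (B1 th) (B1 0).
  rewrite mulr1 ltr_pdivlMr// in thsmall *; rewrite ler_norml => /andP[h _].
  by move: h PB thsmall; lra.
have [sDB iDB] : sqint nu (fun w => D th w * \1_B w) /\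
    \int[nu]_w ((D th w * \1_B w) ^+ 2) <= (e / 2 * `|th|) ^+ 2.
  have h : D_small (e / 2) del th by near: th.
  exact: h.
have Cth : 0 < e / 2 * `|th| by rewrite mulr_gt0// normr_gt0.
rewrite (diffE Gth)//; apply: (le_trans (ler_normD _ _)).
have [s1 e1] := sq_q Gth sf; have [s2 e2] := sq_q G0 sf0.
have fE w : f w = f w * \1_B w.
  rewrite indicE; case: (boolP (w \in B)); rewrite ?mulr1// => wB.
  by rewrite fB ?mul0r// => Bw; move: wB; rewrite mem_set.
have -> : e * `|th| * u = u * (e / 2 * `|th|) + u * (e / 2 * `|th|) by field.
have qD th' : \int[nu]_w (f w * q th' w * D th w) =
    \int[nu]_w (f w * q th' w * (D th w * \1_B w)).
  by apply: eq_Rintegral => w _; rewrite [in LHS]fE; ring.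
by rewrite !qD; apply: lerD; apply: Rintegral_CS_norm => //; rewrite ?e1 ?e2.
Unshelve. all: by end_near. Qed.

(** The error of the expansion is 2 E[f q_0 Rm] + E[f D^2] in integrals over [nu]. The first term is
    o(th) by Cauchy-Schwarz. In the second, where |f| <= K the factor D^2 gives O(th^2); where |f| >
    K, |f D| is at most |f| q_th + |f| q_0, bounded in L2, and the other factor [D] is small by
    [D_local]. *)
Lemma dqm_path_linear : path_linear.
Proof.
move=> f C hC e e0.
have [[mf f2] fC] : sqint (Pth 0) f /\ \int[Pth 0]_w (f w ^+ 2) <= C.
  exact: nbhs_singleton hC.
have sf0 : sqint (Pth 0) f by [].
(* Chosen so that C <= u^2, which bounds the L2 norm of [f] without a square root. *)
pose u := 1 + C.
have C0 : 0 <= C by apply: le_trans fC; apply: Rintegral_ge0 => w _; exact: sqr_ge0.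
have u0 : 0 < u by rewrite /u; lra.
have Cu : C <= u ^+ 2 by rewrite /u; nra.
pose e1 := e / (8 * u).
have e10 : 0 < e1 by rewrite divr_gt0// mulr_gt0.
have [del del0 hdel] := D_local e10.
(* Chebyshev's inequality: K >= 1 gives K <= f^2 on [B], so K P_0(B) <= C < K del. *)
pose K := 1 + C / del.
have K0 : 0 < K by rewrite /K; have := divr_ge0 C0 (ltW del0); lra.
pose B := [set w | K < `|f w|].
have mB : measurable B by exact: measurable_norm_gt.
have sB : sqint (Pth 0) (\1_B : W -> R) by exact: essbd_sqint (essbd_indic _ mB).
have P0B : \int[Pth 0]_w \1_B w < del.
  have Kdel : C < K * del by rewrite /K mulrDl mul1r divfK ?gt_eqF//; lra.
  have : K * \int[Pth 0]_w \1_B w <= C.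
    apply: le_trans fC; rewrite -RintegralZl//; last exact: sqint_int1.
    apply: le_Rintegral => //; first by apply: int1Z; exact: sqint_int1.
    move=> w _; rewrite indicE; case: (boolP (w \in B)) => [|_]; last by rewrite mulr0 sqr_ge0.
    rewrite inE /B /= mulr1 -[f w ^+ 2]real_normK ?num_real// => Kf.
    have K1 : 1 <= K by rewrite /K; have := divr_ge0 C0 (ltW del0); lra.
    nra.
  by move: K0 Kdel; nra.
have e2 : 0 < e / (4 * u) by rewrite divr_gt0// mulr_gt0.
have e3 : 0 < (e / (4 * u)) ^+ 2 by rewrite exprn_gt0.
near=> th.
have [->|th0] := eqVneq th 0.
  by rewrite subrr mul0r subrr normr0 mulr0.
have thp : 0 < `|th| by rewrite normr_gt0.
have Gth : G th by near: th.
have [sf fth] : sqint (Pth th) f /\ \int[Pth th]_w (f w ^+ 2) <= C by near: th.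
have [sD iD] : sqint nu (D th) /\ \int[nu]_w (D th w ^+ 2) <= (CD * `|th|) ^+ 2.
  by near: th; exact: D_bound.
have [sR iR] : sqint nu (Rm th) /\
    \int[nu]_w (Rm th w ^+ 2) <= (e / (4 * u)) ^+ 2 * th ^+ 2.
  by near: th; exact: Rm_small.
have [sDB iDB] : sqint nu (fun w => D th w * \1_B w) /\
    \int[nu]_w ((D th w * \1_B w) ^+ 2) <= (e1 * `|th|) ^+ 2.
  have h : D_small (e1) del th by near: th.
  exact: h.
have thsmall : `|th| < e / 4 / (K * CD ^+ 2).
  by near: th; apply: near0_norm_lt; rewrite !divr_gt0// mulr_gt0// exprn_gt0.
have [s1 q1] := sq_q Gth sf; have [s2 q2] := sq_q G0 sf0.
have [ss _] := sq_q G0 hs.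
have [mp p0 PE] := Gth; have [mp0 p00 P0E] := G0.
have i1 := sqint_int1M s2 sR.
have [_ iD2] := sD.
pose F w := `|f w * q th w| + `|f w * q 0 w|.
have sF : sqint nu F by apply: sqintD; exact: sqint_norm.
have FE : \int[nu]_w (F w ^+ 2) <= (2 * u) ^+ 2.
  apply: (@le_trans _ _ (\int[nu]_w (2 * ((f w * q th w) ^+ 2 + (f w * q 0 w) ^+ 2)))).
    have [_ i] := s1; have [_ i'] := s2; have [_ iF] := sF.
    apply: le_Rintegral => //; first by apply: int1Z; exact: int1D.
    move=> w _; rewrite -[(f w * q th w) ^+ 2]real_normK ?num_real//.
    rewrite -[(f w * q 0 w) ^+ 2]real_normK ?num_real// /F.
    have := sqr_ge0 (`|f w * q th w| - `|f w * q 0 w|); nra.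
  have [_ i] := s1; have [_ i'] := s2.
  rewrite RintegralZl//; last exact: int1D.
  rewrite RintegralD// q1 q2; move: fC fth Cu; nra.
have iFD := sqint_int1M sF sDB.
have F0 w : 0 <= F w by rewrite addr_ge0.
have fDle w : `|f w * D th w ^+ 2| <= K * D th w ^+ 2 + `|F w * (D th w * \1_B w)|.
  rewrite indicE; case: (boolP (w \in B)) => [_|].
    have fDF : `|f w * D th w| <= F w.
      by rewrite /D mulrBr (le_trans (ler_normD _ _))// normrN.
    rewrite mulr1 expr2 mulrA normrM [`|F w * _|]normrM (ger0_norm (F0 w)).
    apply: ler_wpDl; last exact: ler_wpM2r.
    by rewrite -expr2 mulr_ge0 ?sqr_ge0// ltW.
  rewrite notin_setE /B /= => /negP; rewrite -leNgt => fK.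
  rewrite !mulr0 normr0 addr0 normrM [`|D th w ^+ 2|]ger0_norm ?sqr_ge0//.
  by rewrite ler_wpM2r ?sqr_ge0.
have iKD : int1 nu (fun w => K * D th w ^+ 2) by exact: int1Z.
have ifD : int1 nu (fun w => f w * D th w ^+ 2).
  apply: int1_le (int1D iKD (int1_norm iFD)) _ => //.
  by have [mD _] := sD; apply: measurable_funM => //; exact: measurable_funX.
have hfD : `|\int[nu]_w (f w * D th w ^+ 2)| <= e / 2 * `|th|.
  apply: (le_trans (le_normr_Rintegral _ _)) => //.
  apply: (@le_trans _ _ (\int[nu]_w (K * D th w ^+ 2 + `|F w * (D th w * \1_B w)|))).
    by apply: le_Rintegral => //; [exact: int1_norm|exact: int1D iKD (int1_norm iFD)].
  rewrite RintegralD//; last exact: int1_norm.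
  have h : \int[nu]_w `|F w * (D th w * \1_B w)| <= 2 * u * (e1 * `|th|).
    by apply: Rintegral_CS => //; rewrite mulr_gt0.
  have -> : e / 2 * `|th| = e / 4 * `|th| + 2 * u * (e1 * `|th|).
    by rewrite /e1; field; rewrite gt_eqF.
  apply: lerD => //; rewrite RintegralZl//.
  apply: (@le_trans _ _ (K * (CD * `|th|) ^+ 2)); first by rewrite ler_pM2l.
  move: thsmall; rewrite ltr_pdivlMr ?mulr_gt0// ?exprn_gt0// => h'.
  rewrite exprMn mulrA expr2 mulrA ler_pM2r//.
  by rewrite mulrC ltW.
have hfR : `|\int[nu]_w ((f w * q 0 w) * Rm th w)| <= e / 4 * `|th|.
  have -> : e / 4 * `|th| = u * (e / (4 * u) * `|th|) by field; rewrite gt_eqF.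
  apply: Rintegral_CS_norm => //; first by rewrite mulr_gt0.
    by rewrite q2 (le_trans fC).
  by rewrite exprMn real_normK ?num_real.
have -> : \int[Pth th]_w f w - \int[Pth 0]_w f w - th * \int[Pth 0]_w (f w * s w) =
    2 * \int[nu]_w ((f w * q 0 w) * Rm th w) + \int[nu]_w (f w * D th w ^+ 2).
  have [j1 j2 j3] := And3 (sqint_int1 sf) (sqint_int1 sf0) (sqint_int1M sf0 hs).
  rewrite (Rintegral_density mp p0 PE j1) (Rintegral_density mp0 p00 P0E j2).
  rewrite (Rintegral_density mp0 p00 P0E j3).
  have k1 := int1_density mp p0 PE j1; have k2 := int1_density mp0 p00 P0E j2.
  have k3 := int1_density mp0 p00 P0E j3.
  rewrite -!RintegralZl// -RintegralB// -RintegralB//; [|exact: int1B|exact: int1Z].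
  rewrite -RintegralD//; last exact: int1Z.
  apply: eq_Rintegral => w _; rewrite -(@sqr_sqrtr _ (p th w))//.
  by rewrite -(@sqr_sqrtr _ (p 0 w))// /Rm /D /q; field.
apply: (le_trans (ler_normD _ _)); rewrite normrM ger0_norm//.
by move: hfR hfD; lra.
Unshelve. all: by end_near. Qed.

Lemma dqm_differentiable_path : differentiable_path.
Proof.
split; [exact: hs|exact: dqm_path_linear|exact: dqm_path_lipschitz|].
exact: dqm_path_equicontinuous.
Qed.

End dqm.
End differentiable_path.

(** * Families of functions along a path *)

Section clipping.
Context (R : realType).
Implicit Types K x y : R.

Lemma measurable_funV d (T : measurableType d) (f : T -> R) :
  measurable_fun setT f -> measurable_fun setT (fun w => (f w)^-1).
Proof.
move=> mf; rewrite (_ : (fun w => _) = (fun w => f w * (`|f w| `^ (-1)) ^+ 2)).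
  apply: measurable_funM => //; apply: measurable_funX.
  apply: (@measurableT_comp _ _ _ _ _ _ (fun x : R => x `^ (-1))) => //.
  exact: measurableT_comp.
apply/funext => w; rewrite powR_inv1// exprVn real_normK ?num_real//.
have [->|fw] := eqVneq (f w) 0; first by rewrite invr0 mul0r.
by rewrite expr2 invfM mulrA divff// mul1r.
Qed.

Definition clip K x : R := Num.max (- K) (Num.min x K).

Lemma clip_norm K x : 0 <= K -> `|clip K x| <= K.
Proof.
move=> K0; rewrite ler_norml /clip le_max lexx /= ge_max ge_min lexx orbT andbT.
lra.
Qed.

Lemma clip_id K x : `|x| <= K -> clip K x = x.
Proof.
rewrite ler_norml => /andP[a b]; rewrite /clip.
by rewrite (min_idPl b) (max_idPr a).
Qed.

Lemma clip_lipschitz K x y : 0 <= K ->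
  `|clip K x - clip K y| <= `|x - y|.
Proof.
move=> K0; rewrite /clip.
case: (leP x K) => xK; case: (leP y K) => yK;
  rewrite ?(min_idPl (ltW xK)) ?(min_idPl (ltW yK)).
all: repeat match goal with |- context [Num.max ?a ?b] => case: (leP a b) => ? end.
all: rewrite ler_norml; case: (ger0P (x - y)) => ?; lra.
Qed.

Lemma clip_le K x : 0 <= K -> `|clip K x| <= `|x|.
Proof.
move=> K0; have := clip_lipschitz x 0 K0.
by rewrite (@clip_id K 0) ?normr0// !subr0.
Qed.

(** The first bound makes the truncation error small in L1 given only a second moment, uniformly
    over laws; the second keeps the error bounded in L2. *)
Lemma clip_tail K x : 0 < K -> `|x - clip K x| <= K^-1 * x ^+ 2 /\
  `|x - clip K x| <= 2 * `|x|.
Proof.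
move=> K0; have cx := clip_le x (ltW K0).
split; last by rewrite (le_trans (ler_normB _ _))//; lra.
have [xK|xK] := leP `|x| K.
  by rewrite clip_id// subrr normr0 mulr_ge0 ?sqr_ge0// invr_ge0 ltW.
rewrite ler_pdivlMl// -[x ^+ 2]real_normK ?num_real//.
have : `|x - clip K x| <= `|x|.
  rewrite /clip; case: (ger0P x) xK => x0 xK.
    rewrite (min_idPr (ltW xK)) (max_idPr _); last by lra.
    by rewrite ger0_norm; lra.
  rewrite (min_idPl _); last by lra.
  by rewrite (max_idPl _) ?ler0_norm; lra.
have := normr_ge0 (x - clip K x); nra.
Qed.

Lemma measurable_clip d (T : measurableType d) (f : T -> R) K :
  measurable_fun setT f -> measurable_fun setT (fun w => clip K (f w)).
Proof.
by move=> mf; apply: measurable_maxr => //; exact: measurable_minr.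
Qed.

(** A bounded, globally Lipschitz extension of the inverse from |x| >= e to the whole line. It
    carries closeness in the mean from a family to its inverse. *)
Definition inv_clip (e x : R) : R := x / Num.max (x ^+ 2) (e ^+ 2).

Lemma inv_clipE (e x : R) : 0 < e -> e <= `|x| -> inv_clip e x = x^-1.
Proof.
move=> e0 ex; have x0 : x != 0 by rewrite -normr_gt0 (lt_le_trans e0).
have e2 : e ^+ 2 <= x ^+ 2.
  by rewrite -[x ^+ 2]real_normK ?num_real// lerXn2r// nnegrE ltW.
by rewrite /inv_clip (max_idPl e2) expr2 invfM mulrA divff// mul1r.
Qed.

Let inv_clip_cases (e x : R) : 0 < e ->
  (e <= `|x| /\ inv_clip e x = x^-1) \/ (`|x| < e /\ inv_clip e x = x / e ^+ 2).
Proof.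
move=> e0; case: (lerP e `|x|) => ex; [left|right]; split => //.
  exact: inv_clipE.
rewrite /inv_clip (_ : Num.max _ _ = e ^+ 2)//; apply/max_idPr.
by rewrite -[x ^+ 2]real_normK ?num_real// lerXn2r ?nnegrE// ltW.
Qed.

Lemma inv_clip_norm (e x : R) : 0 < e -> `|inv_clip e x| <= e^-1.
Proof.
move=> e0; case: (inv_clip_cases x e0) => -[ex ->].
  by rewrite normfV lef_pV2// posrE// (lt_le_trans e0).
rewrite normrM normfV (@ger0_norm _ (e ^+ 2)) ?sqr_ge0//.
rewrite ler_pdivrMr ?exprn_gt0// expr2 mulrA mulVf ?gt_eqF// mul1r.
exact: ltW.
Qed.

Lemma inv_clip_lipschitz (e x y : R) : 0 < e ->
  `|inv_clip e x - inv_clip e y| <= (e ^+ 2)^-1 * `|x - y|.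
Proof.
move=> e0; have e2 : 0 < e ^+ 2 by rewrite exprn_gt0.
have mixed (u v : R) : e <= `|u| -> `|v| < e ->
    `|u^-1 - v / e ^+ 2| <= (e ^+ 2)^-1 * `|u - v|.
  move=> eu ve; have u0 : u != 0 by rewrite -normr_gt0 (lt_le_trans e0).
  have -> : u^-1 - v / e ^+ 2 = (e ^+ 2)^-1 * ((e ^+ 2 - u * v) / u).
    by field; rewrite u0 gt_eqF.
  rewrite normrM ger0_norm ?invr_ge0 ?(ltW e2)// ler_pM2l ?invr_gt0//.
  rewrite normrM normfV ler_pdivrMr ?normr_gt0// -normrM.
  rewrite ler_norml; move: eu ve; rewrite ltr_norml => + /andP[v1 v2].
  have [u1|u1] := ger0P u => eu.
    have : 0 <= (u - v) * u by rewrite mulr_ge0// subr_ge0; lra.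
    by move=> h; rewrite (ger0_norm h); apply/andP; split; nra.
  have : 0 <= (u - v) * u by rewrite nmulr_rge0 ?subr_le0//; lra.
  by move=> h; rewrite (ger0_norm h); apply/andP; split; nra.
case: (inv_clip_cases x e0) => -[ex ->]; case: (inv_clip_cases y e0) => -[ey ->].
- have x0 : x != 0 by rewrite -normr_gt0 (lt_le_trans e0).
  have y0 : y != 0 by rewrite -normr_gt0 (lt_le_trans e0).
  have -> : x^-1 - y^-1 = (x * y)^-1 * (y - x) by field; rewrite x0 y0.
  rewrite normrM distrC ler_wpM2r// normfV normrM lef_pV2 ?posrE//; last first.
    by rewrite mulr_gt0 ?normr_gt0.
  by rewrite expr2 ler_pM// ltW.
- exact: mixed.
- by rewrite distrC [`|x - y|]distrC; exact: mixed.
- by rewrite -mulrBl normrM mulrC normfV (ger0_norm (ltW e2)).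
Qed.

Lemma measurable_inv_clip d (T : measurableType d) (f : T -> R) e :
  measurable_fun setT f -> measurable_fun setT (fun w => inv_clip e (f w)).
Proof.
move=> mf; apply: measurable_funM => //; apply: measurable_funV.
by apply: measurable_maxr => //; exact: measurable_funX.
Qed.

End clipping.

Section families.
Context d (W : measurableType d) (R : realType).
Variables (Pth : R -> probability W R) (s : W -> R).

Section families_over.
Context d' (V : measurableType d').
Variables (H : W -> V) (mH : measurable_fun setT H).
Implicit Types (g a : R -> V -> R) (phi : V -> R).

Definition L2_le (P : probability W R) (f : V -> R) (C : R) :=
  [/\ measurable_fun setT f, sqint P (f \o H) & \int[P]_w (f (H w) ^+ 2) <= C].

Definition bd_le (P : probability W R) (f : V -> R) (C : R) :=
  measurable_fun setT f /\ {ae P, forall w, `|f (H w)| <= C}.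

Definition fam_L2 g := exists C : R, \forall th \near (0 : R), L2_le (Pth th) (g th) C.

Definition fam_bd g := exists C : R, \forall th \near (0 : R), bd_le (Pth th) (g th) C.

(* [g th] approaches [g 0] weakly enough to be compatible with a changing law:
   both are close to one bounded function in the mean. *)
Definition fam_lim g := forall e : R, 0 < e -> exists2 phi : V -> R,
  measurable_fun setT phi /\ (exists K : R, forall y, `|phi y| <= K) &
  \forall th \near (0 : R), \int[Pth th]_w `|g th (H w) - phi (H w)| <= e.

(** [good] is the class of eta and gamma, for which only second moments are controlled; [bgood] is
    that of rho, delta, kappa and 1 / kappa. Conditional expectation and multiplication by a [bgood]
    family preserve [good], so the backward recursion stays inside it. *)
Definition good g := fam_L2 g /\ fam_lim g.
Definition bgood g := fam_bd g /\ fam_lim g.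

Lemma essbd_comp (P : probability W R) (f : V -> R) C : measurable_fun setT f ->
  {ae P, forall w, `|f (H w)| <= C} -> essbd P (f \o H).
Proof. by move=> mf fC; split; [exact: measurableT_comp|exists C]. Qed.

Lemma sqint_comp (P : probability W R) (f : V -> R) C : measurable_fun setT f ->
  {ae P, forall w, `|f (H w)| <= C} ->
  sqint P (f \o H) /\ \int[P]_w (f (H w) ^+ 2) <= C ^+ 2.
Proof.
move=> mf fC; have sf := essbd_sqint (essbd_comp mf fC); split => //.
rewrite -(Rintegral_prob_cst P (C ^+ 2)); apply: ae_le_Rintegral.
- by have [] := sf.
- exact: int1_cst.
- apply: filterS fC => w fC; rewrite -real_normK ?num_real// lerXn2r ?nnegrE//.
  exact: le_trans fC.
Qed.

Lemma sqint_bounded (P : probability W R) phi : measurable_fun setT phi ->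
  (exists K : R, forall y, `|phi y| <= K) -> sqint P (phi \o H).
Proof.
by move=> mphi [K phiK]; apply: (sqint_comp mphi (C := K) _).1; exact: aeW.
Qed.

Lemma bgood_good g : bgood g -> good g.
Proof.
move=> [[C gC] gl]; split => //; exists (C ^+ 2).
by apply: filterS gC => th [mg gC]; have [] := sqint_comp mg gC; split.
Qed.

Lemma fam_lim_ae g g' : fam_L2 g ->
  (\forall th \near (0 : R), measurable_fun setT (g' th) /\
     {ae Pth th, forall w, g' th (H w) = g th (H w)}) ->
  fam_lim g -> fam_lim g'.
Proof.
move=> [C gC] gg' gl e e0; have [phi [mphi phiK] hphi] := gl e e0.
exists phi => //; near=> th.
have [mg sg _] : L2_le (Pth th) (g th) C by near: th.
have [mg' gg] : measurable_fun setT (g' th) /\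
  {ae Pth th, forall w, g' th (H w) = g th (H w)} by near: th.
rewrite (@ae_Rintegral _ _ _ _ _ (fun w => `|g th (H w) - phi (H w)|)).
- by near: th.
- apply: measurableT_comp => //; apply: measurable_funB; exact: measurableT_comp.
- apply: measurableT_comp => //; apply: measurable_funB; exact: measurableT_comp.
- by apply: filterS gg => w ->.
Unshelve. all: by end_near. Qed.

Lemma bgood_cst phi K : measurable_fun setT phi -> (forall y, `|phi y| <= K) ->
  bgood (fun=> phi).
Proof.
move=> mphi phiK; split.
  by exists K; apply: filterE => th; split => //; exact: aeW.
move=> e e0; exists phi; first by split => //; exists K.
apply: filterE => th.
under eq_Rintegral do rewrite subrr normr0.
by rewrite Rintegral_prob_cst ltW.
Qed.

(** The bound holds only almost surely for each law, whereas the comparison function in [fam_lim]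
    must be bounded everywhere: the clipped [phi] serves. *)
Lemma bgood_cst_ae phi K : measurable_fun setT phi ->
  (\forall th \near (0 : R), {ae Pth th, forall w, `|phi (H w)| <= K}) ->
  bgood (fun=> phi).
Proof.
move=> mphi phiK; have K0 : 0 <= `|K| by [].
have mc : measurable_fun setT (fun y => clip `|K| (phi y)) by exact: measurable_clip.
have bc := bgood_cst mc (fun y => clip_norm _ K0).
split; first by exists K; apply: filterS phiK => th.
apply: fam_lim_ae bc.2; first exact: (bgood_good bc).1.
apply: filterS phiK => th phiK; split => //; apply: filterS phiK => w phiK.
by rewrite clip_id// (le_trans phiK)// ler_norm.
Qed.

Lemma good_cst phi C : measurable_fun setT phi ->
  (\forall th \near (0 : R), sqint (Pth th) (phi \o H) /\
     \int[Pth th]_w (phi (H w) ^+ 2) <= C) -> good (fun=> phi).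
Proof.
move=> mphi phiC; split; first by exists C; apply: filterS phiC => th [].
(* By [clip_tail], clipping at level K costs at most C / K <= e in L1, for all laws at once. *)
move=> e e0; pose K := (1 + `|C|) / e.
have K0 : 0 < K by rewrite divr_gt0// ltr_pwDl.
have mc : measurable_fun setT (fun y => clip K (phi y)) by exact: measurable_clip.
have cK y : `|clip K (phi y)| <= K by exact/clip_norm/ltW.
exists (fun y => clip K (phi y)); first by split => //; exists K.
near=> th.
have [sphi phiCth] : sqint (Pth th) (phi \o H) /\
  \int[Pth th]_w (phi (H w) ^+ 2) <= C by near: th.
have sc : sqint (Pth th) ((fun y => clip K (phi y)) \o H).
  by apply: sqint_bounded => //; exists K.
have [_ i2] := sphi.
apply: (@le_trans _ _ (\int[Pth th]_w (K^-1 * phi (H w) ^+ 2))).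
  apply: le_Rintegral => //.
  - exact: int1_norm (sqint_int1 (sqintB sphi sc)).
  - exact: int1Z.
  by move=> w _; have [] := clip_tail (phi (H w)) K0.
rewrite RintegralZl// ler_pdivrMl// /K divfK ?gt_eqF//.
by rewrite (le_trans phiCth)// (le_trans (ler_norm _))// lerDr.
Unshelve. all: by end_near. Qed.

Lemma fam_L2M a g : fam_bd a -> fam_L2 g -> fam_L2 (fun th y => a th y * g th y).
Proof.
move=> [K aK] [C gC]; exists (K ^+ 2 * C); near=> th.
have [ma aKth] : bd_le (Pth th) (a th) K by near: th.
have [mg sg gCth] : L2_le (Pth th) (g th) C by near: th.
have sag := sqintM (essbd_comp ma aKth) sg.
split => //; first exact: measurable_funM.
apply: (@le_trans _ _ (K ^+ 2 * \int[Pth th]_w (g th (H w) ^+ 2))); last first.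
  by rewrite ler_wpM2l ?sqr_ge0.
have [_ ig2] := sg; have [_ iag2] := sag.
rewrite -RintegralZl//; apply: ae_le_Rintegral => //; first exact: int1Z.
apply: filterS aKth => w aKw.
rewrite exprMn ler_wpM2r ?sqr_ge0// -real_normK ?num_real// lerXn2r ?nnegrE//.
exact: le_trans aKw.
Unshelve. all: by end_near. Qed.

Lemma goodM a g : bgood a -> good g -> good (fun th y => a th y * g th y).
Proof.
move=> [ab al] [gL gl]; split; first exact: fam_L2M.
have [K aK] := ab; have [C gC] := gL.
pose K' := 1 + `|K|; have K'0 : 0 < K' by rewrite ltr_pwDl.
move=> e e0.
have e1 : 0 < e / (2 * K') by rewrite divr_gt0// mulr_gt0.
have [phi [mphi [L phiL]] hphi] := gl _ e1.
pose L' := 1 + `|L|; have L'0 : 0 < L' by rewrite ltr_pwDl.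
have e2 : 0 < e / (2 * L') by rewrite divr_gt0// mulr_gt0.
(* The precision required of [a] depends on the bound of [phi], so [phi] has to be chosen first. *)
have [al' [mal [M alM]] hal] := al _ e2.
exists (fun y => al' y * phi y).
  split; first exact: measurable_funM.
  by exists (M * L) => y; rewrite normrM ler_pM.
near=> th.
have [ma aKth] : bd_le (Pth th) (a th) K by near: th.
have [mg sg gCth] : L2_le (Pth th) (g th) C by near: th.
have sphi : sqint (Pth th) (phi \o H) by apply: sqint_bounded => //; exists L.
have sal : sqint (Pth th) (al' \o H) by apply: sqint_bounded => //; exists M.
have ba := essbd_comp ma aKth.
have bphi : essbd (Pth th) (phi \o H).
  apply: (@essbd_le _ _ _ _ _ L) => [|w]; last exact: phiL.
  exact: measurableT_comp.
have sa := essbd_sqint ba.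
have i1 := int1_norm (sqint_int1 (sqintB sg sphi)).
have i2 := int1_norm (sqint_int1 (sqintB sa sal)).
apply: (@le_trans _ _ (\int[Pth th]_w (K' * `|g th (H w) - phi (H w)| +
    L' * `|a th (H w) - al' (H w)|))).
  apply: ae_le_Rintegral.
  - exact: int1_norm (sqint_int1 (sqintB (sqintM ba sg) (sqintMr sal bphi))).
  - exact: int1D (int1Z _ i1) (int1Z _ i2).
  apply: filterS aKth => w aKw.
  have -> : a th (H w) * g th (H w) - al' (H w) * phi (H w) =
    a th (H w) * (g th (H w) - phi (H w)) + phi (H w) * (a th (H w) - al' (H w)).
    ring.
  rewrite (le_trans (ler_normD _ _))// !normrM lerD// ler_wpM2r//.
    by rewrite (le_trans aKw)// /K' (le_trans (ler_norm _))// lerDr.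
  by rewrite (le_trans (phiL _))// /L' (le_trans (ler_norm _))// lerDr.
rewrite RintegralD//; [|exact: int1Z i1|exact: int1Z i2].
rewrite !RintegralZl//.
have h1 : \int[Pth th]_w `|g th (H w) - phi (H w)| <= e / (2 * K') by near: th.
have h2 : \int[Pth th]_w `|a th (H w) - al' (H w)| <= e / (2 * L') by near: th.
have -> : e = K' * (e / (2 * K')) + L' * (e / (2 * L')).
  by field; rewrite !gt_eqF.
by rewrite lerD// ler_pM2l.
Unshelve. all: by end_near. Qed.

Lemma bgoodM a g : bgood a -> bgood g -> bgood (fun th y => a th y * g th y).
Proof.
move=> ba bg; split; last exact: (goodM ba (bgood_good bg)).2.
have [[K aK] _] := ba; have [[C gC] _] := bg; exists (K * C).
apply: filterS2 aK gC => th [ma aK] [mg gC]; split; first exact: measurable_funM.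
by apply: filterS2 aK gC => w aK gC; rewrite normrM ler_pM.
Qed.

Lemma fam_limB g g' : fam_L2 g -> fam_L2 g' -> fam_lim g -> fam_lim g' ->
  fam_lim (fun th y => g th y - g' th y).
Proof.
move=> [C gC] [C' gC'] gl gl' e e0.
have e2 : 0 < e / 2 by rewrite divr_gt0.
have [phi [mphi [L phiL]] hphi] := gl _ e2.
have [phi' [mphi' [L' phiL']] hphi'] := gl' _ e2.
exists (fun y => phi y - phi' y).
  split; first exact: measurable_funB.
  by exists (L + L') => y; rewrite (le_trans (ler_normB _ _))// lerD.
near=> th.
have [mg sg _] : L2_le (Pth th) (g th) C by near: th.
have [mg' sg' _] : L2_le (Pth th) (g' th) C' by near: th.
have sphi : sqint (Pth th) (phi \o H) by apply: sqint_bounded => //; exists L.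
have sphi' : sqint (Pth th) (phi' \o H) by apply: sqint_bounded => //; exists L'.
have i1 := int1_norm (sqint_int1 (sqintB sg sphi)).
have i2 := int1_norm (sqint_int1 (sqintB sg' sphi')).
have h1 : \int[Pth th]_w `|g th (H w) - phi (H w)| <= e / 2 by near: th.
have h2 : \int[Pth th]_w `|g' th (H w) - phi' (H w)| <= e / 2 by near: th.
apply: (@le_trans _ _ (\int[Pth th]_w (`|g th (H w) - phi (H w)| +
    `|g' th (H w) - phi' (H w)|))); last first.
  by rewrite RintegralD//; move: h1 h2; lra.
apply: le_Rintegral => //.
- exact: int1_norm (sqint_int1 (sqintB (sqintB sg sg') (sqintB sphi sphi'))).
- exact: int1D i1 i2.
move=> w _; rewrite [X in `|X|](_ : _ =
    (g th (H w) - phi (H w)) - (g' th (H w) - phi' (H w))); last by ring.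
exact: ler_normB.
Unshelve. all: by end_near. Qed.

Lemma goodB g g' : good g -> good g' -> good (fun th y => g th y - g' th y).
Proof.
move=> [gL gl] [gL' gl']; split; last exact: fam_limB.
have [C gC] := gL; have [C' gC'] := gL'; exists (2 * (C + C')).
near=> th.
have [mg sg iC] : L2_le (Pth th) (g th) C by near: th.
have [mg' sg' iC'] : L2_le (Pth th) (g' th) C' by near: th.
have [_ i1] := sg; have [_ i2] := sg'.
split; [exact: measurable_funB|exact: sqintB|].
apply: (@le_trans _ _ (\int[Pth th]_w (2 * (g th (H w) ^+ 2 + g' th (H w) ^+ 2)))).
  apply: le_Rintegral => //.
  - by have [] := sqintB sg sg'.
  - by apply: int1Z; exact: int1D.
  move=> w _; have := sqr_ge0 (g th (H w) + g' th (H w)); nra.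
rewrite RintegralZl//; last exact: int1D.
by rewrite RintegralD//; move: iC iC'; lra.
Unshelve. all: by end_near. Qed.

Lemma bgoodB g g' : bgood g -> bgood g' -> bgood (fun th y => g th y - g' th y).
Proof.
move=> bg bg'.
split; last exact: (goodB (bgood_good bg) (bgood_good bg')).2.
have [[C gC] _] := bg; have [[C' gC'] _] := bg'; exists (C + C').
apply: filterS2 gC gC' => th [mg gC] [mg' gC']; split; first exact: measurable_funB.
apply: filterS2 gC gC' => w gC gC'.
by rewrite (le_trans (ler_normB _ _))// lerD.
Qed.

(** [inv_clip] is Lipschitz, so composing with it preserves closeness in the mean, and it agrees
    almost surely with the inverse because |g| >= e. *)
Lemma bgood_inv g e : 0 < e -> bgood g ->
  (\forall th \near (0 : R), {ae Pth th, forall w, e <= `|g th (H w)|}) ->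
  bgood (fun th y => (g th y)^-1).
Proof.
move=> e0 bg ge.
have [[C gC] gl] := bg.
have e20 : 0 < e ^+ 2 by rewrite exprn_gt0.
have bi : bgood (fun th y => inv_clip e (g th y)).
  split.
    exists e^-1; apply: filterS gC => th [mg _]; split.
      exact: measurable_inv_clip.
    by apply: aeW => w; exact: inv_clip_norm.
  move=> eps eps0; have eps1 : 0 < eps * e ^+ 2 by rewrite mulr_gt0.
  have [phi [mphi [K phiK]] hphi] := gl _ eps1.
  have bphi : exists L : R, forall y, `|inv_clip e (phi y)| <= L.
    by exists e^-1 => y; exact: inv_clip_norm.
  have mphi' : measurable_fun setT (fun y => inv_clip e (phi y)).
    exact: measurable_inv_clip.
  exists (fun y => inv_clip e (phi y)) => //.
  near=> th.
  have [mg gCth] : bd_le (Pth th) (g th) C by near: th.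
  have [sg _] := sqint_comp mg gCth.
  have sphi : sqint (Pth th) (phi \o H) by apply: sqint_bounded => //; exists K.
  have sgi : sqint (Pth th) ((fun y => inv_clip e (g th y)) \o H).
    apply: sqint_bounded; first exact: measurable_inv_clip.
    by exists e^-1 => y; exact: inv_clip_norm.
  have sphi' : sqint (Pth th) ((fun y => inv_clip e (phi y)) \o H).
    exact: sqint_bounded.
  have h : \int[Pth th]_w `|g th (H w) - phi (H w)| <= eps * e ^+ 2 by near: th.
  have i1 := int1_norm (sqint_int1 (sqintB sg sphi)).
  apply: (@le_trans _ _ (\int[Pth th]_w ((e ^+ 2)^-1 * `|g th (H w) - phi (H w)|))).
    apply: le_Rintegral => //.
    - exact: int1_norm (sqint_int1 (sqintB sgi sphi')).
    - exact: int1Z.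
    - by move=> w _; exact: inv_clip_lipschitz.
  by rewrite RintegralZl// mulrC ler_pdivrMr.
have ae_inv : \forall th \near (0 : R), measurable_fun setT (fun y => (g th y)^-1) /\
    {ae Pth th, forall w, (g th (H w))^-1 = inv_clip e (g th (H w))}.
  apply: filterS2 gC ge => th [mg _] ge; split; first exact: measurable_funV.
  by apply: filterS ge => w ge; rewrite inv_clipE.
split; last by apply: fam_lim_ae ae_inv bi.2; exact: (bgood_good bi).1.
exists e^-1; apply: filterS ae_inv => th [mi ai]; split => //.
by apply: filterS ai => w ->; exact: inv_clip_norm.
Unshelve. all: by end_near. Qed.

End families_over.

Lemma good_pull d' (V : measurableType d') (H : W -> V) (g : R -> V -> R) :
  measurable_fun setT H -> good H g -> good id (fun th w => g th (H w)).
Proof.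
move=> mH [[C gC] gl]; split.
  exists C; apply: filterS gC => th [mg sg gC]; split => //.
  exact: measurableT_comp.
move=> e e0; have [phi [mphi [K phiK]] h] := gl e e0.
exists (phi \o H) => //; split; first exact: measurableT_comp.
by exists K => w; exact: phiK.
Qed.

Lemma bgood_pull d' (V : measurableType d') (H : W -> V) (g : R -> V -> R) :
  measurable_fun setT H -> bgood H g -> bgood id (fun th w => g th (H w)).
Proof.
move=> mH bg; split; last exact: (good_pull mH (bgood_good mH bg)).2.
have [[C gC] _] := bg; exists C; apply: filterS gC => th [mg gC]; split => //.
exact: measurableT_comp.
Qed.

End families.

(** * Conditional expectations along a path *)

Section conditional_expectation_along_paths.
Context d d' (W : measurableType d) (V : measurableType d') (R : realType).
Variables (Pth : R -> probability W R) (s : W -> R).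
Hypothesis dPth : differentiable_path Pth s.
Variables (H : W -> V) (mH : measurable_fun setT H).
Implicit Types (X g : R -> W -> R) (phi : V -> R).

Lemma sqint_bdd_le (P : probability W R) (f : W -> R) (K : R) :
  measurable_fun setT f -> (forall w, `|f w| <= K) ->
  sqint P f /\ \int[P]_w (f w ^+ 2) <= K ^+ 2.
Proof.
move=> mf fK.
by apply: (sqint_comp (H := id) _ mf); [exact: measurable_id|exact: aeW].
Qed.

Let sgn phi (y : V) : R := 2 * \1_[set y | 0 <= phi y] y - 1.

Let measurable_sgn phi : measurable_fun setT phi -> measurable_fun setT (sgn phi).
Proof.
move=> mphi; apply: measurable_funB => //; apply: measurable_funM => //.
apply: measurable_indic; rewrite -[X in measurable X]setTI.
rewrite (_ : [set y | _] = phi @^-1` `[0, +oo[%classic).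
  by apply: mphi => //; exact: measurable_itv.
by apply/seteqP; split => y /=; rewrite in_itv/= andbT.
Qed.

Let sgn_norm phi y : `|sgn phi y| <= 1.
Proof.
rewrite /sgn indicE; case: (y \in _); rewrite ?mulr1 ?mulr0 ler_norml; lra.
Qed.

Let sgnM phi y : sgn phi y * phi y = `|phi y|.
Proof.
rewrite /sgn indicE; case: (boolP (y \in _)).
  by rewrite inE /= => h; rewrite ger0_norm//; ring.
rewrite notin_setE /= => /negP; rewrite -ltNge => h.
by rewrite ltr0_norm//; ring.
Qed.

(** Let [phi] approximate X_th, m = E_0[phi | H] and sg the sign of E_th[X_th | H] - m. Then
    E_th|E_th[X_th | H] - m| = E_th[sg (X_th - phi)] + E_th[sg (phi - m)]. The first term is small
    by the choice of [phi]; the second has mean zero under [Pth 0], so the Lipschitz property makes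
    it O(th), although sg itself depends on [th]. *)
Lemma fam_lim_condE X : good Pth id X ->
  fam_lim Pth H (fun th => condE (Pth th) H (X th)).
Proof.
move=> [[C XC] Xl] e e0.
have [_ _ [L L0 hL] _] := dPth.
have e2 : 0 < e / 2 by rewrite divr_gt0.
have [phi [mphi [K0 phiK0]] hphi] := Xl _ e2.
pose K := 1 + `|K0|; have Kp : 0 < K by rewrite ltr_pwDl.
have phiK w : `|phi w| <= K.
  by rewrite (le_trans (phiK0 w))// /K (le_trans (ler_norm _))// lerDr.
have [sphi0 _] := sqint_bdd_le (Pth 0) mphi phiK.
pose m0 := condE (Pth 0) H phi.
have m0P : cond_proj (Pth 0) H phi m0 by exact: condE_proj.
have [mm0 sm0 pm0] := m0P.
have m0K : {ae Pth 0, forall w, `|m0 (H w)| <= K}.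
  by apply: cond_proj_norm_le m0P _ => //; exact: aeW.
(* The bound on [m0] is known only almost surely for [Pth 0], which gives no control under
   [Pth th]. *)
pose m y := clip K (m0 y).
have mm : measurable_fun setT m by exact: measurable_clip.
have mK y : `|m y| <= K by apply: clip_norm; exact: ltW.
have mE : {ae Pth 0, forall w, m (H w) = m0 (H w)}.
  by apply: filterS m0K => w; exact: clip_id.
have mmH : measurable_fun setT (m \o H) by exact: measurableT_comp.
exists m; first by split => //; exists K.
near=> th.
have [mX sX _] : L2_le id (Pth th) (X th) C by near: th.
have sXth : sqint (Pth th) (X th) by [].
set c := condE (Pth th) H (X th).
have [mc sc pc] : cond_proj (Pth th) H (X th) c by exact: condE_proj.
pose sg := sgn (fun y => c y - m y).
have msg : measurable_fun setT sg by apply: measurable_sgn; exact: measurable_funB.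
have msgH : measurable_fun setT (sg \o H) by exact: measurableT_comp.
have sg1 w : `|(sg \o H) w| <= 1 by exact: sgn_norm.
have [ssg _] := sqint_bdd_le (Pth th) msgH sg1.
have [ssg0 _] := sqint_bdd_le (Pth 0) msgH sg1.
have bsg := essbd_le (Pth th) msgH sg1.
have [smH _] := sqint_bdd_le (Pth th) mmH (fun w => mK (H w)).
have [smH0 _] := sqint_bdd_le (Pth 0) mmH (fun w => mK (H w)).
have [sphi _] := sqint_bdd_le (Pth th) mphi phiK.
have -> : \int[Pth th]_w `|c (H w) - m (H w)| =
    \int[Pth th]_w (sg (H w) * (X th w - phi w)) +
    \int[Pth th]_w (sg (H w) * (phi w - m (H w))).
  rewrite -RintegralD//; last 2 first.
  - exact: sqint_int1M ssg (sqintB sXth sphi).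
  - exact: sqint_int1M ssg (sqintB sphi smH).
  transitivity (\int[Pth th]_w (sg (H w) * c (H w) - sg (H w) * m (H w))).
    by apply: eq_Rintegral => w _; rewrite -mulrBr sgnM.
  rewrite RintegralB//; [|exact: sqint_int1M ssg sc|exact: sqint_int1M ssg smH].
  rewrite pc// -RintegralB//;
    [|exact: sqint_int1M ssg sXth|exact: sqint_int1M ssg smH].
  by apply: eq_Rintegral => w _; ring.
have h1 : \int[Pth th]_w (sg (H w) * (X th w - phi w)) <= e / 2.
  apply: (@le_trans _ _ (\int[Pth th]_w `|X th w - phi w|)); last by near: th.
  apply: le_Rintegral => //; first exact: sqint_int1M ssg (sqintB sXth sphi).
    exact: int1_norm (sqint_int1 (sqintB sXth sphi)).
  move=> w _; rewrite (le_trans (ler_norm _))// normrM.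
  by rewrite ler_piMl//; exact: sg1.
pose f w := sg (H w) * (phi w - m (H w)).
have mf : measurable_fun setT f by apply: measurable_funM => //; exact: measurable_funB.
have fK w : `|f w| <= 2 * K.
  rewrite normrM -[leRHS]mul1r ler_pM//; first exact: sg1.
  by rewrite (le_trans (ler_normB _ _))// mulrDl mul1r lerD.
have f0 : \int[Pth 0]_w f w = 0.
  rewrite /f; under eq_Rintegral do rewrite mulrBr.
  rewrite RintegralB//; [|exact: sqint_int1M ssg0 sphi0|exact: sqint_int1M ssg0 smH0].
  rewrite -pm0// (@ae_Rintegral _ _ _ _ (fun w => sg (H w) * m0 (H w))
    (fun w => sg (H w) * m (H w))) ?subrr//.
  - by apply: measurable_funM => //; exact: measurableT_comp.
  - exact: measurable_funM.
  - by apply: filterS mE => w ->.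
have thsmall : `|th| < e / 2 / (L * (2 * K)).
  by near: th; apply: near0_norm_lt; rewrite !divr_gt0// !mulr_gt0.
have [sf fle] := sqint_bdd_le (Pth th) mf fK.
have [sf0 fle0] := sqint_bdd_le (Pth 0) mf fK.
have hLth : lipschitz_at Pth L th by near: th.
have K20 : 0 < 2 * K by rewrite mulr_gt0.
have := hLth f _ K20 sf sf0 fle fle0; rewrite f0 subr0 => h2.
have {}h2 : \int[Pth th]_w f w <= e / 2.
  rewrite (le_trans (ler_norm _))// (le_trans h2)//.
  move: thsmall; rewrite ltr_pdivlMr ?mulr_gt0// => /ltW.
  by rewrite mulrA [`|th| * L]mulrC.
by move: h1 h2; rewrite /f; lra.
Unshelve. all: by end_near. Qed.

Lemma good_condE X : good Pth id X -> good Pth H (fun th => condE (Pth th) H (X th)).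
Proof.
move=> gX; split; last exact: fam_lim_condE.
have [[C XC] _] := gX; exists C; apply: filterS XC => th [mX sX XC].
have cP := condE_proj mH sX; have [mc sc _] := cP.
by split => //; exact: le_trans (cond_proj_sqr_le sX cP) XC.
Qed.

Lemma bgood_condE X : bgood Pth id X ->
  bgood Pth H (fun th => condE (Pth th) H (X th)).
Proof.
move=> bX.
have gX := bgood_good (@measurable_id _ W setT) bX.
split; last exact: fam_lim_condE.
have [[C XC] _] := bX; have [[C' XC'] _] := gX.
exists C; apply: filterS2 XC XC' => th [mX XC] [_ sX _].
have cP := condE_proj mH sX; have [mc _ _] := cP.
by split => //; exact: cond_proj_norm_le sX cP XC.
Qed.

(** * Variables centered given H at the base law *)

Section centered.
Variables (X : W -> R) (K : R).
Hypotheses (K0 : 0 < K) (mX : measurable_fun setT X)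
  (XK : \forall th \near (0 : R), {ae Pth th, forall w, `|X w| <= K})
  (X0 : forall phi, measurable_fun setT phi -> sqint (Pth 0) (phi \o H) ->
    \int[Pth 0]_w (phi (H w) * X w) = 0).

Let sX th : {ae Pth th, forall w, `|X w| <= K} ->
  essbd (Pth th) X /\ sqint (Pth th) X.
Proof.
move=> XKth; have b : essbd (Pth th) X by split => //; exists K.
by split => //; exact: essbd_sqint.
Qed.

Let sqMX th phi (A : R) : {ae Pth th, forall w, `|X w| <= K} ->
  sqint (Pth th) (phi \o H) -> \int[Pth th]_w (phi (H w) ^+ 2) <= A ->
  sqint (Pth th) (fun w => phi (H w) * X w) /\
  \int[Pth th]_w ((phi (H w) * X w) ^+ 2) <= K ^+ 2 * A.
Proof.
move=> XKth sphi phiA; have [bX _] := sX XKth.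
have sM := sqintMr sphi bX; split => //.
apply: (@le_trans _ _ (K ^+ 2 * \int[Pth th]_w (phi (H w) ^+ 2))); last first.
  by rewrite ler_pM2l// exprn_gt0.
have [_ i1] := sM; have [_ i2] := sphi.
rewrite -RintegralZl//; apply: ae_le_Rintegral => //; first exact: int1Z.
apply: filterS XKth => w XKw.
rewrite exprMn mulrC ler_wpM2r ?sqr_ge0// -real_normK ?num_real// lerXn2r ?nnegrE//.
exact: ltW.
Qed.

Let centered_rep (C1 th : R) (r : V -> R) :=
  [/\ measurable_fun setT r, (forall y, `|r y| <= K),
    (forall phi, measurable_fun setT phi -> sqint (Pth th) (phi \o H) ->
      \int[Pth th]_w (phi (H w) * X w) = \int[Pth th]_w (phi (H w) * r (H w))),
    \int[Pth th]_w (r (H w) ^+ 2) <= (C1 * `|th|) ^+ 2 &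
    \int[Pth 0]_w (r (H w) ^+ 2) <= (C1 * `|th|) ^+ 2].

(* Since [X] is centered given [H] at [th = 0], the squared norm of [r] is an
   increment of expectations, of order [`|th| * norm r]. *)
Let centered_condE : exists2 C1 : R, 0 < C1 & \forall th \near (0 : R),
  exists r, centered_rep C1 th r.
Proof.
have [_ _ [L L0 hL] _] := dPth.
have XK0 : {ae Pth 0, forall w, `|X w| <= K} by exact: nbhs_singleton XK.
(* With A and B the squared norms of r under [Pth th] and [Pth 0], and u^2 = A + B, the Lipschitz
   bound applied to r X and to r^2 gives A <= L K |th| u and B <= A + L K |th| u. Hence u^2 <= 3 L K
   |th| u. Both laws enter because the Lipschitz bound asks for both norms. *)
exists (3 * L * K); first by rewrite !mulr_gt0.
near=> th.
have XKth : {ae Pth th, forall w, `|X w| <= K} by near: th.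
have [bX sXth] := sX XKth.
pose c := condE (Pth th) H X.
have cP : cond_proj (Pth th) H X c by exact: condE_proj.
have [mc sc pc] := cP.
have cK := cond_proj_norm_le mH sXth cP XKth.
pose r y := clip K (c y).
have mr : measurable_fun setT r by exact: measurable_clip.
have rK y : `|r y| <= K by apply: clip_norm; exact: ltW.
have mrH : measurable_fun setT (r \o H) by exact: measurableT_comp.
have [sr _] := sqint_bdd_le (Pth th) mrH (fun w => rK (H w)).
have [sr0 _] := sqint_bdd_le (Pth 0) mrH (fun w => rK (H w)).
have rc : {ae Pth th, forall w, r (H w) = c (H w)}.
  by apply: filterS cK => w; exact: clip_id.
have pr phi : measurable_fun setT phi -> sqint (Pth th) (phi \o H) ->
    \int[Pth th]_w (phi (H w) * X w) = \int[Pth th]_w (phi (H w) * r (H w)).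
  move=> mphi sphi; rewrite -pc//; apply: ae_Rintegral.
  - by apply: measurable_funM; exact: measurableT_comp.
  - by apply: measurable_funM; exact: measurableT_comp.
  - by apply: filterS rc => w ->.
exists r; suff [h1 h2] : \int[Pth th]_w (r (H w) ^+ 2) <= (3 * L * K * `|th|) ^+ 2 /\
    \int[Pth 0]_w (r (H w) ^+ 2) <= (3 * L * K * `|th|) ^+ 2 by split.
pose A := \int[Pth th]_w (r (H w) ^+ 2).
pose B := \int[Pth 0]_w (r (H w) ^+ 2).
have A0 : 0 <= A by apply: Rintegral_ge0 => w _; exact: sqr_ge0.
have B0 : 0 <= B by apply: Rintegral_ge0 => w _; exact: sqr_ge0.
have [AB|AB] := leP (A + B) 0.
  have [A00 B00] : A <= 0 /\ B <= 0 by split; lra.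
  by split; [apply: le_trans A00 _|apply: le_trans B00 _]; exact: sqr_ge0.
pose u := Num.sqrt (A + B).
have u0 : 0 < u by rewrite sqrtr_gt0.
have uE : u ^+ 2 = A + B by rewrite sqr_sqrtr// ltW.
have hLth : lipschitz_at Pth L th by near: th.
have Ku0 : 0 < K * u by rewrite mulr_gt0.
have Ale : A <= L * `|th| * (K * u).
  have [s1 l1] := sqMX XKth sr (lexx _); have [s2 l2] := sqMX XK0 sr0 (lexx _).
  have := hLth _ _ Ku0 s1 s2; rewrite X0// subr0.
  have -> : \int[Pth th]_w (r (H w) * X w) = A.
    by rewrite pr//; apply: eq_Rintegral => w _; rewrite expr2.
  rewrite exprMn uE => h; apply: le_trans (h _ _); first exact: ler_norm.
    by apply: (le_trans l1); rewrite ler_pM2l ?exprn_gt0// lerDl.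
  by apply: (le_trans l2); rewrite ler_pM2l ?exprn_gt0// lerDr.
have Ble : B <= A + L * `|th| * (K * u).
  have mr2 : measurable_fun setT (fun w => r (H w) ^+ 2) by exact: measurable_funX.
  have r2K w : `|r (H w) ^+ 2| <= K ^+ 2 by rewrite normrX lerXn2r// nnegrE ltW.
  have [s1 _] := sqint_bdd_le (Pth th) mr2 r2K.
  have [s2 _] := sqint_bdd_le (Pth 0) mr2 r2K.
  have r4 P' : sqint P' (r \o H) -> sqint P' (fun w => r (H w) ^+ 2) ->
     \int[P']_w ((r (H w) ^+ 2) ^+ 2) <= K ^+ 2 * \int[P']_w (r (H w) ^+ 2).
    move=> [_ i1] [_ i2]; rewrite -RintegralZl//; apply: le_Rintegral => //.
      exact: int1Z.
    move=> w _; rewrite expr2 ler_wpM2r ?sqr_ge0//.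
    by rewrite -[leLHS]ger0_norm ?sqr_ge0.
  have := hLth _ _ Ku0 s1 s2; rewrite -/A -/B exprMn uE => h.
  have : `|A - B| <= L * `|th| * (K * u).
    apply: h.
      by rewrite (le_trans (r4 _ sr s1))// ler_pM2l ?exprn_gt0// lerDl.
    by rewrite (le_trans (r4 _ sr0 s2))// ler_pM2l ?exprn_gt0// lerDr.
  by rewrite ler_norml => /andP[]; lra.
have ule : u <= 3 * L * K * `|th|.
  by rewrite -(ler_pM2l u0) -expr2 uE; move: Ale Ble; lra.
have u2 : u ^+ 2 <= (3 * L * K * `|th|) ^+ 2.
  by rewrite lerXn2r// nnegrE; [exact: ltW|rewrite (le_trans _ ule)// ltW].
by rewrite -/A -/B; split; apply: le_trans u2; rewrite uE ?lerDl ?lerDr.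
Unshelve. all: by end_near. Qed.

Definition small_at (C' e del th : R) := forall h : V -> R, measurable_fun setT h ->
  sqint (Pth th) (h \o H) -> \int[Pth th]_w (h (H w) ^+ 2) <= C' ^+ 2 ->
  \int[Pth th]_w `|h (H w)| <= del ->
  `|\int[Pth th]_w (h (H w) * X w)| <= e * `|th|.

(** E_th[h X] = E_th[h r] with r of norm O(th). Off the set |h| > 1, h^2 <= |h| makes h small in L2.
    On that set, whose probability is at most E_th|h|, the roles change: h is merely bounded in L2,
    but E_th[r^2; |h| > 1] is an increment of the expectation of a function carried by a small set,
    so equicontinuity makes it o(th^2). *)
Lemma centered_small (C' e : R) : 0 < C' -> 0 < e -> exists2 del : R, 0 < del &
  \forall th \near (0 : R), small_at C' e del th.
Proof.
move=> C'0 e0.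
have [_ _ _ hE] := dPth.
have [C1 C10 hC1] := centered_condE.
have XK0 : {ae Pth 0, forall w, `|X w| <= K} by exact: nbhs_singleton XK.
(* Norms of the small factors, chosen so that t1 C1 and C' t2, one for each part of the split, both
   equal e / 2. *)
pose t1 := e / (2 * C1); pose t2 := e / (2 * C').
have t10 : 0 < t1 by rewrite divr_gt0// mulr_gt0.
have t20 : 0 < t2 by rewrite divr_gt0// mulr_gt0.
have e1 : 0 < t2 ^+ 2 / (K * C1) by rewrite divr_gt0 ?exprn_gt0// mulr_gt0.
have [del del0 hdel] := hE _ e1.
exists (Num.min del (t1 ^+ 2)); first by rewrite lt_min del0 exprn_gt0.
near=> th => h mh sh hC'; rewrite le_min => /andP[hdel1 hdel2].
have XKth : {ae Pth th, forall w, `|X w| <= K} by near: th.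
have [r [mr rK pr rth r0]] : exists r, centered_rep C1 th r by near: th.
have mrH : measurable_fun setT (r \o H) by exact: measurableT_comp.
have [sr _] := sqint_bdd_le (Pth th) mrH (fun w => rK (H w)).
have [sr0 _] := sqint_bdd_le (Pth 0) mrH (fun w => rK (H w)).
have brth := essbd_le (Pth th) mrH (fun w => rK (H w)).
have [th0|th0] := eqVneq th 0.
  have sh0 : sqint (Pth 0) (h \o H) by rewrite -th0.
  by rewrite th0 X0// normr0 mulr_ge0// ltW.
have Cth : 0 < C1 * `|th| by rewrite mulr_gt0// normr_gt0.
pose B := [set y | 1 < `|h y|].
have mB : measurable B by exact: measurable_norm_gt.
have mHB : measurable (H @^-1` B) by rewrite -[X in measurable X]setTI; exact: mH.
have BE w : \1_(H @^-1` B) w = \1_B (H w) :> R by [].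
have PB : \int[Pth th]_w \1_(H @^-1` B) w <= del.
  apply: le_trans hdel1; apply: le_Rintegral => //.
  - exact: sqint_int1 (essbd_sqint (essbd_indic _ mHB)).
  - exact: int1_norm (sqint_int1 sh).
  move=> w _; rewrite BE indicE; case: (boolP (H w \in B)) => [|_]; last exact: normr_ge0.
  by rewrite inE /B /= => /ltW.
pose rB y := r y * \1_B y.
have mrB : measurable_fun setT rB by apply: measurable_funM => //; exact: measurable_indic.
have rBle y : `|rB y| <= `|r y|.
  rewrite /rB indicE; case: (y \in B); rewrite ?mulr1// mulr0 normr0//.
have mrBH := measurableT_comp mrB mH.
have srB := sqint_le mrBH sr (fun w => rBle (H w)).
have srB0 := sqint_le mrBH sr0 (fun w => rBle (H w)).
have rB2 y : rB y ^+ 2 <= r y ^+ 2.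
  by rewrite -[leLHS]real_normK ?num_real// -[leRHS]real_normK ?num_real// lerXn2r ?nnegrE.
have irB : \int[Pth th]_w (rB (H w) ^+ 2) <= (C1 * `|th|) ^+ 2.
  by apply: le_trans rth; apply: le_Rintegral => //; [case: srB|case: sr].
have irB0 : \int[Pth 0]_w (rB (H w) ^+ 2) <= (C1 * `|th|) ^+ 2.
  by apply: le_trans r0; apply: le_Rintegral => //; [case: srB0|case: sr0].
have [s1 l1] := sqMX XKth srB irB; have [s2 l2] := sqMX XK0 srB0 irB0.
have hEth : equicontinuous_at Pth (t2 ^+ 2 / (K * C1)) del th by near: th.
have KC0 : 0 < K * (C1 * `|th|) by rewrite mulr_gt0.
have rBsmall : \int[Pth th]_w (rB (H w) ^+ 2) <= (t2 * `|th|) ^+ 2.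
  have -> : \int[Pth th]_w (rB (H w) ^+ 2) = \int[Pth th]_w (rB (H w) * X w).
    rewrite pr//; apply: eq_Rintegral => w _.
    rewrite /rB indicE; case: (H w \in B); rewrite ?mulr1 ?expr2//.
    by rewrite mulr0 !mul0r.
  have rB_out w : ~ (H @^-1` B) w -> rB (H w) * X w = 0.
    move=> nB; rewrite /rB indicE memNset// mulr0 mul0r//.
  have := hEth _ _ _ KC0 mHB PB rB_out s1 s2.
  rewrite X0// subr0 exprMn => /(_ l1 l2).
  move=> h1; rewrite (le_trans (ler_norm _))// (le_trans h1)//.
  rewrite le_eqVlt; apply/orP; left; apply/eqP.
  by field; rewrite !gt_eqF.
pose hC y := h y * \1_(~` B) y.
have mhC : measurable_fun setT hC.
  by apply: measurable_funM => //; apply: measurable_indic; exact: measurableC.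
have hCle y : `|hC y| <= 1 /\ `|hC y| <= `|h y|.
  rewrite /hC indicE; case: (boolP (y \in _)).
    by rewrite inE /B /= mulr1 => /negP; rewrite -leNgt.
  by rewrite mulr0 normr0 ler01.
have shC := sqint_le (measurableT_comp mhC mH) sh (fun w => (hCle (H w)).2).
have hC2 : \int[Pth th]_w (hC (H w) ^+ 2) <= t1 ^+ 2.
  apply: le_trans hdel2; apply: le_Rintegral => //; first by case: shC.
    exact: int1_norm (sqint_int1 sh).
  move=> w _; have [a b] := hCle (H w).
  rewrite -real_normK ?num_real// expr2 (le_trans _ b)//.
  by rewrite ler_piMl.
rewrite pr//.
have -> : \int[Pth th]_w (h (H w) * r (H w)) =
    \int[Pth th]_w (h (H w) * rB (H w)) + \int[Pth th]_w (hC (H w) * r (H w)).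
  rewrite -RintegralD//; [|exact: sqint_int1M sh srB|exact: sqint_int1M shC sr].
  apply: eq_Rintegral => w _; rewrite /rB /hC !indicE in_setC.
  by case: (H w \in B); rewrite /=; ring.
rewrite (le_trans (ler_normD _ _))//.
have -> : e * `|th| = C' * (t2 * `|th|) + t1 * (C1 * `|th|).
  by rewrite /t1 /t2; field; rewrite !gt_eqF.
have thp : 0 < t2 * `|th| by rewrite mulr_gt0// normr_gt0.
by apply: lerD; apply: Rintegral_CS_norm.
Unshelve. all: by end_near. Qed.

End centered.
End conditional_expectation_along_paths.

(** * Derivatives of centered expectations *)

Section derivative_at_zero.
Context (R : realType).
Implicit Types (F G : R -> R) (u v : R).

(** Free of quotients, so that estimates of the form e |th| apply directly and [th = 0] is no
    exception. *)
Definition has_deriv0 F v := forall e : R, 0 < e -> \forall th \near (0 : R),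
  `|F th - F 0 - th * v| <= e * `|th|.

Lemma has_deriv0D F G u v : has_deriv0 F u -> has_deriv0 G v ->
  has_deriv0 (fun th => F th + G th) (u + v).
Proof.
move=> hF hG e e0; have e2 : 0 < e / 2 by rewrite divr_gt0.
apply: filterS2 (hF _ e2) (hG _ e2) => th h1 h2.
rewrite [X in `|X|](_ : _ = (F th - F 0 - th * u) + (G th - G 0 - th * v)); last ring.
by rewrite (le_trans (ler_normD _ _))//; lra.
Qed.

Lemma has_deriv0N F u : has_deriv0 F u -> has_deriv0 (fun th => - F th) (- u).
Proof.
move=> hF e e0; apply: filterS (hF _ e0) => th.
rewrite -normrN; congr (`|_| <= _); ring.
Qed.

Lemma has_deriv0B F G u v : has_deriv0 F u -> has_deriv0 G v ->
  has_deriv0 (fun th => F th - G th) (u - v).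
Proof. by move=> hF /has_deriv0N; exact: has_deriv0D. Qed.

Lemma has_deriv0_sum n (F : 'I_n -> R -> R) (v : 'I_n -> R) :
  (forall i, has_deriv0 (F i) (v i)) ->
  has_deriv0 (fun th => \sum_(i < n) F i th) (\sum_(i < n) v i).
Proof.
move=> hF; elim: n F v hF => [|n IH] F v hF.
  move=> e e0; apply: filterE => th.
  by rewrite !big_ord0 mulr0 !subr0 normr0 mulr_ge0// ltW.
have := has_deriv0D (IH _ _ (fun i => hF (widen_ord (leqnSn n) i))) (hF ord_max).
rewrite -big_ord_recr; congr has_deriv0.
by apply/funext => th; rewrite big_ord_recr.
Qed.

Lemma has_deriv0_near F G v : (\forall th \near (0 : R), F th = G th) ->
  has_deriv0 G v -> has_deriv0 F v.
Proof.
move=> FG hG e e0; have FG0 : F 0 = G 0 by exact: nbhs_singleton FG.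
by apply: filterS2 FG (hG _ e0) => th ->; rewrite FG0.
Qed.

Lemma has_deriv0_is_derive F v : has_deriv0 F v -> is_derive (0 : R) (1 : R) F v.
Proof.
move=> hF.
have cF : (fun h : R => h^-1 *: (F (h *: (1 : R) + 0) - F 0)) @ (0 : R)^' --> v.
  apply/cvgrPdist_le => e e0; rewrite near_withinE.
  apply: filterS (hF _ e0) => h hh h0.
  rewrite /= addr0 [h *: 1]mulr1 [_ *: _]/(h^-1 * (F h - F 0)).
  have eh : F h - F 0 - h * v = - ((v - h^-1 * (F h - F 0)) * h) by field.
  by move: hh; rewrite eh normrN normrM ler_pM2r// normr_gt0.
apply: DeriveDef; first by apply/cvg_ex; exists v; exact: cF.
exact: cvg_lim cF.
Qed.

End derivative_at_zero.

Section fixed_law.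
Context d (W : measurableType d) (R : realType) (P : probability W R).

(** Counterpart of [centered_small] under one law, for the derivative itself. The split is again at
    |h| > 1: on that set the integral of q^2 is small by absolute continuity, and off it h is small
    in L2 because h^2 <= |h|. *)
Lemma Rintegral_mul_small (q : W -> R) (C e : R) : sqint P q -> 0 < C -> 0 < e ->
  exists2 del : R, 0 < del & forall h : W -> R, sqint P h ->
    \int[P]_w (h w ^+ 2) <= C ^+ 2 -> \int[P]_w `|h w| <= del ->
    `|\int[P]_w (h w * q w)| <= e.
Proof.
move=> sq C0 e0; have [mq q2] := sq.
pose t := e / (2 * C); have t0 : 0 < t by rewrite divr_gt0// mulr_gt0.
have t20 : 0 < t ^+ 2 by rewrite exprn_gt0.
have [d0 [d00 hd0]] := integral_normr_continuous q2 t20.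
pose Q := 1 + \int[P]_w (q w ^+ 2).
have Q1 : 1 <= Q.
  by rewrite /Q lerDl; apply: Rintegral_ge0 => w _; exact: sqr_ge0.
have Q0 : 0 < Q by rewrite (lt_le_trans ltr01).
pose t1 := e / (2 * Q); have t10 : 0 < t1 by rewrite divr_gt0// mulr_gt0.
exists (Num.min (d0 / 2) (t1 ^+ 2)); first by rewrite lt_min divr_gt0 ?exprn_gt0.
move=> h sh hC; rewrite le_min => /andP[hd1 hd2].
have [mh h2] := sh.
pose B := [set w | 1 < `|h w|].
have mB : measurable B by exact: measurable_norm_gt.
have iB := sqint_int1 (essbd_sqint (essbd_indic P mB)).
have PB : (P B < d0%:E)%E.
  rewrite -(setIT B) -integral_indic// -EFin_Rintegral// lte_fin.
  apply: (@le_lt_trans _ _ (d0 / 2)); last by lra.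
  apply: le_trans hd1; apply: le_Rintegral => //.
    exact: int1_norm (sqint_int1 sh).
  move=> w _; rewrite indicE; case: (boolP (w \in B)) => [|_]; last exact: normr_ge0.
  by rewrite inE /B /= => /ltW.
have sqB : sqint P (fun w => q w * \1_B w) by exact: sqintMr sq (essbd_indic P mB).
have qBt : \int[P]_w ((q w * \1_B w) ^+ 2) <= t ^+ 2.
  rewrite ltW//; apply: le_lt_trans (hd0 _ mB PB).
  rewrite [leRHS]Rintegral_mkcond le_eqVlt; apply/orP; left; apply/eqP.
  apply: eq_Rintegral => w _.
  rewrite /patch indicE; case: ifPn => _ /=; last by rewrite mulr0 expr2 mul0r.
  by rewrite mulr1 ger0_norm ?sqr_ge0.
pose hC' w := h w * \1_(~` B) w.
have bC := essbd_indic P (measurableC mB).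
have shC : sqint P hC' by exact: sqintMr sh bC.
have hC2 : \int[P]_w (hC' w ^+ 2) <= t1 ^+ 2.
  apply: le_trans hd2; apply: le_Rintegral => //; first by case: shC.
    exact: int1_norm (sqint_int1 sh).
  move=> w _; rewrite /hC' indicE; case: (boolP (w \in _)).
    rewrite inE /B /= mulr1 => /negP; rewrite -leNgt => h1.
    by rewrite -real_normK ?num_real// expr2 ler_piMl.
  by rewrite mulr0 expr2 mul0r.
have -> : \int[P]_w (h w * q w) =
    \int[P]_w (h w * (q w * \1_B w)) + \int[P]_w (hC' w * q w).
  rewrite -RintegralD//; [|exact: sqint_int1M sh sqB|exact: sqint_int1M shC sq].
  apply: eq_Rintegral => w _; rewrite /hC' !indicE in_setC.
  by case: (w \in B); rewrite /=; ring.
rewrite (le_trans (ler_normD _ _))//.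
have -> : e = C * t + t1 * Q by rewrite /t1 /t; field; rewrite !gt_eqF.
have qQ : \int[P]_w (q w ^+ 2) <= Q ^+ 2.
  apply: (@le_trans _ _ Q); first by rewrite /Q lerDr.
  by rewrite expr2 ler_peMl// ltW.
by apply: lerD; apply: Rintegral_CS_norm.
Qed.

End fixed_law.

Section centered_derivative.
Context d d' (W : measurableType d) (V : measurableType d') (R : realType).
Variables (Pth : R -> probability W R) (s : W -> R).
Hypothesis dPth : differentiable_path Pth s.
Variables (H : W -> V) (mH : measurable_fun setT H).
Variables (X : W -> R) (K : R).
Hypotheses (K0 : 0 < K) (mX : measurable_fun setT X)
  (XK : \forall th \near (0 : R), {ae Pth th, forall w, `|X w| <= K})
  (X0 : forall phi, measurable_fun setT phi -> sqint (Pth 0) (phi \o H) ->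
    \int[Pth 0]_w (phi (H w) * X w) = 0).

Let combine (x1 x2 x3 x4 y z th e : R) : `|x1| <= e / 8 * `|th| -> `|x2| <= e / 8 ->
  `|x3| <= e / 8 * `|th| -> `|x4| <= e / 8 -> `|y - th * z| <= e / 2 * `|th| ->
  `|x1 + x3 + y - th * (x2 + x4 + z)| <= e * `|th|.
Proof.
move=> h1 h2 h3 h4 hy.
have -> : x1 + x3 + y - th * (x2 + x4 + z) =
  (x1 + x3) + (y - th * z) - th * (x2 + x4) by ring.
have h24 : `|th * (x2 + x4)| <= `|th| * (e / 4).
  by rewrite normrM ler_wpM2l//; have := ler_normD x2 x4; lra.
have := ler_normB ((x1 + x3) + (y - th * z)) (th * (x2 + x4)).
have := ler_normD (x1 + x3) (y - th * z); have := ler_normD x1 x3.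
lra.
Qed.

(** For a fixed bounded [phi], [path_linear] expands E_th[phi(H) X]. Replacing g_th by [phi] costs
    o(th) in the expectation, by [centered_small], and little in the derivative, by
    [Rintegral_mul_small]. *)
Lemma has_deriv0_centered (g : R -> V -> R) : good Pth H g ->
  has_deriv0 (fun th => \int[Pth th]_w (g th (H w) * X w))
    (\int[Pth 0]_w (g 0 (H w) * X w * s w)).
Proof.
move=> [[C0 gC0] gl] e e0.
have [ss hlin _ _] := dPth.
pose C := 1 + `|C0|; have C1 : 1 <= C by rewrite /C lerDl.
have Cp : 0 < C by rewrite (lt_le_trans ltr01).
have gC : \forall th \near (0 : R), L2_le H (Pth th) (g th) C.
  apply: filterS gC0 => th [? ? h]; split => //; rewrite (le_trans h)// /C.
  by rewrite (le_trans (ler_norm _))// lerDr.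
have [mg0 sg0 gC00] := nbhs_singleton gC.
have XK0 := nbhs_singleton XK.
have bX0 : essbd (Pth 0) X by split => //; exists K.
have sXs : sqint (Pth 0) (fun w => X w * s w) by exact: sqintM bX0 ss.
have e8 : 0 < e / 8 by rewrite divr_gt0.
have C20 : 0 < 2 * C by rewrite mulr_gt0.
have [d1 d10 hd1] := centered_small dPth mH K0 mX XK X0 C20 e8.
have [d2 d20 hd2] := Rintegral_mul_small sXs C20 e8.
(* The admissible distance in the mean depends on an L2 bound of the difference, while the bound [L]
   of the approximant is known only once that distance is fixed. Truncation breaks the circle: C
   fixes d1 and d2, these fix M, which fixes d3 and d4, and [phi0] is then clipped at M so that [L]
   does not matter. By [clip_tail], truncating [g] at M costs at most C / M, the minimum of d1 and
   d2, in the mean. *)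
pose M := C / Num.min d1 d2.
have dm : 0 < Num.min d1 d2 by rewrite lt_min d10 d20.
have M0 : 0 < M by rewrite divr_gt0.
have M20 : 0 < 2 * M by rewrite mulr_gt0.
have [d3 d30 hd3] := centered_small dPth mH K0 mX XK X0 M20 e8.
have [d4 d40 hd4] := Rintegral_mul_small sXs M20 e8.
have dm' : 0 < Num.min d3 d4 by rewrite lt_min d30 d40.
have [phi0 [mphi0 [L phi0L]] hphi0] := gl _ dm'.
pose phi y := clip M (phi0 y).
have mphi : measurable_fun setT phi by exact: measurable_clip.
have phiM y : `|phi y| <= M by apply: clip_norm; exact: ltW.
pose f w := phi (H w) * X w.
have mphiH : measurable_fun setT (phi \o H) by exact: measurableT_comp.
(* Two-step approximation: truncate [g] at level [M], then replace the
   truncation by the fixed bounded function [phi]. *)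
have parts th : L2_le H (Pth th) (g th) C ->
    \int[Pth th]_w `|g th (H w) - phi0 (H w)| <= Num.min d3 d4 ->
    let h1 y := g th y - clip M (g th y) in let h2 y := clip M (g th y) - phi y in
    [/\ [/\ measurable_fun setT h1, sqint (Pth th) (h1 \o H),
            \int[Pth th]_w (h1 (H w) ^+ 2) <= (2 * C) ^+ 2 &
            \int[Pth th]_w `|h1 (H w)| <= Num.min d1 d2],
        [/\ measurable_fun setT h2, sqint (Pth th) (h2 \o H),
            \int[Pth th]_w (h2 (H w) ^+ 2) <= (2 * M) ^+ 2 &
            \int[Pth th]_w `|h2 (H w)| <= Num.min d3 d4] &
        sqint (Pth th) (phi \o H)].
  move=> [mg sg gCth] gphi h1 h2; have [_ ig2] := sg.
  have mcg : measurable_fun setT (fun y => clip M (g th y)) by exact: measurable_clip.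
  have scg : sqint (Pth th) ((fun y => clip M (g th y)) \o H).
    apply: (sqint_bounded mH) => //; exists M => y.
    by apply: clip_norm; exact: ltW.
  have sphi : sqint (Pth th) (phi \o H).
    by apply: (sqint_bounded mH) => //; exists M.
  have sphi0 : sqint (Pth th) (phi0 \o H).
    by apply: (sqint_bounded mH) => //; exists L.
  have mh1 : measurable_fun setT h1 by exact: measurable_funB.
  have mh2 : measurable_fun setT h2 by exact: measurable_funB.
  have sh1 : sqint (Pth th) (h1 \o H) by exact: sqintB.
  have sh2 : sqint (Pth th) (h2 \o H) by exact: sqintB.
  split => //; split => //.
  - apply: (@le_trans _ _ (\int[Pth th]_w (4 * g th (H w) ^+ 2))).
      apply: le_Rintegral => //; [by case: sh1|exact: int1Z|] => w _.
      have [_ b] := clip_tail (g th (H w)) M0.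
      rewrite -real_normK ?num_real// -[g th (H w) ^+ 2]real_normK ?num_real//.
      rewrite (_ : 4 * _ = (2 * `|g th (H w)|) ^+ 2); last by ring.
      by rewrite lerXn2r ?nnegrE// mulr_ge0.
    rewrite RintegralZl//; apply: (@le_trans _ _ (4 * C)); first by rewrite ler_pM2l.
    rewrite (_ : (2 * C) ^+ 2 = 4 * C * C); last by ring.
    by rewrite ler_peMr// mulr_ge0// ltW.
  - apply: (@le_trans _ _ (\int[Pth th]_w (M^-1 * g th (H w) ^+ 2))).
      apply: le_Rintegral => //; [|exact: int1Z|].
        exact: int1_norm (sqint_int1 sh1).
      by move=> w _; have [] := clip_tail (g th (H w)) M0.
    by rewrite RintegralZl// ler_pdivrMl// /M divfK ?gt_eqF.
  - have h2M w : `|(h2 \o H) w| <= 2 * M.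
      rewrite (le_trans (ler_normB _ _))// mulrDl mul1r lerD//.
      by apply: clip_norm; exact: ltW.
    have mh2H : measurable_fun setT (h2 \o H) by exact: measurableT_comp.
    by have [] := sqint_bdd_le (Pth th) mh2H h2M.
  - apply: le_trans gphi; apply: le_Rintegral => //.
    + exact: int1_norm (sqint_int1 sh2).
    + exact: int1_norm (sqint_int1 (sqintB sg sphi0)).
    + by move=> w _; apply: clip_lipschitz; exact: ltW.
have hphi00 := nbhs_singleton hphi0.
have [[mh1 sh1 h1C h1d] [mh2 sh2 h2C h2d] sphi] :=
  parts 0 (And3 mg0 sg0 gC00) hphi00.
have lin : \forall th \near (0 : R),
    `|\int[Pth th]_w f w - \int[Pth 0]_w f w - th * \int[Pth 0]_w (f w * s w)|
      <= e / 2 * `|th|.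
  apply: (hlin f ((M * K) ^+ 2)); last by rewrite divr_gt0.
  apply: filterS XK => th XKth; rewrite /f.
  have mf : measurable_fun setT (fun w => phi (H w) * X w) by exact: measurable_funM.
  have := @sqint_comp _ _ _ _ _ id (@measurable_id _ W setT) (Pth th) _ (M * K) mf.
  apply; apply: filterS XKth => w XKw.
  by rewrite normrM ler_pM.
near=> th.
have gCth : L2_le H (Pth th) (g th) C by near: th.
have gphi : \int[Pth th]_w `|g th (H w) - phi0 (H w)| <= Num.min d3 d4 by near: th.
have [[mk1 sk1 k1C k1d] [mk2 sk2 k2C k2d] sphith] := parts th gCth gphi.
have XKth : {ae Pth th, forall w, `|X w| <= K} by near: th.
have sXth : sqint (Pth th) X by apply: essbd_sqint; split => //; exists K.
have sX0 : sqint (Pth 0) X by exact: essbd_sqint.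
have hd1th : small_at Pth H X (2 * C) (e / 8) d1 th by near: th.
have hd3th : small_at Pth H X (2 * M) (e / 8) d3 th by near: th.
have b1 : `|\int[Pth th]_w ((g th (H w) - clip M (g th (H w))) * X w)| <= e / 8 * `|th|.
  by apply: (hd1th _ mk1) => //; rewrite (le_trans k1d)// ge_min lexx.
have b3 : `|\int[Pth th]_w ((clip M (g th (H w)) - phi (H w)) * X w)| <= e / 8 * `|th|.
  by apply: (hd3th _ mk2) => //; rewrite (le_trans k2d)// ge_min lexx.
have b2 : `|\int[Pth 0]_w ((g 0 (H w) - clip M (g 0 (H w))) * (X w * s w))| <= e / 8.
  by apply: hd2 => //; rewrite (le_trans h1d)// ge_min lexx orbT.
have b4 : `|\int[Pth 0]_w ((clip M (g 0 (H w)) - phi (H w)) * (X w * s w))| <= e / 8.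
  by apply: hd4 => //; rewrite (le_trans h2d)// ge_min lexx orbT.
have blin : `|\int[Pth th]_w f w - \int[Pth 0]_w f w - th * \int[Pth 0]_w (f w * s w)|
  <= e / 2 * `|th| by near: th.
rewrite (X0 mg0 sg0) subr0; move: blin; rewrite [\int[Pth 0]_w f w]X0// subr0 => blin.
have -> : \int[Pth th]_w (g th (H w) * X w) =
    \int[Pth th]_w ((g th (H w) - clip M (g th (H w))) * X w) +
    \int[Pth th]_w ((clip M (g th (H w)) - phi (H w)) * X w) + \int[Pth th]_w f w.
  have j1 := sqint_int1M sk1 sXth; have j2 := sqint_int1M sk2 sXth.
  rewrite -RintegralD// -RintegralD//; [|exact: int1D j1 j2|exact: sqint_int1M sphith sXth].
  by apply: eq_Rintegral => w _; rewrite /f; ring.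
have -> : \int[Pth 0]_w (g 0 (H w) * X w * s w) =
    \int[Pth 0]_w ((g 0 (H w) - clip M (g 0 (H w))) * (X w * s w)) +
    \int[Pth 0]_w ((clip M (g 0 (H w)) - phi (H w)) * (X w * s w)) +
    \int[Pth 0]_w (f w * s w).
  have j1 := sqint_int1M sh1 sXs; have j2 := sqint_int1M sh2 sXs.
  have j3 : int1 (Pth 0) (fun w => f w * s w).
    have := sqint_int1M sphi sXs; congr (int1 _ _).
    by apply/funext => w; rewrite /f /= mulrA.
  rewrite -RintegralD// -RintegralD//; last exact: int1D j1 j2.
  by apply: eq_Rintegral => w _; rewrite /f; ring.
move: b1 b3 b2 b4 blin.
set x1 := \int[Pth th]_w _; set x3 := \int[Pth th]_w _.
set x2 := \int[Pth 0]_w _; set x4 := \int[Pth 0]_w _.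
set y := \int[Pth th]_w _; set z := \int[Pth 0]_w _ => b1 b3 b2 b4 blin.
exact: combine b1 b2 b3 b4 blin.
Unshelve. all: by end_near. Qed.

End centered_derivative.

(** * One stage of the recursion *)

Section range_fix.
Context (R : realType).

(* Versions of the conditional covariance are bounded, and bounded away from
   zero, only almost everywhere; this makes the bounds hold everywhere. *)
Definition range_fix (e K x : R) : R := if e <= `|x| <= K then x else e.

Lemma range_fix_id e K x : e <= `|x| -> `|x| <= K -> range_fix e K x = x.
Proof. by rewrite /range_fix => -> ->. Qed.

Lemma range_fix_ge e K x : 0 < e -> e <= `|range_fix e K x|.
Proof.
by move=> e0; rewrite /range_fix; case: ifP => [/andP[]//|_]; exact: ler_norm.
Qed.

Lemma range_fix_le e K x : 0 < e -> e <= K -> `|range_fix e K x| <= K.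
Proof.
move=> e0 eK; rewrite /range_fix; case: ifP => [/andP[]//|_].
by rewrite ger0_norm// ltW.
Qed.

Lemma range_fix_neq0 e K x : 0 < e -> range_fix e K x != 0.
Proof. by move=> e0; rewrite -normr_gt0 (lt_le_trans e0)// range_fix_ge. Qed.

Lemma measurable_range_fix d (T : measurableType d) (f : T -> R) e K :
  measurable_fun setT f -> measurable_fun setT (fun w => range_fix e K (f w)).
Proof.
move=> mf; pose B := [set w | e <= `|f w| <= K].
have mB : measurable B.
  rewrite -[X in measurable X]setTI (_ : B = (fun w => `|f w|) @^-1` `[e, K]%classic).
    have : measurable_fun setT (fun w => `|f w|) by exact: measurableT_comp.
    by apply => //; exact: measurable_itv.
  by apply/seteqP; split => w /=; rewrite in_itv.
rewrite (_ : (fun w => _) = (fun w => e + \1_B w * (f w - e))).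
  apply: measurable_funD => //; apply: measurable_funM; first exact: measurable_indic.
  exact: measurable_funB.
apply/funext => w; rewrite /range_fix indicE.
case: ifPn => h; first by rewrite mem_set//=; ring.
by rewrite memNset/=; [ring|exact/negP].
Qed.

End range_fix.

Section null_expectation.
Context d (W : measurableType d) (R : realType) (P : probability W R).
Implicit Types f g : W -> R.

(** Corrections that may be added to an integrand for free; with them, the equality of expectations
    in [step_identity] becomes a pointwise identity. *)
Definition null_exp f := int1 P f /\ \int[P]_w f w = 0.

Lemma null_expD f g : null_exp f -> null_exp g -> null_exp (fun w => f w + g w).
Proof.
by move=> [fi f0] [gi g0]; split; [exact: int1D|rewrite RintegralD// f0 g0 addr0].
Qed.

Lemma null_expB f g : null_exp f -> null_exp g -> null_exp (fun w => f w - g w).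
Proof.
by move=> [fi f0] [gi g0]; split; [exact: int1B|rewrite RintegralB// f0 g0 subrr].
Qed.

Lemma null_exp_proj d' (V : measurableType d') (H : W -> V) (X : W -> R)
    (g f : V -> R) : sqint P X -> cond_proj P H X g -> measurable_fun setT f ->
  sqint P (f \o H) -> null_exp (fun w => f (H w) * X w - f (H w) * g (H w)).
Proof.
move=> sX [mg sg pg] mf sf.
have i1 := sqint_int1M sf sX; have i2 := sqint_int1M sf sg.
by split; [exact: int1B i1 i2|rewrite RintegralB// pg// subrr].
Qed.

End null_expectation.

Section one_step.
Context d d' (W : measurableType d) (V : measurableType d') (R : realType).
Variables (Pth : R -> probability W R) (s : W -> R).
Hypothesis dPth : differentiable_path Pth s.
Variables (H : W -> V) (mH : measurable_fun setT H).
Variables (Z A : W -> R) (G : R -> W -> R) (M eps : R).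
Hypotheses (M0 : 0 < M) (eps0 : 0 < eps).
Hypotheses (mZ : measurable_fun setT Z) (mA : measurable_fun setT A)
  (A1 : forall w, `|A w| <= 1)
  (ZM : \forall th \near (0 : R), {ae Pth th, forall w, `|Z w| <= M})
  (kge : \forall th \near (0 : R),
     {ae Pth th, forall w, eps <= `|condCov (Pth th) H A Z (H w)|})
  (gG : good Pth id G).

Let rho th := condE (Pth th) H Z.
Let delta th := condE (Pth th) H A.
Let kappa th := condCov (Pth th) H A Z.
Let eta th := condE (Pth th) H (fun w => A w * G th w).
Let gam th h := condCov (Pth th) H (fun w => A w * G th w) Z h / kappa th h.

Let mid : measurable_fun setT (@id W). Proof. exact: measurable_id. Qed.

Let bZ : bgood Pth id (fun=> Z). Proof. exact: bgood_cst_ae ZM. Qed.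
Let bA : bgood Pth id (fun=> A). Proof. exact: bgood_cst A1. Qed.
Let gAG : good Pth id (fun th w => A w * G th w). Proof. exact: goodM bA gG. Qed.

Lemma bgood_rho : bgood Pth H rho. Proof. exact: (bgood_condE dPth mH bZ). Qed.
Lemma bgood_delta : bgood Pth H delta. Proof. exact: (bgood_condE dPth mH bA). Qed.
Lemma good_eta : good Pth H eta. Proof. exact: (good_condE dPth mH gAG). Qed.

Let bZr : bgood Pth id (fun th w => Z w - rho th (H w)).
Proof. by apply: bgoodB => //; apply: bgood_pull => //; exact: bgood_rho. Qed.

Let bAd : bgood Pth id (fun th w => A w - delta th (H w)).
Proof. by apply: bgoodB => //; apply: bgood_pull => //; exact: bgood_delta. Qed.

Let gAGe : good Pth id (fun th w => A w * G th w - eta th (H w)).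
Proof. by apply: goodB => //; apply: good_pull => //; exact: good_eta. Qed.

Let bcov : bgood Pth id (fun th w => (A w - delta th (H w)) * (Z w - rho th (H w))).
Proof. exact: bgoodM bAd bZr. Qed.

Let gcov : good Pth id
  (fun th w => (A w * G th w - eta th (H w)) * (Z w - rho th (H w))).
Proof.
have := goodM mid bZr gAGe; congr (good _ _ _).
by apply/funext => th; apply/funext => w; rewrite mulrC.
Qed.

Lemma bgood_kappa : bgood Pth H kappa. Proof. exact: (bgood_condE dPth mH bcov). Qed.

Lemma bgood_kappaV : bgood Pth H (fun th h => (kappa th h)^-1).
Proof. exact: bgood_inv eps0 bgood_kappa kge. Qed.

Lemma good_gam : good Pth H gam.
Proof.
have := goodM mH bgood_kappaV (good_condE dPth mH gcov); congr (good _ _ _).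
by apply/funext => th; apply/funext => w; rewrite mulrC.
Qed.

Let nice th := [/\ [/\ essbd (Pth th) Z, essbd (Pth th) A & sqint (Pth th) (G th)],
  [/\ cond_proj (Pth th) H Z (rho th), cond_proj (Pth th) H A (delta th) &
      cond_proj (Pth th) H (fun w => A w * G th w) (eta th)],
  [/\ essbd (Pth th) (rho th \o H), essbd (Pth th) (delta th \o H),
      essbd (Pth th) (kappa th \o H) & essbd (Pth th) (fun w => (kappa th (H w))^-1)],
  [/\ cond_proj (Pth th) H
        (fun w => (A w - delta th (H w)) * (Z w - rho th (H w))) (kappa th),
      cond_proj (Pth th) H
        (fun w => (A w * G th w - eta th (H w)) * (Z w - rho th (H w)))
        (condCov (Pth th) H (fun w => A w * G th w) Z) &
      sqint (Pth th) (gam th \o H)] &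
  [/\ {ae Pth th, forall w, `|Z w| <= M},
      {ae Pth th, forall w, eps <= `|kappa th (H w)|} &
      measurable_fun setT (gam th)]].

Let near_nice : \forall th \near (0 : R), nice th.
Proof.
have [[C1 hG] _] := gG.
have [[C2 hr] _] := bgood_rho; have [[C3 hd] _] := bgood_delta.
have [[C4 hk] _] := bgood_kappa; have [[C5 hkV] _] := bgood_kappaV.
have [[C6 hg] _] := good_gam; have [[C7 he] _] := good_eta.
near=> th.
have [mG sG _] : L2_le id (Pth th) (G th) C1 by near: th.
have [mr rb] : bd_le H (Pth th) (rho th) C2 by near: th.
have [md db] : bd_le H (Pth th) (delta th) C3 by near: th.
have [mk kb] : bd_le H (Pth th) (kappa th) C4 by near: th.
have [mkV kVb] : measurable_fun setT (fun y => (kappa th y)^-1) /\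
  {ae Pth th, forall w, `|(kappa th (H w))^-1| <= C5} by near: th.
have [mg sg _] : L2_le H (Pth th) (gam th) C6 by near: th.
have [me se _] : L2_le H (Pth th) (eta th) C7 by near: th.
have ZMth : {ae Pth th, forall w, `|Z w| <= M} by near: th.
have kth : {ae Pth th, forall w, eps <= `|kappa th (H w)|} by near: th.
have eZ : essbd (Pth th) Z by split => //; exists M.
have eA : essbd (Pth th) A by exact: essbd_le.
have er := essbd_comp mH mr rb; have ed := essbd_comp mH md db.
have ek := essbd_comp mH mk kb.
have ekV : essbd (Pth th) (fun w => (kappa th (H w))^-1).
  exact: (essbd_comp mH mkV kVb).
have sAG : sqint (Pth th) (fun w => A w * G th w) by exact: (sqintM _ sG).
have eZr : essbd (Pth th) (fun w => Z w - rho th (H w)) := essbdB eZ er.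
have eAd : essbd (Pth th) (fun w => A w - delta th (H w)) := essbdB eA ed.
have sAGe : sqint (Pth th) (fun w => A w * G th w - eta th (H w)) := sqintB sAG se.
split.
- by split.
- split; [exact: (condE_proj mH (essbd_sqint eZ))|exact: (condE_proj mH (essbd_sqint eA))|].
  exact: (condE_proj mH sAG).
- by split.
- split; last exact: sg.
    exact: (condE_proj mH (essbd_sqint (essbdM eAd eZr))).
  exact: (condE_proj mH (sqintMr sAGe eZr)).
- by split.
Unshelve. all: by end_near. Qed.

(** kappa gamma is the conditional covariance of A G and Z, that is, the conditional mean of (A G -
    eta) (Z - rho); the eta part disappears because Z - rho is centered given H. *)
Let Ecovk th f : nice th -> measurable_fun setT f -> essbd (Pth th) (f \o H) ->
  \int[Pth th]_w (f (H w) * (kappa th (H w) * gam th (H w))) =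
  \int[Pth th]_w (f (H w) * ((Z w - rho th (H w)) * (A w * G th w))).
Proof.
move=> [[bZt bAt sG] [pr pd pe] [br bd bk bkV] [pk pc sg] [_ kth mg]] mf bf.
have sf := essbd_sqint bf.
have [mc sc {}pc] := pc; have [me se {}pe] := pe; have [mk _ _] := pk.
have [mr _ {}pr] := pr.
have mfH := measurableT_comp mf mH; have mkH := measurableT_comp mk mH.
have mgH := measurableT_comp mg mH; have mcH := measurableT_comp mc mH.
have sAG : sqint (Pth th) (fun w => A w * G th w) by exact: (sqintM _ sG).
have bZrt : essbd (Pth th) (fun w => Z w - rho th (H w)) := essbdB bZt br.
transitivity (\int[Pth th]_w (f (H w) *
    condCov (Pth th) H (fun w => A w * G th w) Z (H w))).
  apply: ae_Rintegral.
  - exact: (measurable_funM mfH (measurable_funM mkH mgH)).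
  - exact: (measurable_funM mfH mcH).
  - apply: filterS kth => w kw; congr (_ * _).
    rewrite /gam mulrC divfK// -normr_gt0; exact: lt_le_trans kw.
rewrite pc//.
have sfe : sqint (Pth th) (fun w => f (H w) * eta th (H w)) by exact: sqintM bf se.
have mfe : measurable_fun setT (fun y => f y * eta th y) by exact: measurable_funM.
have i1 := sqint_int1M sf (sqintM bZrt sAG).
have i2 := sqint_int1M sfe (essbd_sqint bZt).
have i3 := sqint_int1M sfe (essbd_sqint br).
have e0 := pr _ mfe sfe.
transitivity (\int[Pth th]_w (f (H w) * ((Z w - rho th (H w)) * (A w * G th w)) -
   (f (H w) * eta th (H w) * Z w - f (H w) * eta th (H w) * rho th (H w)))).
  by apply: eq_Rintegral => w _; ring.
rewrite RintegralB//; last exact: int1B i2 i3.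
by rewrite [X in _ - X]RintegralB// e0 subrr subr0.
Qed.

(** Tested against bounded functions of H, this says gamma = E_th[w G | H] with w the weight of the
    same law: [Ecovk] with f / kappa as test function. *)
Lemma near_expectation_gamma : \forall th \near (0 : R), forall f : V -> R,
  measurable_fun setT f -> essbd (Pth th) (f \o H) ->
  \int[Pth th]_w (f (H w) * gam th (H w)) =
  \int[Pth th]_w (f (H w) * ((Z w - rho th (H w)) * A w / kappa th (H w) * G th w)).
Proof.
apply: filterS near_nice => th nth f mf bf.
have [[bZt bAt sG] [pr pd pe] [br bd bk bkV] [pk pc sg] [_ kth mg]] := nth.
have [mk _ _] := pk; have [mr _ _] := pr; have [mG _] := sG.
have mkV : measurable_fun setT (fun y => (kappa th y)^-1) by exact: measurable_funV.
have mf' : measurable_fun setT (fun y => f y / kappa th y) := measurable_funM mf mkV.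
have mfH := measurableT_comp mf mH; have mf'H := measurableT_comp mf' mH.
have mkH := measurableT_comp mk mH; have mgH := measurableT_comp mg mH.
have := Ecovk nth mf' (essbdM bf bkV).
rewrite (@ae_Rintegral _ _ _ (Pth th) _ (fun w => f (H w) * gam th (H w))).
- by move=> ->; apply: eq_Rintegral => w _; ring.
- exact: (measurable_funM mf'H (measurable_funM mkH mgH)).
- exact: (measurable_funM mfH mgH).
- apply: filterS kth => w kw.
  have k0 : kappa th (H w) != 0 by rewrite -normr_gt0; exact: lt_le_trans kw.
  by rewrite mulrA divfK.
Qed.

(** |A - delta| <= 2 and |Z - rho| <= 2 M bound kappa by 4 M; adding eps guarantees eps <= K, so
    that the default value of [range_fix] obeys the bound too. *)
Let K := M * 4 + eps.
Definition rho_fix y := clip M (rho 0 y).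
Definition delta_fix y := clip 1 (delta 0 y).
Definition kappa_fix y := range_fix eps K (kappa 0 y).

Let nice0 : nice 0. Proof. exact: nbhs_singleton near_nice. Qed.

Lemma rho_fix_le y : `|rho_fix y| <= M. Proof. by apply: clip_norm; exact: ltW. Qed.
Lemma delta_fix_le y : `|delta_fix y| <= 1. Proof. exact: clip_norm. Qed.

Let kappa_fix_le y : `|kappa_fix y| <= K.
Proof. by apply: range_fix_le => //; rewrite lerDr mulr_ge0// ltW. Qed.

Let kappa_fix_neq0 y : kappa_fix y != 0. Proof. exact: range_fix_neq0. Qed.

Lemma kappa_fixV_le y : `|(kappa_fix y)^-1| <= eps^-1.
Proof.
rewrite normfV lef_pV2 ?posrE ?normr_gt0 ?kappa_fix_neq0//; exact: range_fix_ge.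
Qed.

Lemma measurable_rho_fix : measurable_fun setT rho_fix.
Proof. by have [_ [[mr _ _] _ _] _ _ _] := nice0; exact: measurable_clip. Qed.

Let measurable_delta_fix : measurable_fun setT delta_fix.
Proof. by have [_ [_ [md _ _] _] _ _ _] := nice0; exact: measurable_clip. Qed.

Let measurable_kappa_fix : measurable_fun setT kappa_fix.
Proof. by have [_ _ _ [[mk _ _] _ _] _] := nice0; exact: measurable_range_fix. Qed.

Lemma measurable_kappa_fixV : measurable_fun setT (fun y => (kappa_fix y)^-1).
Proof. exact: measurable_funV. Qed.

Lemma fix_ae : {ae Pth 0, forall w, [/\ rho_fix (H w) = rho 0 (H w),
  delta_fix (H w) = delta 0 (H w) & kappa_fix (H w) = kappa 0 (H w)]}.
Proof.
have [[bZ0 bA0 _] [pr pd _] [br bd _ _] [pk _ _] [Z0 k0 _]] := nice0.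
have sZ := essbd_sqint bZ0; have sA := essbd_sqint bA0.
have rM := cond_proj_norm_le mH sZ pr Z0.
have d1 := cond_proj_norm_le mH sA pd (aeW _ A1).
have sc : sqint (Pth 0) (fun w => (A w - delta 0 (H w)) * (Z w - rho 0 (H w))).
  by apply: essbd_sqint; apply: essbdM; exact: essbdB.
have kK : {ae Pth 0, forall w, `|kappa 0 (H w)| <= K}.
  apply: cond_proj_norm_le sc pk _ => //.
  apply: filterS2 Z0 (filterI rM d1) => w Zw [rw dw]; rewrite normrM /K.
  apply: (@le_trans _ _ (2 * (2 * M))); last by move: eps0 => /ltW; lra.
  have hA := A1 w.
  apply: ler_pM => //; apply: (le_trans (ler_normB _ _)); lra.
apply: filterS2 (filterI rM d1) (filterI kK k0) => w [rw dw] [kw k0w].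
by rewrite /rho_fix /delta_fix /kappa_fix !clip_id// range_fix_id.
Qed.

Let X1 w := Z w - rho_fix (H w).
Let X2 w := X1 w * (A w - delta_fix (H w)) - kappa_fix (H w).

Let mX1 : measurable_fun setT X1.
Proof. exact: (measurable_funB mZ (measurableT_comp measurable_rho_fix mH)). Qed.

Let mX2 : measurable_fun setT X2.
Proof.
have mAd := measurable_funB mA (measurableT_comp measurable_delta_fix mH).
exact: (measurable_funB (measurable_funM mX1 mAd)
  (measurableT_comp measurable_kappa_fix mH)).
Qed.

Let K0 : 0 < K. Proof. by rewrite /K ltr_wpDl// mulr_ge0// ltW. Qed.

Let X1M th : {ae Pth th, forall w, `|Z w| <= M} ->
  {ae Pth th, forall w, `|X1 w| <= 2 * M}.
Proof.
apply: filterS => w Zw; rewrite (le_trans (ler_normB _ _))//.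
by have := rho_fix_le (H w); lra.
Qed.

Let X2M th : {ae Pth th, forall w, `|Z w| <= M} ->
  {ae Pth th, forall w, `|X2 w| <= 2 * M * 2 + K}.
Proof.
move=> /X1M; apply: filterS => w X1w; rewrite (le_trans (ler_normB _ _))// lerD//.
rewrite normrM ler_pM// (le_trans (ler_normB _ _))//.
by have := delta_fix_le (H w); have := A1 w; lra.
Qed.

Let X1_centered phi : measurable_fun setT phi -> sqint (Pth 0) (phi \o H) ->
  \int[Pth 0]_w (phi (H w) * X1 w) = 0.
Proof.
move=> mphi sphi; have [[bZ0 _ _] [pr _ _] _ _ _] := nice0.
have [_ z] := null_exp_proj (essbd_sqint bZ0) pr mphi sphi.
rewrite -[RHS]z.
have [mr _ _] := pr; have mpH := measurableT_comp mphi mH.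
apply: ae_Rintegral.
- exact: (measurable_funM mpH mX1).
- exact: (measurable_funB (measurable_funM mpH mZ)
    (measurable_funM mpH (measurableT_comp mr mH))).
- by apply: filterS fix_ae => w; rewrite /X1 => -[-> _ _]; rewrite mulrBr.
Qed.

Let X2_centered phi : measurable_fun setT phi -> sqint (Pth 0) (phi \o H) ->
  \int[Pth 0]_w (phi (H w) * X2 w) = 0.
Proof.
move=> mphi sphi; have [[bZ0 bA0 _] [pr pd _] [br bd _ _] [pk _ _] _] := nice0.
have e1 : essbd (Pth 0) (fun w => A w - delta 0 (H w)) := essbdB bA0 bd.
have e2 : essbd (Pth 0) (fun w => Z w - rho 0 (H w)) := essbdB bZ0 br.
have [_ z] := null_exp_proj (essbd_sqint (essbdM e1 e2)) pk mphi sphi.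
rewrite -[RHS]z.
have [mk _ _] := pk; have mpH := measurableT_comp mphi mH.
have [me1 _] := e1; have [me2 _] := e2.
apply: ae_Rintegral.
- exact: (measurable_funM mpH mX2).
- exact: (measurable_funB (measurable_funM mpH (measurable_funM me1 me2))
    (measurable_funM mpH (measurableT_comp mk mH))).
- by apply: filterS fix_ae => w; rewrite /X2 /X1 => -[-> -> ->]; ring.
Qed.

Variables (c : V -> R) (Kc : R).
Hypotheses (mc : measurable_fun setT c) (cK : forall y, `|c y| <= Kc).

Let f y := c y / kappa_fix y.

Let mf : measurable_fun setT f.
Proof. exact: (measurable_funM mc measurable_kappa_fixV). Qed.

Let fK y : `|f y| <= Kc * eps^-1.
Proof. by rewrite normrM ler_pM// kappa_fixV_le. Qed.

Let bf : bgood Pth H (fun=> f). Proof. exact: bgood_cst mf fK. Qed.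

Let fam1 th y := f y * gam th y.
Let fam2 th y := (delta th y - delta_fix y) * fam1 th y.
Let fam3 th y := f y * eta th y.

Let good1 : good Pth H fam1. Proof. exact: (goodM mH bf good_gam). Qed.

Let good2 : good Pth H fam2.
Proof.
have bd := bgood_cst Pth H measurable_delta_fix delta_fix_le.
exact: (goodM mH (bgoodB mH bgood_delta bd) good1).
Qed.

Let good3 : good Pth H fam3. Proof. exact: (goodM mH bf good_eta). Qed.

(** After expanding [X2], the claim reduces to E_th[f X1 (A G - eta - gam (A - delta))] = 0, with
    the nuisances of [Pth th] in the parentheses. Write X1 = (Z - rho_th) + (rho_th - rho_fix). The
    second part is a function of H and the residual is centered given H ([z3], [z4]); the first part
    gives its conditional covariance with Z, zero by the definition of [gam] ([z1], [z2], [z5]). *)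
Let step_identity th : nice th ->
  \int[Pth th]_w (c (H w) * gam th (H w)) -
  \int[Pth th]_w (c (H w) * (X1 w * A w / kappa_fix (H w) * G th w)) =
  \int[Pth th]_w (fam2 th (H w) * X1 w) - \int[Pth th]_w (fam1 th (H w) * X2 w) -
  \int[Pth th]_w (fam3 th (H w) * X1 w).
Proof.
move=> nth; have [[bZt bAt sG] [pr pd pe] [br bd bk bkV] [pk pc sg] [ZMt kth mg]] := nth.
have [mr _ _] := pr; have [md _ _] := pd; have [me se _] := pe; have [mk _ _] := pk.
have efH := essbd_le (Pth th) (measurableT_comp mf mH) (fun w => fK (H w)).
have ecH := essbd_le (Pth th) (measurableT_comp mc mH) (fun w => cK (H w)).
have erc := essbd_le (Pth th) (measurableT_comp measurable_rho_fix mH)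
  (fun w => rho_fix_le (H w)).
have edc := essbd_le (Pth th) (measurableT_comp measurable_delta_fix mH)
  (fun w => delta_fix_le (H w)).
have ekV := essbd_le (Pth th) (measurableT_comp measurable_kappa_fixV mH)
  (fun w => kappa_fixV_le (H w)).
have eX1 : essbd (Pth th) X1 by split => //; exists (2 * M); exact: X1M.
have eX2 : essbd (Pth th) X2 by split => //; exists (2 * M * 2 + K); exact: X2M.
have err := essbdB br erc.
have sAG := sqintM bAt sG.
have mrr := measurable_funB mr measurable_rho_fix.
have sfg := sqintM efH sg.
have mfg := measurable_funM mf mg.
have z1 : null_exp (Pth th) (fun w => f (H w) * (kappa th (H w) * gam th (H w)) -
    f (H w) * ((Z w - rho th (H w)) * (A w * G th w))).
  have i1 : int1 (Pth th) (fun w => f (H w) * (kappa th (H w) * gam th (H w))).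
    exact: sqint_int1M (essbd_sqint efH) (sqintM bk sg).
  have i2 : int1 (Pth th) (fun w => f (H w) * ((Z w - rho th (H w)) * (A w * G th w))).
    exact: sqint_int1M (essbd_sqint efH) (sqintM (essbdB bZt br) sAG).
  by split; [exact: int1B i1 i2|rewrite RintegralB// Ecovk// subrr].
have z2 := null_exp_proj (essbd_sqint (essbdM (essbdB bAt bd) (essbdB bZt br)))
  pk mfg sfg.
have z3 := null_exp_proj (essbd_sqint bAt) pd (measurable_funM mfg mrr)
  (sqintMr sfg err).
have z4 := null_exp_proj sAG pe (measurable_funM mf mrr)
  (essbd_sqint (essbdM efH err)).
have z5 := null_exp_proj (essbd_sqint bZt) pr (measurable_funM mf me)
  (sqintM efH se).
have [_ z0] := null_expD (null_expB (null_expD (null_expD z1 z2) z3) z4) z5.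
have i1 : int1 (Pth th) (fun w => c (H w) * gam th (H w)).
  exact: sqint_int1 (sqintM ecH sg).
have i2 : int1 (Pth th) (fun w => c (H w) * (X1 w * A w / kappa_fix (H w) * G th w)).
  exact: sqint_int1 (sqintM ecH (sqintM (essbdM (essbdM eX1 bAt) ekV) sG)).
have i3 : int1 (Pth th) (fun w => fam1 th (H w) * X2 w).
  exact: sqint_int1 (sqintMr sfg eX2).
have i4 : int1 (Pth th) (fun w => fam2 th (H w) * X1 w).
  exact: sqint_int1 (sqintMr (sqintM (essbdB bd edc) sfg) eX1).
have i5 : int1 (Pth th) (fun w => fam3 th (H w) * X1 w).
  exact: sqint_int1 (sqintMr (sqintM efH se) eX1).
apply/eqP; rewrite -subr_eq0; apply/eqP.
have i12 := int1B i1 i2; have i43 := int1B i4 i3; have i435 := int1B i43 i5.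
rewrite -(RintegralB _ i1 i2)// -(RintegralB _ i4 i3)// -(RintegralB _ i43 i5)//.
rewrite -(RintegralB _ i12 i435)//.
rewrite -[RHS]z0; apply: eq_Rintegral => w _.
rewrite /fam2 /fam3 /fam1 /X2 /X1 /f /=.
by field; rewrite kappa_fix_neq0.
Qed.

Let has_deriv0_step : has_deriv0
  (fun th => \int[Pth th]_w (c (H w) * gam th (H w)) -
     \int[Pth th]_w (c (H w) * (X1 w * A w / kappa_fix (H w) * G th w)))
  (- (\int[Pth 0]_w (fam1 0 (H w) * X2 w * s w)) -
     \int[Pth 0]_w (fam3 0 (H w) * X1 w * s w)).
Proof.
apply: (@has_deriv0_near _ _ (fun th => \int[Pth th]_w (fam2 th (H w) * X1 w) -
  \int[Pth th]_w (fam1 th (H w) * X2 w) - \int[Pth th]_w (fam3 th (H w) * X1 w))).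
  by apply: filterS near_nice => th; exact: step_identity.
have M20 : 0 < 2 * M by rewrite mulr_gt0.
have X1Mn : \forall th \near (0 : R), {ae Pth th, forall w, `|X1 w| <= 2 * M}.
  by apply: filterS ZM => th; exact: X1M.
have X2Mn : \forall th \near (0 : R), {ae Pth th, forall w, `|X2 w| <= 2 * M * 2 + K}.
  by apply: filterS ZM => th; exact: X2M.
have KK : 0 < 2 * M * 2 + K by rewrite addr_gt0// mulr_gt0.
have d1 := has_deriv0_centered dPth mH KK mX2 X2Mn X2_centered good1.
have d2 := has_deriv0_centered dPth mH M20 mX1 X1Mn X1_centered good2.
have d3 := has_deriv0_centered dPth mH M20 mX1 X1Mn X1_centered good3.
(* At [th = 0] the coefficient [fam2] contains delta - delta_fix, which is zero almost surely: this
   term leaves no trace in the derivative. *)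
have e0 : \int[Pth 0]_w (fam2 0 (H w) * X1 w * s w) = 0.
  have [ss _ _ _] := dPth; have [ms _] := ss.
  have [_ [_ [md _ _] _] _ _ [_ _ mg]] := nice0.
  rewrite -[RHS](Rintegral_prob_cst (Pth 0) 0); apply: ae_Rintegral.
  - have m1 := measurable_funB (measurableT_comp md mH)
      (measurableT_comp measurable_delta_fix mH).
    have m2 := measurable_funM (measurableT_comp mf mH) (measurableT_comp mg mH).
    exact: (measurable_funM (measurable_funM (measurable_funM m1 m2) mX1) ms).
  - exact: measurable_cst.
  - by apply: filterS fix_ae => w; rewrite /fam2 => -[_ -> _]; rewrite subrr !mul0r.
have := has_deriv0B (has_deriv0B d2 d1) d3.
by rewrite e0 sub0r.
Qed.

(** [D] comes with its pointwise formula so that a caller may write c(H) in another form, here as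
    the product of the earlier frozen weights. *)
Lemma step_deriv (D : W -> R) :
  (forall w, D w = - (c (H w) / kappa_fix (H w) * gam 0 (H w) *
      ((Z w - rho_fix (H w)) * (A w - delta_fix (H w)) - kappa_fix (H w))) -
    c (H w) / kappa_fix (H w) * eta 0 (H w) * (Z w - rho_fix (H w))) ->
  [/\ sqint (Pth 0) D, \int[Pth 0]_w D w = 0 &
    has_deriv0 (fun th => \int[Pth th]_w (c (H w) * gam th (H w)) -
       \int[Pth th]_w (c (H w) *
         ((Z w - rho_fix (H w)) * A w / kappa_fix (H w) * G th w)))
      (\int[Pth 0]_w (D w * s w))].
Proof.
move=> DE; have [ss _ _ _] := dPth.
have ZM0 := nbhs_singleton ZM.
have eX1 : essbd (Pth 0) X1 by split => //; exists (2 * M); exact: X1M.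
have eX2 : essbd (Pth 0) X2 by split => //; exists (2 * M * 2 + K); exact: X2M.
have [[C1 hC1] _] := good1; have [m1 s1 _] := nbhs_singleton hC1.
have [[C3 hC3] _] := good3; have [m3 s3 _] := nbhs_singleton hC3.
have s1X := sqintMr s1 eX2; have s3X := sqintMr s3 eX1.
have {}DE : D = fun w => - 1 * (fam1 0 (H w) * X2 w) - fam3 0 (H w) * X1 w.
  by apply/funext => w; rewrite DE mulN1r.
rewrite DE; split.
- exact: sqintB (sqintZ (-1) s1X) s3X.
- rewrite RintegralB//; [|exact: sqint_int1 (sqintZ (-1) s1X)|exact: sqint_int1 s3X].
  rewrite RintegralZl//; last exact: sqint_int1 s1X.
  by rewrite X2_centered// X1_centered// mulr0 subrr.
- have i1 : int1 (Pth 0) (fun w => fam1 0 (H w) * X2 w * s w) := sqint_int1M s1X ss.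
  have i3 : int1 (Pth 0) (fun w => fam3 0 (H w) * X1 w * s w) := sqint_int1M s3X ss.
  have := has_deriv0_step; congr has_deriv0.
  rewrite -[X in X - _]mulN1r -(RintegralZl _ _ i1)// -(RintegralB _ (int1Z (-1) i1) i3)//.
  by apply: eq_Rintegral => w _; ring.
Qed.

End one_step.

(** * Measurability of the observed data *)

(** One induction for all closure properties of finite sums and products of functions: adaptedness,
    boundedness and integrability. *)
Lemma fun_big_ind (T I S : Type) (idx : S) (op : S -> S -> S) (K : (T -> S) -> Prop)
    (r : seq I) (p : pred I) (F : I -> T -> S) : K (fun=> idx) ->
  (forall f g, K f -> K g -> K (fun x => op (f x) (g x))) ->
  (forall i, p i -> K (F i)) -> K (fun x => \big[op/idx]_(i <- r | p i) F i x).
Proof.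
move=> K0 Kop KF; elim: r => [|i r IH]; first by under eq_fun do rewrite big_nil.
have [pi|/negPf npi] := boolP (p i); under eq_fun do rewrite big_cons ?pi ?npi //.
- by apply: Kop IH; exact: KF.
- exact: IH.
Qed.

Section product_measurability.
Context (I : Type) (dI : I -> measure_display) (X : forall i, measurableType (dI i)).

Lemma measurable_coord (i : I) :
  measurable_fun setT (fun f : prod_space X => f i : X i).
Proof.
move=> _ B mB; rewrite setTI; apply: sub_sigma_algebra.
by exists i, B.
Qed.

Lemma measurable_prod_space d (T : measurableType d) (F : T -> prod_space X) :
  (forall i, measurable_fun setT (fun w => F w i : X i)) -> measurable_fun setT F.
Proof.
move=> mF; apply: (@measurability _ _ _ _ setT F (@cylinder I dI X)) => //.
move=> _ [_ [i [B mB ->]] <-].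
exact: mF.
Qed.

Lemma measurable_coord_comp d (T : measurableType d) (F : T -> prod_space X) i :
  measurable_fun setT F -> measurable_fun setT (fun w => F w i : X i).
Proof. by move=> mF; exact: (measurableT_comp (@measurable_coord i) mF). Qed.

End product_measurability.

Section observed_data_measurability.
Context {R : realType} {T : nat} {dA dL : 'I_T.+1 -> measure_display}.
Variables (calA : forall t, measurableType (dA t))
          (calL : forall t, measurableType (dL t)).
Local Notation obs := (@obs R T dA dL calA calL).
Local Notation hist := (@hist R T dA dL calA calL).

Lemma measurable_obsZ t : measurable_fun setT (@obsZ R T dA dL calA calL t).
Proof.
have m1 : measurable_fun setT (fun o : obs => o.1.1.1).
  by do 2 apply: (measurableT_comp measurable_fst); exact: measurable_fst.
exact: measurable_coord_comp m1.
Qed.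

Lemma measurable_obsA t : measurable_fun setT (@obsA R T dA dL calA calL t).
Proof.
have m1 : measurable_fun setT (fun o : obs => o.1.1.2).
  apply: (measurableT_comp measurable_snd).
  by apply: (measurableT_comp measurable_fst); exact: measurable_fst.
exact: measurable_coord_comp m1.
Qed.

Lemma measurable_obsL t : measurable_fun setT (@obsL R T dA dL calA calL t).
Proof.
have m1 : measurable_fun setT (fun o : obs => o.1.2).
  by apply: (measurableT_comp measurable_snd); exact: measurable_fst.
exact: measurable_coord_comp m1.
Qed.

Lemma measurable_obsY : measurable_fun setT (@obsY R T dA dL calA calL).
Proof. exact: measurable_snd. Qed.

Lemma measurable_obsH t : measurable_fun setT (@obsH R T dA dL calA calL t).
Proof.
apply: measurable_fun_pair; first apply: measurable_fun_pair.
- by apply: measurable_prod_space => s; exact: measurable_obsZ.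
- by apply: measurable_prod_space => s; exact: measurable_obsA.
- by apply: measurable_prod_space => s; exact: measurable_obsL.
Qed.

Lemma measurable_cast dX (X : forall t : 'I_T.+1, measurableType (dX t)) i j (e : i = j) :
  measurable_fun setT (fun x : X i => ecast z (X z) e x).
Proof. by case: _ / e; exact: measurable_id. Qed.

Let measurable_histZ t : measurable_fun setT (fun h : hist t => h.1.1).
Proof. exact: (measurableT_comp measurable_fst measurable_fst). Qed.

Let measurable_histA t : measurable_fun setT (fun h : hist t => h.1.2).
Proof. exact: (measurableT_comp measurable_snd measurable_fst). Qed.

(* The index of an earlier time among the predecessors of [t] determines the
   time only up to a proof of equality of ordinals, hence the casts. *)
Lemma obsH_factor (r t : 'I_T.+1) : (r <= t)%N ->
  exists2 F : hist t -> hist r, measurable_fun setT F &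
    forall o, @obsH R T dA dL calA calL r o = F (obsH t o).
Proof.
move=> rt; have rt1 : (r.+1 <= t.+1)%N by [].
have eA (u : 'I_r) : before (widen_ord rt u) = before u by exact: val_inj.
have eL (u : 'I_r.+1) : upto (widen_ord rt1 u) = upto u by exact: val_inj.
exists (fun h : hist t => ((fun u : 'I_r => h.1.1 (widen_ord rt u)),
  (fun u : 'I_r => ecast z (calA z) (eA u) (h.1.2 (widen_ord rt u))),
  (fun u : 'I_r.+1 => ecast z (calL z) (eL u) (h.2 (widen_ord rt1 u)))) : hist r).
  apply: measurable_fun_pair; first apply: measurable_fun_pair.
  - apply: measurable_prod_space => u.
    exact: measurable_coord_comp (@measurable_histZ t).
  - apply: measurable_prod_space => u.
    apply: (measurableT_comp (@measurable_cast _ calA _ _ (eA u))).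
    exact: measurable_coord_comp (@measurable_histA t).
  - apply: measurable_prod_space => u.
    apply: (measurableT_comp (@measurable_cast _ calL _ _ (eL u))).
    exact: measurable_coord_comp measurable_snd.
move=> o; rewrite /obsH /=; congr (_, _, _).
- by apply/funext => u; congr (obsZ _ o); apply: val_inj.
- apply: functional_extensionality_dep => u /=.
  by case: _ / (eA u).
- apply: functional_extensionality_dep => u /=.
  by case: _ / (eL u).
Qed.

(** Measurability for the sigma-algebra generated by [obsH t], in factored form because the
    projection property tests with functions on [hist t]. *)
Definition adapted (t : 'I_T.+1) (f : obs -> R) :=
  exists2 g : hist t -> R, measurable_fun setT g & f = g \o obsH t.

Lemma adapted_cst t k : adapted t (fun=> k).
Proof. by exists (fun=> k) => //; exact: measurable_cst. Qed.

Lemma adaptedM t f g : adapted t f -> adapted t g -> adapted t (fun o => f o * g o).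
Proof.
move=> [f' mf ->] [g' mg ->]; exists (fun h => f' h * g' h) => //.
exact: measurable_funM.
Qed.

Lemma adapted_comp (r t : 'I_T.+1) (g : hist r -> R) : (r <= t)%N ->
  measurable_fun setT g -> adapted t (fun o => g (obsH r o)).
Proof.
move=> rt mg; have [F mF HF] := obsH_factor rt.
exists (g \o F); first exact: measurableT_comp.
by apply/funext => o; rewrite /= HF.
Qed.

Lemma adapted_prod t (p : pred 'I_T.+1) (f : 'I_T.+1 -> obs -> R) :
  (forall r, p r -> adapted t (f r)) -> adapted t (fun o => \prod_(r | p r) f r o).
Proof. exact: (fun_big_ind _ (adapted_cst t 1) (@adaptedM t)). Qed.

Lemma adaptedB t f g : adapted t f -> adapted t g -> adapted t (fun o => f o - g o).
Proof.
move=> [f' mf ->] [g' mg ->]; exists (fun h => f' h - g' h) => //.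
exact: measurable_funB.
Qed.

Lemma adapted_obsZ (r t : 'I_T.+1) : (r < t)%N ->
  adapted t (@obsZ R T dA dL calA calL r).
Proof.
move=> rt; have -> : r = before (Ordinal rt) by exact: val_inj.
exists (fun h : hist t => h.1.1 (Ordinal rt)) => //.
exact: measurable_coord_comp (@measurable_histZ t).
Qed.

Variables (a : forall t, calA t)
  (calA_discrete : forall t, discrete_space (calA t)).

Let measurable_set_a t : measurable [set a t].
Proof. by have [_] := calA_discrete t; exact. Qed.

Lemma measurable_obsAind t : measurable_fun setT (@obsAind R T dA dL calA calL a t).
Proof.
have m1 : measurable_fun setT (\1_[set a t] : calA t -> R) by exact: measurable_indic.
exact: (measurableT_comp m1 (@measurable_obsA t)).
Qed.

Lemma obsAind_le1 t (o : obs) : `|obsAind a t o| <= 1 :> R.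
Proof.
by rewrite /obsAind indicE ger0_norm ?ler0n// lern1; case: (_ \in _).
Qed.

Lemma adapted_obsAind (r t : 'I_T.+1) : (r < t)%N ->
  adapted t (@obsAind R T dA dL calA calL a r).
Proof.
move=> rt; have -> : r = before (Ordinal rt) by exact: val_inj.
exists (fun h : hist t => \1_[set a (before (Ordinal rt))] (h.1.2 (Ordinal rt))) => //.
have m2 := measurableT_comp (@measurable_coord _ _ _ (Ordinal rt)) (@measurable_histA t).
have m3 : measurable_fun setT
    (\1_[set a (before (Ordinal rt))] : calA (before (Ordinal rt)) -> R).
  exact: measurable_indic.
exact: (measurableT_comp m3 m2).
Qed.

(** [gamma_rv] counts backward from the outcome, so time [t] is stage (T - t).+1; the [inord] in its
    definition then returns [t]. *)
Lemma gamma_rvS (Q : probability obs R) (t : 'I_T.+1) :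
  gamma_rv a Q (T - t).+1 = fun o => gamma_step a Q (gamma_rv a Q (T - t)) (obsH t o).
Proof.
have e : inord (T - (T - t)) = t by rewrite subKn ?inord_val// -ltnS.
by rewrite /= e.
Qed.

End observed_data_measurability.

(** * The pathwise derivative of psi *)

Section finite_sums_and_products.
Context d (T : measurableType d) (R : realType).
Implicit Types (P : probability T R).

Lemma essbd_prod P (I : finType) (p : pred I) (f : I -> T -> R) :
  (forall r, p r -> essbd P (f r)) -> essbd P (fun o => \prod_(r | p r) f r o).
Proof. exact: (fun_big_ind _ (essbd_cst P 1) (@essbdM _ _ _ P)). Qed.

Lemma sqint_ae (mu : {measure set T -> \bar R}) (f g : T -> R) :
  measurable_fun setT f -> sqint mu g -> {ae mu, forall w, f w = g w} -> sqint mu f.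
Proof.
move=> mf [mg ig] fg; split => //; apply: int1_le_ae ig _; first exact: measurable_funX.
by apply: filterS fg => w ->; rewrite ger0_norm ?sqr_ge0.
Qed.

Lemma sqint_sum P (I : finType) (f : I -> T -> R) :
  (forall i, sqint P (f i)) -> sqint P (fun w => \sum_i f i w).
Proof.
move=> sf; apply: (fun_big_ind _ _ (@sqintD _ _ _ P)) => //.
exact: essbd_sqint (essbd_cst P 0).
Qed.

Lemma int1_sum P (I : finType) (f : I -> T -> R) :
  (forall i, int1 P (f i)) -> int1 P (fun w => \sum_i f i w).
Proof. by move=> fi; apply: (fun_big_ind _ (int1_cst P 0) (@int1D _ _ _ P)). Qed.

Lemma Rintegral_sum P (I : finType) (f : I -> T -> R) : (forall i, int1 P (f i)) ->
  \int[P]_w (\sum_i f i w) = \sum_i \int[P]_w f i w.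
Proof.
move=> fi; apply: EFin_inj; rewrite EFin_Rintegral; last exact: int1_sum.
under eq_integral do rewrite -sumEFin.
rewrite integral_sum// -sumEFin.
by apply: eq_bigr => i _; rewrite EFin_Rintegral.
Qed.

End finite_sums_and_products.

Lemma near0_forall (R : realType) (I : finType) (f : I -> R -> Prop) :
  (forall i, \forall x \near (0 : R), f i x) ->
  \forall x \near (0 : R), forall i, f i x.
Proof. exact: (@filter_forall _ I f (nbhs (0 : R)) (nbhs_filter (0 : R))). Qed.

Lemma ae_forall d (T : measurableType d) (R : realType)
    (mu : {measure set T -> \bar R}) (I : finType) (f : I -> T -> Prop) :
  (forall i, {ae mu, forall x, f i x}) -> {ae mu, forall x, forall i, f i x}.
Proof.
have FF : Filter (almost_everywhere mu) by exact: _.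
exact: (@filter_forall _ I f _ FF).
Qed.

Section path_derivative.
Context {R : realType} {T : nat} {dA dL : 'I_T.+1 -> measure_display}.
Variables (calA : forall t, measurableType (dA t))
          (calL : forall t, measurableType (dL t)).
Local Notation obs := (@obs R T dA dL calA calL).
Local Notation hist := (@hist R T dA dL calA calL).
Variables (a : forall t, calA t)
  (calA_discrete : forall t, discrete_space (calA t)).
Variables (Pth : R -> probability obs R) (s : obs -> R).
Hypothesis dPth : differentiable_path Pth s.
Variables (M eps C : R).
Hypotheses (M0 : 0 < M) (eps0 : 0 < eps).
Hypotheses
  (hw : \forall th \near (0 : R), forall t, weighting_bounds a (Pth th) M eps t)
  (hY : \forall th \near (0 : R), (\int[Pth th]_o ((obsY o) ^+ 2)%:E <= C%:E)%E).

Let Z (t : 'I_T.+1) : obs -> R := obsZ t.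
Let A (t : 'I_T.+1) : obs -> R := obsAind a t.
Let H (t : 'I_T.+1) : obs -> hist t := obsH t.
Let G (m : nat) (th : R) : obs -> R := gamma_rv a (Pth th) m.

Let mZ t : measurable_fun setT (Z t). Proof. exact: measurable_obsZ. Qed.
Let mA t : measurable_fun setT (A t). Proof. exact: measurable_obsAind. Qed.
Let mH t : measurable_fun setT (H t). Proof. exact: measurable_obsH. Qed.
Let A1 t o : `|A t o| <= 1. Proof. exact: obsAind_le1. Qed.

Let ZM t : \forall th \near (0 : R), {ae Pth th, forall o, `|Z t o| <= M}.
Proof. by apply: filterS hw => th /(_ t)[]. Qed.

Let kge t : \forall th \near (0 : R),
  {ae Pth th, forall o, eps <= `|condCov (Pth th) (H t) (A t) (Z t) (H t o)|}.
Proof. by apply: filterS hw => th /(_ t)[]. Qed.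

Let sqY : \forall th \near (0 : R), sqint (Pth th) (@obsY R T dA dL calA calL) /\
  \int[Pth th]_o (obsY o ^+ 2) <= C.
Proof.
apply: filterS hY => th hYth.
have mY2 : measurable_fun setT (fun o : obs => obsY o ^+ 2).
  exact: (measurable_funX 2%N (@measurable_obsY R T dA dL calA calL)).
have [i b] := int1_lty mY2 (fun o => sqr_ge0 _) hYth.
by split => //; split => //; exact: measurable_obsY.
Qed.

(** Induction along the backward recursion, from the second moment of the outcome; [good_gam] is the
    step. *)
Let good_G m : (m <= T.+1)%N -> good Pth id (G m).
Proof.
elim: m => [_|m IH mT].
  exact: (good_cst (@measurable_id _ obs setT) (@measurable_obsY R T dA dL calA calL) sqY).
pose t : 'I_T.+1 := inord (T - m).
have gG := IH (ltnW mT).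
exact: (good_pull (@mH t)
  (good_gam dPth (@mH t) eps0 (@mZ t) (@mA t) (A1 t) (ZM t) (kge t) gG)).
Qed.

Let gG (t : 'I_T.+1) : good Pth id (G (T - t)).
Proof. by apply: good_G; rewrite leqW// leq_subr. Qed.

Let w (th : R) (t : 'I_T.+1) : obs -> R := cov_weight a (nuisance_true a (Pth th)) t.

Let prefix (v : 'I_T.+1 -> obs -> R) (k : nat) (o : obs) : R :=
  \prod_(r < T.+1 | (r < k)%N) v r o.

Let prefix0 v o : prefix v 0 o = 1.
Proof. by rewrite /prefix big_pred0. Qed.

Let prefixS v (t : 'I_T.+1) o : prefix v t.+1 o = prefix v t o * v t o.
Proof.
rewrite /prefix (bigD1 t)//= mulrC; congr (_ * _); apply: eq_bigl => r.
by rewrite ltnS ltn_neqAle andbC.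
Qed.

Let prefixT v o : prefix v T.+1 o = \prod_(r < T.+1) v r o.
Proof. by apply: eq_bigl => r; rewrite ltn_ord. Qed.

Let near_w : \forall th \near (0 : R), forall t,
  essbd (Pth th) (w th t) /\ (forall k : 'I_T.+1, (t < k)%N -> adapted k (w th t)).
Proof.
apply: near0_forall => t.
have [[C1 hr] _] := bgood_rho dPth (@mH t) (@mZ t) (ZM t).
have [[C2 hk] _] :=
  bgood_kappaV dPth (@mH t) eps0 (@mZ t) (@mA t) (A1 t) (ZM t) (kge t).
apply: filterS3 hr hk (ZM t) => th [mr rb] [mk kb] Zb; split.
  have eZ : essbd (Pth th) (Z t) by split => //; exists M.
  have eA : essbd (Pth th) (A t) := essbd_le (Pth th) (@mA t) (A1 t).
  exact: (essbdM (essbdM (essbdB eZ (essbd_comp (@mH t) mr rb)) eA)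
    (essbd_comp (@mH t) mk kb)).
move=> k tk; have tk' := ltnW tk.
exact: (adaptedM (adaptedM
  (adaptedB (adapted_obsZ calA calL tk) (adapted_comp tk' mr))
  (adapted_obsAind calL a calA_discrete tk)) (adapted_comp tk' mk)).
Qed.

Lemma psi_gamma0 : \forall th \near (0 : R),
  psi a (Pth th) = \int[Pth th]_o G T.+1 th o.
Proof.
have hE : \forall th \near (0 : R), forall t : 'I_T.+1, forall f : hist t -> R,
    measurable_fun setT f -> essbd (Pth th) (f \o H t) ->
    \int[Pth th]_o (f (H t o) * gamma_step a (Pth th) (G (T - t) th) (H t o)) =
    \int[Pth th]_o (f (H t o) * (w th t o * G (T - t) th o)).
  apply: near0_forall => t.
  exact: (near_expectation_gamma dPth (@mH t) eps0 (@mZ t) (@mA t) (A1 t) (ZM t) (kge t) (gG t)).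
apply: filterS2 hE near_w => th hE hwth.
(* [G (T.+1 - k)] is gamma_k, so [k = 0] is gamma_0 alone and [k = T.+1] is the full product of
   weights times the outcome. *)
have step k : (k <= T.+1)%N -> \int[Pth th]_o (prefix (w th) k o * G (T.+1 - k) th o) =
    \int[Pth th]_o G T.+1 th o.
  elim: k => [_|k IH kT].
    by apply: eq_Rintegral => o _; rewrite prefix0 mul1r subn0.
  rewrite -{}IH; last exact: ltnW.
  pose t : 'I_T.+1 := Ordinal kT.
  have [f mf fE] : adapted t (prefix (w th) t).
    by apply: adapted_prod => r rt; exact: (hwth r).2.
  have bf : essbd (Pth th) (f \o H t).
    by rewrite -fE; apply: essbd_prod => r _; exact: (hwth r).1.
  have fE' o : prefix (w th) k o = f (H t o) by rewrite -[LHS]/(prefix _ t o) fE.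
  rewrite subSS subSn; last by rewrite -ltnS.
  rewrite [G (T - k).+1]/G.
  under [RHS]eq_Rintegral do rewrite fE' (@gamma_rvS R T dA dL calA calL a (Pth th) t).
  rewrite hE//; apply: eq_Rintegral => o _.
  by rewrite (prefixS _ t) fE' mulrA.
have := step T.+1 (leqnn _); rewrite subnn => <-.
by apply: eq_Rintegral => o _; rewrite prefixT.
Qed.

Let rf t := rho_fix Pth (H t) (Z t) M.
Let df t := delta_fix Pth (H t) (A t).
Let kf t := kappa_fix Pth (H t) (Z t) (A t) M eps.

Let fixed_ae : {ae Pth 0, forall o, forall t, [/\ @rf t (H t o) = condE (Pth 0) (H t) (Z t) (H t o),
  @df t (H t o) = condE (Pth 0) (H t) (A t) (H t o),
  @kf t (H t o) = condCov (Pth 0) (H t) (A t) (Z t) (H t o),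
  `|Z t o| <= M & condCov (Pth 0) (H t) (A t) (Z t) (H t o) != 0]}.
Proof.
apply: ae_forall => t.
apply: filterS3 (fix_ae dPth (@mH t) eps0 (@mZ t) (@mA t) (A1 t) (ZM t) (kge t) (gG t))
  (nbhs_singleton (ZM t)) (nbhs_singleton (kge t)) => o [h1 h2 h3] h4 h5.
by split => //; rewrite -normr_gt0 (lt_le_trans eps0).
Qed.

(** Frozen weight, with the instrument clipped as well: |Z| <= M holds almost surely under every law
    near 0, so no expectation changes, and the products become bounded everywhere, as [step_deriv]
    requires of its [c]. *)
Let wf (t : 'I_T.+1) (o : obs) : R :=
  (clip M (Z t o) - @rf t (H t o)) * A t o / @kf t (H t o).

Let B := 2 * M * 1 * eps^-1.

Let wf_le t o : `|wf t o| <= B.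
Proof.
rewrite normrM ler_pM//; last exact: kappa_fixV_le.
rewrite normrM ler_pM//.
rewrite (le_trans (ler_normB _ _))// mulrDl mul1r lerD//.
  by apply: clip_norm; exact: ltW.
exact: rho_fix_le.
Qed.

Let mrf t : measurable_fun setT (@rf t).
Proof.
exact: (measurable_rho_fix dPth (@mH t) eps0 (@mZ t) (@mA t) (A1 t) (ZM t) (kge t) (gG t)).
Qed.

Let mkf t : measurable_fun setT (fun y => (@kf t y)^-1).
Proof.
exact: (measurable_kappa_fixV dPth (@mH t) eps0 (@mZ t) (@mA t) (A1 t) (ZM t) (kge t) (gG t)).
Qed.

Let adapted_wf (r t : 'I_T.+1) : (r < t)%N -> adapted t (wf r).
Proof.
move=> rt; have rt' := ltnW rt.
have aZ : adapted t (fun o => clip M (Z r o)).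
  have [g mg gE] : adapted t (Z r) by exact: adapted_obsZ.
  exists (fun h => clip M (g h)); first exact: measurable_clip.
  by apply/funext => o; rewrite gE.
exact: (adaptedM (adaptedM (adaptedB aZ (adapted_comp rt' (@mrf r)))
  (adapted_obsAind calL a calA_discrete rt)) (adapted_comp rt' (@mkf r))).
Qed.

Let Kc (k : nat) : R := \prod_(r < T.+1 | (r < k)%N) B.

Let prefix_wf_le k o : `|prefix wf k o| <= Kc k.
Proof.
rewrite normr_prod; apply: ler_prod => r _.
by rewrite normr_ge0 wf_le.
Qed.

Let Kc0 k : 0 <= Kc k.
Proof. by apply: le_trans (prefix_wf_le k point); exact: normr_ge0. Qed.

Let mwf t : measurable_fun setT (wf t).
Proof.
have mcZ := measurable_clip M (@mZ t).
exact: (measurable_funM (measurable_funM (measurable_funB mcZ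
  (measurableT_comp (@mrf t) (@mH t))) (@mA t)) (measurableT_comp (@mkf t) (@mH t))).
Qed.

Let mprefix k : measurable_fun setT (prefix wf k).
Proof.
have [] := @essbd_prod _ _ _ (Pth 0) _ (fun r : 'I_T.+1 => (r < k)%N) wf => //.
by move=> r _; exact: (essbd_le _ (@mwf r) (wf_le r)).
Qed.

(** Adaptedness alone gives a factor that is bounded only on the range of [obsH t]; clipping bounds
    it on all of [hist t] and leaves the composition unchanged. *)
Let c_ex (t : 'I_T.+1) : exists c : hist t -> R, [/\ measurable_fun setT c,
  (forall y, `|c y| <= Kc t) & forall o, c (H t o) = prefix wf t o].
Proof.
have [g mg gE] : adapted t (prefix wf t).
  by apply: adapted_prod => r rt; exact: adapted_wf.
exists (fun y => clip (Kc t) (g y)); split.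
- exact: measurable_clip.
- by move=> y; exact: clip_norm.
- by move=> o; rewrite -[g (H t o)]/((g \o obsH t) o) -gE clip_id.
Qed.

Let gam0 (t : 'I_T.+1) : hist t -> R := gamma_step a (Pth 0) (G (T - t) 0).
Let eta0 (t : 'I_T.+1) : hist t -> R := condE (Pth 0) (H t) (fun o => A t o * G (T - t) 0 o).

(** The [t]-th summand of phi with frozen nuisances, regrouped as in [phi_term] so that the two
    centered variables appear. *)
Let Dt (t : 'I_T.+1) (o : obs) : R :=
  - (prefix wf t o / @kf t (H t o) * @gam0 t (H t o) *
      ((Z t o - @rf t (H t o)) * (A t o - @df t (H t o)) - @kf t (H t o))) -
    prefix wf t o / @kf t (H t o) * @eta0 t (H t o) * (Z t o - @rf t (H t o)).

Let Dt_null t : [/\ sqint (Pth 0) (Dt t), \int[Pth 0]_o Dt t o = 0 &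
  has_deriv0 (fun th => \int[Pth th]_o (prefix wf t o * G (T.+1 - t) th o) -
    \int[Pth th]_o (prefix wf t.+1 o * G (T - t) th o))
    (\int[Pth 0]_o (Dt t o * s o))].
Proof.
have [c [mc cK cE]] := c_ex t.
have DE o : Dt t o = - (c (H t o) / @kf t (H t o) * @gam0 t (H t o) *
      ((Z t o - @rf t (H t o)) * (A t o - @df t (H t o)) - @kf t (H t o))) -
    c (H t o) / @kf t (H t o) * @eta0 t (H t o) * (Z t o - @rf t (H t o)).
  by rewrite /Dt cE.
have [h1 h2 h3] := step_deriv dPth (@mH t) M0 eps0 (@mZ t) (@mA t) (A1 t) (ZM t) (kge t)
  (gG t) mc cK DE.
split; [exact: h1|exact: h2|].
  apply: has_deriv0_near h3.
  have [[C0 hG] _] := gG t.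
  apply: filterS2 (ZM t) hG => th Zth [_ [mGth _] _]; congr (_ - _).
    apply: eq_Rintegral => o _; rewrite cE subSn; last by rewrite -ltnS.
    by rewrite [G (T - t).+1]/G (@gamma_rvS R T dA dL calA calL a (Pth th) t).
  have mGth' : measurable_fun setT (G (T - t) th) by [].
  have mwu : measurable_fun setT (fun o => (Z t o - @rf t (H t o)) * A t o / @kf t (H t o)).
    exact: (measurable_funM (measurable_funM (measurable_funB (@mZ t)
      (measurableT_comp (@mrf t) (@mH t))) (@mA t)) (measurableT_comp (@mkf t) (@mH t))).
  apply: ae_Rintegral.
  - exact: (measurable_funM (@mprefix t.+1) mGth').
  - exact: (measurable_funM (measurableT_comp mc (@mH t)) (measurable_funM mwu mGth')).
  - by apply: filterS Zth => o Zo; rewrite prefixS cE /wf clip_id// -[LHS]mulrA.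
Qed.

Let W0 := prefix wf T.+1.
Let f0 o := W0 o * obsY o.

Let f0_deriv : sqint (Pth 0) f0 /\ has_deriv0
  (fun th => \int[Pth th]_o f0 o) (\int[Pth 0]_o (f0 o * s o)).
Proof.
have [_ hlin _ _] := dPth.
have h : \forall th \near (0 : R), sqint (Pth th) f0 /\
    \int[Pth th]_o (f0 o ^+ 2) <= Kc T.+1 ^+ 2 * C.
  apply: filterS sqY => th [sYth YC].
  have eW := essbd_le (Pth th) (@mprefix T.+1) (prefix_wf_le T.+1).
  have sf := sqintM eW sYth; split => //.
  have [_ i1] := sf; have [_ i2] := sYth.
  apply: (@le_trans _ _ (\int[Pth th]_o (Kc T.+1 ^+ 2 * obsY o ^+ 2))).
    apply: le_Rintegral => //; first exact: int1Z.
    move=> o _; rewrite exprMn ler_wpM2r ?sqr_ge0// -[leLHS]real_normK ?num_real//.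
    by apply: lerXn2r; rewrite ?nnegrE//; exact: prefix_wf_le.
  by rewrite RintegralZl// ler_wpM2l ?sqr_ge0.
have [sf0 _] := nbhs_singleton h; split => //.
by move=> e e0; exact: hlin h _ e0.
Qed.

Lemma psi_deriv : has_deriv0 (fun th => psi a (Pth th))
  (\int[Pth 0]_o (f0 o * s o) + \sum_(t < T.+1) \int[Pth 0]_o (Dt t o * s o)).
Proof.
pose S k th := \int[Pth th]_o (prefix wf k o * G (T.+1 - k) th o).
have hS : has_deriv0 (fun th => \int[Pth th]_o f0 o +
    \sum_(t < T.+1) (S t th - S t.+1 th))
  (\int[Pth 0]_o (f0 o * s o) + \sum_(t < T.+1) \int[Pth 0]_o (Dt t o * s o)).
  apply: has_deriv0D; first exact: f0_deriv.2.
  apply: has_deriv0_sum => t; have [_ _] := Dt_null t.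
  by rewrite /S subSS.
apply: has_deriv0_near hS; apply: filterS psi_gamma0 => th ->.
have -> : \sum_(t < T.+1) (S t th - S t.+1 th) = S 0%N th - S T.+1 th.
  rewrite -(big_mkord xpredT (fun t => S t th - S t.+1 th)).
  rewrite -[LHS]opprK -sumrN.
  under eq_bigr do rewrite opprB.
  by rewrite telescope_sumr// opprB.
have -> : S T.+1 th = \int[Pth th]_o f0 o.
  by apply: eq_Rintegral => o _; rewrite subnn.
rewrite addrC subrK; apply: eq_Rintegral => o _.
by rewrite prefix0 mul1r subn0.
Qed.

Let phi0 o := f0 o - psi a (Pth 0) + \sum_(t < T.+1) Dt t o.

Let phi_term (p z r v d k g e : R) : k != 0 ->
  p * ((1 - (z - r) * (v - d) / k) * g - (z - r) * e / k) =
  - (p / k * g * ((z - r) * (v - d) - k)) - p / k * e * (z - r).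
Proof. by move=> k0; field. Qed.

Let phi_ae : {ae Pth 0, forall o,
  phi a (psi a (Pth 0)) (nuisance_true a (Pth 0)) o = phi0 o}.
Proof.
apply: filterS fixed_ae => o h.
have wE t : cov_weight a (nuisance_true a (Pth 0)) t o = wf t o.
  by have [h1 _ h3 h4 _] := h t; rewrite /cov_weight /wf h1 h3 clip_id.
rewrite /phi /phi0; congr (_ + _).
  congr (_ * _ - _); rewrite /W0 prefixT; exact: eq_bigr.
apply: eq_bigr => t _; rewrite /Dt.
have -> : \prod_(r < T.+1 | (r < t)%N) cov_weight a (nuisance_true a (Pth 0)) r o =
  prefix wf t o by exact: eq_bigr.
have [h1 h2 h3 h4 h5] := h t; rewrite h1 h2 h3 /=.
exact: phi_term.
Qed.

Let phi0_meas : measurable_fun setT phi0 /\ sqint (Pth 0) phi0.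
Proof.
have [sf _] := f0_deriv.
have sD : sqint (Pth 0) (fun o => \sum_(t < T.+1) Dt t o).
  by apply: sqint_sum => t; have [] := Dt_null t.
have s1 : sqint (Pth 0) phi0.
  exact: (sqintD (sqintB sf (essbd_sqint (essbd_cst _ _))) sD).
by split => //; have [] := s1.
Qed.

Let cov_prod_meas (p : pred 'I_T.+1) : measurable_fun setT
  (fun o => \prod_(r < T.+1 | p r) cov_weight a (nuisance_true a (Pth 0)) r o).
Proof.
have [] := @essbd_prod _ _ _ (Pth 0) _ p (w 0) => //.
by move=> r _; have [] := nbhs_singleton near_w r.
Qed.

(** Membership in [Lfun] asks for genuine measurability, which [phi_ae] does not provide since the
    law is not assumed complete. *)
Let phi_meas : measurable_fun setT (phi a (psi a (Pth 0)) (nuisance_true a (Pth 0))).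
Proof.
have mY := @measurable_obsY R T dA dL calA calL.
have mprod := cov_prod_meas.
apply: measurable_funD.
  exact: (measurable_funB (measurable_funM (mprod xpredT) mY) (measurable_cst _)).
apply: measurable_sum => t.
have [[C1 hr] _] := bgood_rho dPth (@mH t) (@mZ t) (ZM t).
have [[C2 hk] _] :=
  bgood_kappaV dPth (@mH t) eps0 (@mZ t) (@mA t) (A1 t) (ZM t) (kge t).
have [[C3 hd] _] := bgood_delta dPth (@mH t) (@mA t) (A1 t).
have [[C4 he] _] := good_eta dPth (@mH t) (@mA t) (A1 t) (gG t).
have [[C5 hg] _] := good_gam dPth (@mH t) eps0 (@mZ t) (@mA t) (A1 t) (ZM t) (kge t) (gG t).
have [mr _] := nbhs_singleton hr; have [mk _] := nbhs_singleton hk.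
have [md _] := nbhs_singleton hd; have [me _ _] := nbhs_singleton he.
have [mg _ _] := nbhs_singleton hg.
have mrH := measurable_funB (@mZ t) (measurableT_comp mr (@mH t)).
have mdH := measurable_funB (@mA t) (measurableT_comp md (@mH t)).
have mkH := measurableT_comp mk (@mH t); have meH := measurableT_comp me (@mH t).
have mgH := measurableT_comp mg (@mH t).
have m1 := measurable_funB (measurable_cst (1 : R)) (measurable_funM (measurable_funM mrH mdH) mkH).
exact: (measurable_funM (mprod (fun r : 'I_T.+1 => (r < t)%N)) (measurable_funB (measurable_funM m1 mgH)
  (measurable_funM (measurable_funM mrH meH) mkH))).
Qed.

(** The constant function 1 has expectation 1 all along the path, so its first-order term th E_0[s]
    is o(th). *)
Lemma path_score_mean0 : \int[Pth 0]_o s o = 0.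
Proof.
have [ss hlin _ _] := dPth.
have h1 : \forall th \near (0 : R), sqint (Pth th) (fun=> 1) /\
    \int[Pth th]_o ((1 : R) ^+ 2) <= 1.
  apply: filterE => th; split; first exact: essbd_sqint (essbd_cst _ _).
  by rewrite Rintegral_prob_cst expr1n.
apply/eqP; rewrite -normr_le0; apply/ler_addgt0Pr => e e0; rewrite add0r.
have [d /= d0 hd] := hlin _ _ h1 e e0.
have dd : 0 < d / 2 by rewrite divr_gt0.
have dlt : `|0 - d / 2| < d by rewrite sub0r normrN gtr0_norm// ltr_pdivrMr// ltr_pMr// ltr1n.
have := hd _ dlt; rewrite !Rintegral_prob_cst subrr sub0r normrN normrM gtr0_norm//.
rewrite [e * _]mulrC ler_pM2l//.
by under eq_Rintegral do rewrite mul1r.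
Qed.

Lemma phi_path_derivative : let phiQ := phi a (psi a (Pth 0)) (nuisance_true a (Pth 0)) in
  [/\ sqint (Pth 0) phiQ, \int[Pth 0]_o phiQ o = 0 &
    has_deriv0 (fun th => psi a (Pth th)) (\int[Pth 0]_o (phiQ o * s o))].
Proof.
have [mphi0 sphi0] := phi0_meas; have [ss _ _ _] := dPth; have [ms _] := ss.
have [sf _] := f0_deriv.
have iD t : int1 (Pth 0) (Dt t) by have [h _ _] := Dt_null t; exact: sqint_int1 h.
have eD := Rintegral_sum iD; have iSD := int1_sum iD.
have psiE : psi a (Pth 0) = \int[Pth 0]_o f0 o.
  apply: ae_Rintegral.
  - exact: (measurable_funM (cov_prod_meas xpredT) (@measurable_obsY R T dA dL calA calL)).
  - by have [] := sf.
  - apply: filterS fixed_ae => o h; congr (_ * _); rewrite /W0 prefixT.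
    apply: eq_bigr => t _; have [h1 _ h3 h4 _] := h t.
    by rewrite /wf h1 h3 clip_id.
have i1 := sqint_int1 sf; have i2 := int1_cst (Pth 0) (psi a (Pth 0)).
split.
- exact: (sqint_ae phi_meas sphi0 phi_ae).
- rewrite (ae_Rintegral phi_meas mphi0 phi_ae).
  rewrite /phi0 (RintegralD _ (int1B i1 i2) iSD)// (RintegralB _ i1 i2)//.
  rewrite Rintegral_prob_cst -psiE subrr add0r eD big1// => t _.
  by have [] := Dt_null t.
- have -> : \int[Pth 0]_o (phi a (psi a (Pth 0)) (nuisance_true a (Pth 0)) o * s o) =
      \int[Pth 0]_o (f0 o * s o) + \sum_(t < T.+1) \int[Pth 0]_o (Dt t o * s o).
    rewrite (@ae_Rintegral _ _ _ _ _ (fun o => phi0 o * s o)); last 3 first.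
    + exact: measurable_funM phi_meas ms.
    + exact: measurable_funM mphi0 ms.
    + by apply: filterS phi_ae => o ->.
    have j1 := sqint_int1M sf ss.
    have j2 := int1Z (psi a (Pth 0)) (sqint_int1 ss).
    have jD t : int1 (Pth 0) (fun o => Dt t o * s o).
      by have [h _ _] := Dt_null t; exact: sqint_int1M h ss.
    have eDs := Rintegral_sum jD; have iDs := int1_sum jD.
    (* The centering constant in phi does not affect the inner product with a score, which has mean
       zero. *)
    have psis : \int[Pth 0]_o (psi a (Pth 0) * s o) = 0.
      by rewrite RintegralZl ?path_score_mean0 ?mulr0//; exact: sqint_int1 ss.
    rewrite -eDs; transitivity (\int[Pth 0]_o (f0 o * s o) -
      \int[Pth 0]_o (psi a (Pth 0) * s o) +
      \int[Pth 0]_o (\sum_(t < T.+1) (Dt t o * s o))); last by rewrite psis subr0.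
    rewrite -(RintegralB _ j1 j2)// -(RintegralD _ (int1B j1 j2) iDs)//.
    by apply: eq_Rintegral => o _; rewrite /phi0 mulrDl mulrBl mulr_suml.
  exact: psi_deriv.
Qed.

End path_derivative.

(** * Bounded tilts of a law *)

Section tilting.
Context d (W : measurableType d) (R : realType).

Lemma probability_of_density (Q : probability W R) (p : W -> R) :
  measurable_fun setT p -> (forall w, 0 <= p w) -> int1 Q p -> \int[Q]_w p w = 1 ->
  exists P : probability W R, forall B, measurable B ->
    P B = (\int[Q]_(w in B) (p w)%:E)%E.
Proof.
move=> mp p0 ip p1.
pose mu := density_meas Q mp p0.
(* The mass of [mu] is 1, so normalization leaves it unchanged; [Q] is merely the fallback value. *)
exists (mnormalize mu Q) => B mB.
have mu1 : mu setT = 1%E by rewrite -[LHS]/(\int[Q]_w (p w)%:E)%E -EFin_Rintegral// p1.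
by rewrite /= /mnormalize mu1 onee_eq0 /= invr1 mule1.
Qed.

Variables (Q P : probability W R) (s : W -> R) (t : R).
Hypotheses (ms : measurable_fun setT s) (s1 : forall w, `|s w| <= 1)
  (t2 : `|t| <= 1 / 2).

Let p w := 1 + t * s w.

Hypothesis PE : forall B, measurable B -> P B = (\int[Q]_(w in B) (p w)%:E)%E.

Let ts_le w : `|t * s w| <= 1 / 2.
Proof. by rewrite normrM -[leRHS]mulr1 ler_pM. Qed.

Let p_ge w : 1 / 2 <= p w.
Proof. by have := ts_le w; rewrite ler_norml /p => /andP[]; lra. Qed.

Let p_le w : p w <= 2.
Proof. by have := ts_le w; rewrite ler_norml /p => /andP[]; lra. Qed.

Let p0 w : 0 <= p w. Proof. by apply: le_trans (p_ge w). Qed.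

Let mp : measurable_fun setT p.
Proof. by apply: measurable_funD => //; exact: measurable_funM. Qed.

Lemma tilt_int1 f : int1 Q f -> int1 P f.
Proof.
move=> fi; have mf := int1_meas fi.
have fpi : int1 Q (fun w => `|f w| * p w).
  apply: int1_le (int1Z 2 (int1_norm fi)) _.
    by apply: measurable_funM => //; exact: measurableT_comp.
  by move=> w; rewrite normrM normr_id (ger0_norm (p0 w)) mulrC ler_wpM2r.
apply/integrableP; split; first exact/measurable_EFinP.
have /integrableP[_] := fpi; apply: le_lt_trans.
have mE : measurable_fun setT (fun w => `|(f w)%:E|%E).
  by apply: measurableT_comp => //; exact/measurable_EFinP.
rewrite (@ge0_integral_pushforward_density _ _ _ _ _ Q P id p (fun w => `|(f w)%:E|%E))//.
rewrite le_eqVlt; apply/orP; left; apply/eqP; apply: eq_integral => w _ /=.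
by rewrite normrM normr_id (ger0_norm (p0 w)) EFinM.
Qed.

Lemma tilt_Rintegral f : int1 Q f ->
  \int[P]_w f w = \int[Q]_w f w + t * \int[Q]_w (f w * s w).
Proof.
move=> fi; have mf := int1_meas fi.
have fsi : int1 Q (fun w => f w * s w).
  apply: int1_le (int1_norm fi) _; first exact: measurable_funM.
  by move=> w; rewrite normrM ler_piMr.
rewrite (Rintegral_density mp p0 PE (tilt_int1 fi)) -RintegralZl// -RintegralD//.
  by apply: eq_Rintegral => w _; rewrite /p; ring.
exact: int1Z.
Qed.

Lemma tilt_ge0_le f : int1 Q f -> (forall w, 0 <= f w) ->
  \int[P]_w f w <= 2 * \int[Q]_w f w /\ \int[Q]_w f w <= 2 * \int[P]_w f w.
Proof.
move=> fi f0; have mf := int1_meas fi.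
rewrite (Rintegral_density mp p0 PE (tilt_int1 fi)).
have fpi : int1 Q (fun w => f w * p w) := int1_density mp p0 PE (tilt_int1 fi).
split; rewrite -RintegralZl//; apply: le_Rintegral => //; try exact: int1Z.
- by move=> w _; rewrite mulrC ler_wpM2r.
- by move=> w _; have := p_ge w; have := f0 w; nra.
Qed.

Lemma tilt_ae (S : set W) : {ae Q, forall w, S w} -> {ae P, forall w, S w}.
Proof.
move=> [N [mN QN NS]]; exists N; split => //.
rewrite PE//; apply: null_set_integral => //.
by apply: measurable_funTS; exact/measurable_EFinP.
Qed.

(** * Stability of conditional moments under a bounded tilt *)

Section conditional.
Context d' (V : measurableType d') (H : W -> V) (mH : measurable_fun setT H).

(** Only the tilt contributes: E_P[f(H) D] = t E_Q[f(H) D s], at most |t| K E_Q|f(H)|. The factor 2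
    returns to [P], whose density is at least 1 / 2. *)
Lemma tilt_centered (D : W -> R) (K : R) : measurable_fun setT D ->
  {ae Q, forall w, `|D w| <= K} ->
  (forall f : V -> R, measurable_fun setT f -> sqint Q (f \o H) ->
     \int[Q]_w (f (H w) * D w) = 0) ->
  forall f : V -> R, measurable_fun setT f -> essbd Q (f \o H) ->
    `|\int[P]_w (f (H w) * D w)| <= 2 * K * `|t| * \int[P]_w `|f (H w)|.
Proof.
move=> mD DK D0 f mf bf.
have sf := essbd_sqint bf.
have bD : essbd Q D by split => //; exists K.
have ss : sqint Q s by apply: essbd_sqint; exact: essbd_le.
have i1 := sqint_int1 (sqintMr sf bD).
rewrite tilt_Rintegral// D0// add0r normrM.
have ifa : int1 Q (fun w => `|f (H w)|) := int1_norm (sqint_int1 sf).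
have h : `|\int[Q]_w (f (H w) * D w * s w)| <= K * \int[Q]_w `|f (H w)|.
  have i2 : int1 Q (fun w => f (H w) * D w * s w).
    exact: sqint_int1M (sqintMr sf bD) ss.
  apply: (le_trans (le_normr_Rintegral _ i2)) => //.
  rewrite -RintegralZl//; apply: ae_le_Rintegral.
  - exact: int1_norm.
  - exact: int1Z.
  - apply: filterS DK => w DK; rewrite !normrM mulrAC.
    apply: (@le_trans _ _ (`|f (H w)| * `|D w|)).
      by rewrite mulrAC ler_piMr ?mulr_ge0.
    by rewrite mulrC ler_wpM2r.
have [_ h2] := tilt_ge0_le ifa (fun w => normr_ge0 _).
(* [K] bounds an absolute value on a set of full measure, which cannot be empty. *)
have K0 : 0 <= K.
  have PN : ~ {ae Q, forall w, False}.
    move=> [N [mN QN NS]]; have : N = setT by apply/seteqP; split => w // _; exact: NS.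
    by move=> e; move: QN; rewrite e probability_setT => /eqP; rewrite eqe oner_eq0.
  rewrite leNgt; apply/negP => K0; apply: PN; apply: filterS DK => w Dw.
  by have := le_lt_trans (le_trans (normr_ge0 _) Dw) K0; rewrite ltxx.
have -> : 2 * K * `|t| * \int[P]_w `|f (H w)| =
  `|t| * (K * (2 * \int[P]_w `|f (H w)|)) by ring.
rewrite ler_wpM2l// (le_trans h)// ler_wpM2l//.
Qed.

(* Testing against indicators of level sets turns a bound on integrals into an
   almost sure bound. *)
Lemma ae_le_of_test (g : V -> R) (b : R) : measurable_fun setT g ->
  sqint P (g \o H) ->
  (forall f : V -> R, measurable_fun setT f -> (forall y, `|f y| <= 1) ->
    `|\int[P]_w (f (H w) * g (H w))| <= b * \int[P]_w `|f (H w)|) ->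
  {ae P, forall w, `|g (H w)| <= b}.
Proof.
move=> mg sg gb.
have half (h : V -> R) : measurable_fun setT h -> sqint P (h \o H) ->
   (forall f : V -> R, measurable_fun setT f -> (forall y, `|f y| <= 1) ->
    `|\int[P]_w (f (H w) * h (H w))| <= b * \int[P]_w `|f (H w)|) ->
   {ae P, forall w, h (H w) <= b}.
  move=> mh sh hb; pose E := [set y | b < h y].
  have mE : measurable E.
    rewrite -[X in measurable X]setTI (_ : E = h @^-1` `]b, +oo[%classic).
      by apply: mh => //; exact: measurable_itv.
    by apply/seteqP; split => w /=; rewrite in_itv/= andbT.
  pose f : V -> R := \1_E.
  have mf : measurable_fun setT f by exact: measurable_indic.
  have f1 y : `|f y| <= 1.
    by rewrite /f indicE ger0_norm ?ler0n// lern1; case: (_ \in _).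
  have bfH : essbd P (f \o H).
    exact: (essbd_le _ (measurableT_comp mf mH) (fun w => f1 (H w))).
  have iff := sqint_int1 (essbd_sqint bfH).
  have ifh : int1 P (fun w => f (H w) * h (H w)) := sqint_int1 (sqintM bfH sh).
  have := hb f mf f1.
  have -> : \int[P]_w `|f (H w)| = \int[P]_w f (H w).
    by apply: eq_Rintegral => w _; rewrite ger0_norm// /f indicE.
  move=> hf; pose v w := f (H w) * h (H w) - b * f (H w).
  have iv : int1 P v := int1B ifh (int1Z b iff).
  have v0 w : 0 <= v w.
    rewrite /v /f indicE; case: (boolP (H w \in E)).
      by rewrite inE /E /= mulr1 mul1r subr_ge0 => /ltW.
    by rewrite mul0r mulr0 subrr.
  have iv0 : \int[P]_w v w <= 0.
    rewrite /v (RintegralB _ ifh (int1Z b iff))// (RintegralZl _ _ iff)//.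
    by rewrite subr_le0 (le_trans (ler_norm _)).
  have vae : {ae P, forall w, v w = 0}.
    have mv := int1_meas iv.
    have : (\int[P]_w `|(v w)%:E| = 0)%E.
      under eq_integral do rewrite /= ger0_norm//.
      rewrite -EFin_Rintegral//; congr EFin; apply/eqP; rewrite eq_le iv0 /=.
      by apply: Rintegral_ge0 => w _.
    have mve : measurable_fun setT (fun w => (v w)%:E) by exact/measurable_EFinP.
    move/(ae_eq_integral_abs P measurableT mve).
    by apply: filterS => w /(_ I)[].
  apply: filterS vae => w; rewrite /v /f indicE leNgt => vw.
  apply/negP => hw; move: vw; rewrite mem_set//= mul1r mulr1 => /eqP.
  by rewrite subr_eq0 => /eqP e; move: hw; rewrite e ltxx.
have mgN : measurable_fun setT (fun y => - g y) by exact: measurableT_comp.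
have sgN : sqint P ((fun y => - g y) \o H) := sqintN sg.
have h1 := half _ mg sg gb.
have h2 : {ae P, forall w, - g (H w) <= b}.
  apply: half mgN sgN _ => f mf f1.
  under [X in `|X|]eq_Rintegral do rewrite mulrN -mulNr.
  have := gb (fun y => - f y) (measurableT_comp _ mf) _.
  under [X in _ -> _ -> _ <= _ * X]eq_Rintegral do rewrite normrN.
  apply; first exact: oppr_measurable.
  by move=> y; rewrite normrN.
apply: filterS2 h1 h2 => w h1 h2.
by rewrite ler_norml lerNl h1 h2.
Qed.

(** The difference is E_P[D | H] for D = X - E_Q[X | H], which is centered under [Q] and bounded by
    2 K; [tilt_centered] then gives 2 (2 K) |t| against every test function. *)
Lemma tilt_condE (X : W -> R) (K : R) : measurable_fun setT X ->
  {ae Q, forall w, `|X w| <= K} ->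
  {ae P, forall w, `|condE P H X (H w) - condE Q H X (H w)| <= 4 * K * `|t|}.
Proof.
move=> mX XK.
have bX : essbd Q X by split => //; exists K.
have sX := essbd_sqint bX.
have XKP := tilt_ae XK.
have bXP : essbd P X by split => //; exists K.
have pQ := condE_proj mH sX; have [mQ sQ pQ'] := pQ.
have pP := condE_proj mH (essbd_sqint bXP); have [mP sP pP'] := pP.
have QK := cond_proj_norm_le mH sX pQ XK.
have bQ : essbd Q (condE Q H X \o H) := essbd_comp mH mQ QK.
have bQP : essbd P (condE Q H X \o H) := essbd_comp mH mQ (tilt_ae QK).
pose D w := X w - condE Q H X (H w).
have mD : measurable_fun setT D := measurable_funB mX (measurableT_comp mQ mH).
have DK : {ae Q, forall w, `|D w| <= 2 * K}.
  apply: filterS2 XK QK => w a b; rewrite (le_trans (ler_normB _ _))//.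
  by rewrite mulrDl mul1r lerD.
have D0 f : measurable_fun setT f -> sqint Q (f \o H) -> \int[Q]_w (f (H w) * D w) = 0.
  move=> mf sf; have [i e] := null_exp_proj sX pQ mf sf.
  by rewrite -[RHS]e; apply: eq_Rintegral => w _; rewrite /D mulrBr.
have := ae_le_of_test (measurable_funB mP mQ) (sqintB sP (essbd_sqint bQP)).
apply => f mf f1.
have bf P' : essbd P' (f \o H).
  exact: (essbd_le _ (measurableT_comp mf mH) (fun w => f1 (H w))).
have sf := essbd_sqint (bf P).
have -> : \int[P]_w (f (H w) * (condE P H X (H w) - condE Q H X (H w))) =
    \int[P]_w (f (H w) * D w).
  have i1 := sqint_int1M sf sP; have i2 := sqint_int1M sf (essbd_sqint bQP).
  have i3 := sqint_int1M sf (essbd_sqint bXP).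
  under eq_Rintegral do rewrite mulrBr.
  rewrite (RintegralB _ i1 i2)// pP'// -(RintegralB _ i3 i2)//.
  by apply: eq_Rintegral => w _; rewrite /D mulrBr.
have := tilt_centered mD DK D0 mf (bf Q).
by rewrite (_ : 2 * (2 * K) = 4 * K)//; ring.
Qed.

(** The difference is E_P[D + F | H]. Here D is the centered product under [Q] minus its conditional
    mean, bounded by 4 M + 4 M, so it contributes 2 (8 M) |t|. F is the effect of recentering at the
    means of [P], at most 4 |t| 2 M + 2 (4 M |t|) by [tilt_condE]. Together 32 M |t|. *)
Lemma tilt_condCov (Z A : W -> R) (M : R) : 0 < M ->
  measurable_fun setT Z -> measurable_fun setT A -> (forall w, `|A w| <= 1) ->
  {ae Q, forall w, `|Z w| <= M} ->
  {ae P, forall w, `|condCov P H A Z (H w) - condCov Q H A Z (H w)| <= 32 * M * `|t|}.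
Proof.
move=> M0 mZ mA A1 ZM.
have ZMP := tilt_ae ZM.
have bZ : essbd Q Z by split => //; exists M.
have bZP : essbd P Z by split => //; exists M.
have bA P' : essbd P' A := essbd_le P' mA A1.
have A1Q : {ae Q, forall w, `|A w| <= 1} by exact: aeW.
have A1P : {ae P, forall w, `|A w| <= 1} by exact: aeW.
pose r0 := condE Q H Z; pose r1 := condE P H Z.
pose d0 := condE Q H A; pose d1 := condE P H A.
have pr0 : cond_proj Q H Z r0 := condE_proj mH (essbd_sqint bZ).
have pr1 : cond_proj P H Z r1 := condE_proj mH (essbd_sqint bZP).
have pd0 : cond_proj Q H A d0 := condE_proj mH (essbd_sqint (bA Q)).
have pd1 : cond_proj P H A d1 := condE_proj mH (essbd_sqint (bA P)).
have [mr0 _ _] := pr0; have [mr1 _ _] := pr1; have [md0 _ _] := pd0; have [md1 _ _] := pd1.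
have r0M := cond_proj_norm_le mH (essbd_sqint bZ) pr0 ZM.
have r1M := cond_proj_norm_le mH (essbd_sqint bZP) pr1 ZMP.
have d01 := cond_proj_norm_le mH (essbd_sqint (bA Q)) pd0 A1Q.
have d11 := cond_proj_norm_le mH (essbd_sqint (bA P)) pd1 A1P.
have dr := tilt_condE mZ ZM; have dd := tilt_condE mA A1Q.
have br0 := essbd_comp mH mr0 r0M; have br0P := essbd_comp mH mr0 (tilt_ae r0M).
have br1 := essbd_comp mH mr1 r1M.
have bd0 := essbd_comp mH md0 d01; have bd0P := essbd_comp mH md0 (tilt_ae d01).
have bd1 := essbd_comp mH md1 d11.
have bX0 := essbdM (essbdB (bA Q) bd0) (essbdB bZ br0).
have bX0P := essbdM (essbdB (bA P) bd0P) (essbdB bZP br0P).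
have bX1 := essbdM (essbdB (bA P) bd1) (essbdB bZP br1).
pose k0 := condCov Q H A Z; pose k1 := condCov P H A Z.
have pk0 : cond_proj Q H (fun w => (A w - d0 (H w)) * (Z w - r0 (H w))) k0 :=
  condE_proj mH (essbd_sqint bX0).
have pk1 : cond_proj P H (fun w => (A w - d1 (H w)) * (Z w - r1 (H w))) k1 :=
  condE_proj mH (essbd_sqint bX1).
have [mk0 sk0 _] := pk0; have [mk1 sk1 pk1'] := pk1.
have X0M : {ae Q, forall w, `|(A w - d0 (H w)) * (Z w - r0 (H w))| <= 2 * (2 * M)}.
  apply: filterS2 (filterI ZM r0M) d01 => w [a b] c.
  have a1 := A1 w.
  by rewrite normrM ler_pM// (le_trans (ler_normB _ _))//; lra.
have k0M := cond_proj_norm_le mH (essbd_sqint bX0) pk0 X0M.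
have bk0 := essbd_comp mH mk0 k0M; have bk0P := essbd_comp mH mk0 (tilt_ae k0M).
pose D w := (A w - d0 (H w)) * (Z w - r0 (H w)) - k0 (H w).
have mD : measurable_fun setT D by have [] := essbdB bX0 bk0.
have DK : {ae Q, forall w, `|D w| <= 8 * M}.
  apply: filterS2 X0M k0M => w a b; rewrite (le_trans (ler_normB _ _))//; lra.
have D0 f : measurable_fun setT f -> sqint Q (f \o H) -> \int[Q]_w (f (H w) * D w) = 0.
  move=> mf sf; have [i e] := null_exp_proj (essbd_sqint bX0) pk0 mf sf.
  by rewrite -[RHS]e; apply: eq_Rintegral => w _; rewrite /D mulrBr.
have := ae_le_of_test (measurable_funB mk1 mk0) (sqintB sk1 (essbd_sqint bk0P)).
apply => f mf f1.
have bf P' : essbd P' (f \o H).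
  exact: (essbd_le _ (measurableT_comp mf mH) (fun w => f1 (H w))).
have sf := essbd_sqint (bf P).
have bDP : essbd P D by exact: essbdB bX0P bk0P.
pose F w := (d0 (H w) - d1 (H w)) * (Z w - r0 (H w)) + (A w - d1 (H w)) * (r0 (H w) - r1 (H w)).
have bF : essbd P F.
  exact: (essbdD (essbdM (essbdB bd0P bd1) (essbdB bZP br0P))
    (essbdM (essbdB (bA P) bd1) (essbdB br0P br1))).
have FM : {ae P, forall w, `|F w| <= 16 * M * `|t|}.
  apply: filterS3 (filterI dr dd) (filterI ZMP (tilt_ae r0M)) d11 => w [a b] [c e] g.
  have a1 := A1 w; rewrite (le_trans (ler_normD _ _))// !normrM.
  have -> : 16 * M * `|t| = 4 * 1 * `|t| * (2 * M) + 2 * (4 * M * `|t|) by ring.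
  apply: lerD; apply: ler_pM => //.
  - by rewrite distrC.
  - by rewrite (le_trans (ler_normB _ _))//; lra.
  - by rewrite (le_trans (ler_normB _ _))//; lra.
  - by rewrite distrC.
have iF := sqint_int1M sf (essbd_sqint bF).
have iD := sqint_int1M sf (essbd_sqint bDP).
have -> : \int[P]_w (f (H w) * (k1 (H w) - k0 (H w))) =
    \int[P]_w (f (H w) * D w) + \int[P]_w (f (H w) * F w).
  have i1 := sqint_int1M sf sk1; have i2 := sqint_int1M sf (essbd_sqint bk0P).
  have i3 := sqint_int1M sf (essbd_sqint bX1).
  under eq_Rintegral do rewrite mulrBr.
  rewrite (RintegralB _ i1 i2)// pk1'// -(RintegralB _ i3 i2)// -(RintegralD _ iD iF)//.
  by apply: eq_Rintegral => w _; rewrite /D /F /comp; ring.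
have hD := tilt_centered mD DK D0 mf (bf Q).
have ifa : int1 P (fun w => `|f (H w)|) := int1_norm (sqint_int1 sf).
have hF : `|\int[P]_w (f (H w) * F w)| <= 16 * M * `|t| * \int[P]_w `|f (H w)|.
  apply: (le_trans (le_normr_Rintegral _ iF)) => //.
  rewrite -RintegralZl//; apply: ae_le_Rintegral.
  - exact: int1_norm.
  - exact: int1Z.
  - by apply: filterS FM => w FM; rewrite normrM mulrC ler_wpM2r.
rewrite (le_trans (ler_normD _ _))//.
have -> : 32 * M * `|t| * \int[P]_w `|f (H w)| =
  2 * (8 * M) * `|t| * \int[P]_w `|f (H w)| + 16 * M * `|t| * \int[P]_w `|f (H w)| by ring.
exact: lerD.
Qed.

End conditional.
End tilting.

(** * Efficiency *)

Section equal_laws.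
Context d (W : measurableType d) (R : realType).
Variables P Q : probability W R.
Hypothesis PQ : forall B : set W, measurable B -> P B = Q B.

Lemma eq_law_integral (D : set W) (f : W -> \bar R) :
  (\int[P]_(w in D) f w = \int[Q]_(w in D) f w)%E.
Proof. by apply: eq_measure_integral => A mA _; exact: PQ. Qed.

Lemma eq_law_Rintegral (f : W -> R) : \int[P]_w f w = \int[Q]_w f w.
Proof. by rewrite /Rintegral eq_law_integral. Qed.

Lemma eq_law_int1 f : int1 P f -> int1 Q f.
Proof.
by move=> /integrableP[mf foo]; apply/integrableP; split => //; rewrite -eq_law_integral.
Qed.

Lemma eq_law_sqint f : sqint P f -> sqint Q f.
Proof. by move=> [mf fi]; split => //; exact: eq_law_int1. Qed.

End equal_laws.

Section equal_conditioning.
Context d d' (W : measurableType d) (V : measurableType d') (R : realType).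
Variables (P Q : probability W R) (H : W -> V).
Hypothesis PQ : forall B : set W, measurable B -> P B = Q B.

(** [condE] picks from the set of versions, and equal laws have the same set. The choices coincide,
    so this is an equality of functions and not merely almost sure. *)
Lemma eq_law_condE : condE P H = condE Q H.
Proof.
have QP B : measurable B -> Q B = P B by move=> mB; rewrite PQ.
apply/funext => X; rewrite /condE; congr (xget _ _); apply/funext => g; apply/propext.
split=> -[mg ig Eg]; split => //.
- exact: (eq_law_int1 PQ ig).
- by move=> B mB; rewrite -!(eq_law_integral PQ) Eg.
- exact: (eq_law_int1 QP ig).
- by move=> B mB; rewrite !(eq_law_integral PQ) Eg.
Qed.

Lemma eq_law_condCov : condCov P H = condCov Q H.
Proof. by rewrite /condCov eq_law_condE. Qed.

End equal_conditioning.

Section constant_path.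
Context d (W : measurableType d) (R : realType) (Q : probability W R).

(** With this path, [phi_path_derivative] yields the square integrability and zero mean of phi at
    [Q] without any submodel at hand. *)
Lemma differentiable_path_cst : differentiable_path (fun=> Q) (fun=> 0).
Proof.
split.
- exact: essbd_sqint (essbd_cst _ _).
- move=> f C _ e e0; apply: filterE => th.
  under [X in _ * X]eq_Rintegral do rewrite mulr0.
  by rewrite Rintegral_prob_cst mulr0 subr0 subrr normr0 mulr_ge0// ltW.
- exists 1 => //; apply: filterE => th f u u0 *.
  by rewrite subrr normr0 !mulr_ge0// ltW.
- move=> e e0; exists 1 => //; apply: filterE => th f B u u0 *.
  by rewrite subrr normr0 !mulr_ge0// ltW.
Qed.

End constant_path.

Section square_root.
Context (R : realType).
Implicit Types x th s : R.

(** With r the square root of 1 + x, the error is -(r - 1)^2 / 2, while x^2 = (r - 1)^2 (r + 1)^2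
    and r + 1 >= 1. *)
Lemma sqrt1D_taylor x : `|x| <= 1 / 2 ->
  `|Num.sqrt (1 + x) - 1 - x / 2| <= x ^+ 2 / 2.
Proof.
rewrite ler_norml => /andP[xl xu].
have x0 : 0 <= 1 + x by lra.
have r0 : 0 <= Num.sqrt (1 + x) by exact: sqrtr_ge0.
have := sqr_sqrtr x0; set r := Num.sqrt _ in r0 * => r2.
have xE : x = r ^+ 2 - 1 by lra.
have -> : r - 1 - x / 2 = - ((r - 1) ^+ 2 / 2) by rewrite xE; field.
rewrite normrN ger0_norm ?divr_ge0 ?sqr_ge0// ler_pM2r ?invr_gt0//.
rewrite xE (_ : (r ^+ 2 - 1) ^+ 2 = (r - 1) ^+ 2 * (r + 1) ^+ 2); last by ring.
by rewrite ler_peMr ?sqr_ge0//; nra.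
Qed.

Lemma sqrt1D_remainder th s : `|th| <= 1 / 2 -> `|s| <= 1 ->
  (Num.sqrt (1 + th * s) - 1 - th / 2 * s) ^+ 2 <= th ^+ 4.
Proof.
move=> th2 s1.
have ths : `|th * s| <= `|th| by rewrite normrM ler_piMr.
have := sqrt1D_taylor (le_trans ths th2).
rewrite (_ : th * s / 2 = th / 2 * s); last by field.
set r := _ - _ => hr.
have h2 : (th * s) ^+ 2 <= th ^+ 2.
  by rewrite -(real_normK (num_real (th * s))) -(real_normK (num_real th)) ler_sqr.
rewrite -(real_normK (num_real r)) (_ : th ^+ 4 = (th ^+ 2) ^+ 2); last by ring.
rewrite ler_sqr ?nnegrE ?sqr_ge0//.
by apply: (le_trans hr); have := sqr_ge0 th; lra.
Qed.

End square_root.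

Lemma norm_ge_half (R : realType) (x y M eps t : R) : 0 < M -> eps <= `|x| ->
  `|y - x| <= 32 * M * t -> t <= eps / 2 / (32 * M) -> eps / 2 <= `|y|.
Proof.
move=> M0 xe yx; rewrite ler_pdivlMr ?mulr_gt0// => te.
have : `|x| <= `|y| + `|y - x|.
  by rewrite -[x in leLHS](subKr y) (le_trans (ler_normB _ _)).
by lra.
Qed.

(** * Tilts as regular submodels *)

Section tilted_submodel.
Context {R : realType} {T : nat} {dA dL : 'I_T.+1 -> measure_display}.
Variables (calA : forall t, measurableType (dA t))
          (calL : forall t, measurableType (dL t)).
Local Notation obs := (@obs R T dA dL calA calL).
Variables (a : forall t, calA t)
  (calA_discrete : forall t, discrete_space (calA t)).
Variable Q : probability obs R.
Variables (M eps : R) (M0 : 0 < M) (eps0 : 0 < eps).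
Hypothesis hQ : forall t, weighting_bounds a Q M eps t.
Hypothesis sY : sqint Q (@obsY R T dA dL calA calL).
Variable s : obs -> R.
Hypotheses (ms : measurable_fun setT s) (s1 : forall o, `|s o| <= 1)
  (Es : \int[Q]_o s o = 0).

(* The clip only makes the density nonnegative for large theta. *)
Let p (th : R) (o : obs) : R := 1 + clip (1 / 2) th * s o.

Lemma tilted_submodel : exists Pth, regular_submodel a Q s Pth.
Proof.
have h2 : 0 <= 1 / 2 :> R by lra.
have ss : sqint Q s := essbd_sqint (essbd_le Q ms s1).
have is1 := sqint_int1 ss.
have mp th : measurable_fun setT (p th).
  by apply: measurable_funD => //; exact: measurable_funM.
have p0 th o : 0 <= p th o.
  have : `|clip (1 / 2) th * s o| <= 1 / 2.
    by rewrite normrM -[leRHS]mulr1 ler_pM// clip_norm.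
  by rewrite ler_norml /p => /andP[]; lra.
have ip th : int1 Q (p th) := int1D (int1_cst Q 1) (int1Z (clip (1 / 2) th) is1).
have p1 th : \int[Q]_o p th o = 1.
  rewrite /p (RintegralD _ (int1_cst Q 1) (int1Z (clip (1 / 2) th) is1))//.
  by rewrite (RintegralZl _ _ is1)// Es mulr0 addr0 Rintegral_prob_cst.
have /choice[Pth PthE] th := probability_of_density (mp th) (p0 th) (ip th) (p1 th).
have small th : `|th| <= 1 / 2 ->
    forall B, measurable B -> Pth th B = (\int[Q]_(o in B) (1 + th * s o)%:E)%E.
  by move=> th2 B mB; rewrite PthE// /p clip_id.
have h20 : 0 < 1 / 2 :> R by lra.
exists Pth; split.
- move=> B mB; rewrite small ?normr0//.
  under eq_integral do rewrite mul0r addr0.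
  by rewrite integral_cst// mul1e.
- exact/Lfun2P.
- exists Q, p; split; first exact: sigma_finiteT.
    by apply: filterE => th; split => // B; exact: PthE.
  have p0E o : p 0 o = 1 by rewrite /p clip_id ?normr0// mul0r addr0.
  (* The dominating measure is [Q], under which the base density is 1. The squared remainder is at
     most th^4 pointwise, so after division by th^2 it is squeezed below th^2. *)
  apply: (@squeeze_cvge _ _ _ _ (fun=> 0%E) _ (fun th : R => (th ^+ 2)%:E)).
  + rewrite near_withinE; near=> th => th0.
    have th2 : `|th| <= 1 / 2 by apply: ltW; near: th; exact: near0_norm_lt.
    have th2p : 0 < th ^+ 2 by rewrite exprn_even_gt0.
    apply/andP; split.
      rewrite mule_ge0 ?lee_fin ?invr_ge0 ?(ltW th2p)//.
      by apply: integral_ge0 => o _; rewrite lee_fin sqr_ge0.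
    have -> : ((th ^+ 2)%:E = (th ^- 2)%:E * (th ^+ 4)%:E)%E.
      by rewrite -EFinM; congr EFin; field.
    rewrite lee_pmul2l ?lte_fin ?invr_gt0//.
    have mr : measurable_fun setT (fun o => (Num.sqrt (p th o) - Num.sqrt (p 0 o) -
        th / 2 * s o * Num.sqrt (p 0 o)) ^+ 2).
      have mq th' : measurable_fun setT (fun o => Num.sqrt (p th' o)).
        apply: (@measurableT_comp _ _ _ _ _ _ (@Num.sqrt R)) => //.
        by apply: continuous_measurable_fun; exact: sqrt_continuous.
      apply: measurable_funX; apply: measurable_funB; first exact: measurable_funB.
      by apply: measurable_funM => //; exact: measurable_funM.
    apply: (@le_trans _ _ (\int[Q]_o (th ^+ 4)%:E)%E); last first.
      by rewrite -(EFin_Rintegral (int1_cst Q _)) Rintegral_prob_cst.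
    apply: ge0_le_integral => //.
    * by move=> o _; rewrite lee_fin sqr_ge0.
    * exact/measurable_EFinP.
    * move=> o _; rewrite lee_fin p0E sqrtr1 mulr1 /p clip_id//.
      exact: sqrt1D_remainder.
  + exact: cvg_cst.
  + apply: cvg_EFin; first exact: filterE.
    rewrite -[X in _ --> X](_ : (0 : R) ^+ 2 = 0); last by rewrite expr2 mul0r.
    by apply: cvg_within_filter; exact: exprn_continuous.
(* Null sets of [Q] stay null under the tilt, so [M] is kept. Conditional covariances move by at
   most 32 M |th|, which is below eps / 2 near 0. The factor 2 bounds the density. *)
- exists M, (eps / 2), (2 * \int[Q]_o (obsY o ^+ 2)); split; first by rewrite divr_gt0.
  near=> th.
  have th2 : `|th| <= 1 / 2 by apply: ltW; near: th; exact: near0_norm_lt.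
  have the : `|th| <= eps / 2 / (32 * M).
    by apply: ltW; near: th; apply: near0_norm_lt; rewrite !divr_gt0// mulr_gt0.
  have PE := small th th2.
  split.
    move=> t; have [ZM ke] := hQ t; split; first exact: (tilt_ae ms PE ZM).
    have := tilt_condCov ms s1 th2 PE (@measurable_obsH R T dA dL calA calL t) M0
      (@measurable_obsZ R T dA dL calA calL t)
      (@measurable_obsAind R T dA dL calA calL a calA_discrete t)
      (@obsAind_le1 R T dA dL calA calL a t) ZM.
    apply: filterS2 (tilt_ae ms PE ke) => o.
    by move=> xe yx; exact: norm_ge_half M0 xe yx the.
  have [mY iY] := sY.
  rewrite -EFin_Rintegral; last exact: (tilt_int1 ms s1 th2 PE iY).
  rewrite lee_fin; have [] := tilt_ge0_le ms s1 th2 PE iY => //.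
  by move=> o; exact: sqr_ge0.
Unshelve. all: by end_near. Qed.

End tilted_submodel.

Section efficiency.
Context {R : realType} {T : nat} {dA dL : 'I_T.+1 -> measure_display}.
Variables (calA : forall t, measurableType (dA t))
          (calL : forall t, measurableType (dL t)).
Local Notation obs := (@obs R T dA dL calA calL).
Variables (a : forall t, calA t)
  (calA_discrete : forall t, discrete_space (calA t)).

Lemma eq_law_gamma_rv (P Q : probability obs R) k :
  (forall B : set obs, measurable B -> P B = Q B) ->
  gamma_rv a P k = gamma_rv a Q k.
Proof.
move=> PQ; elim: k => [//|k IH].
by apply/funext => o; rewrite /= IH /gamma_step /kappa_true (eq_law_condCov _ PQ).
Qed.

Lemma eq_law_psi (P Q : probability obs R) :
  (forall B : set obs, measurable B -> P B = Q B) -> psi a P = psi a Q.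
Proof.
move=> PQ; rewrite /psi (eq_law_Rintegral PQ); apply: eq_Rintegral => o _.
congr (_ * obsY o); apply: eq_bigr => t _.
by rewrite (eq_law_condCov _ PQ) (eq_law_condE _ PQ).
Qed.

Lemma eq_law_nuisance_true (P Q : probability obs R) :
  (forall B : set obs, measurable B -> P B = Q B) ->
  nuisance_true a P = nuisance_true a Q.
Proof.
move=> PQ; apply: functional_extensionality_dep => t; rewrite /nuisance_true /gamma_step /kappa_true.
by rewrite (eq_law_gamma_rv _ PQ) !(eq_law_condCov _ PQ) !(eq_law_condE _ PQ).
Qed.

Variable Q : probability obs R.
Hypothesis Q_regular : forall t, regular_weighting a Q t.
Hypothesis sY : sqint Q (@obsY R T dA dL calA calL).

(** Sums over time stand in for the maximum of the bounds and of the inverses 1 / eps_t; the added 1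
    ensures positivity. *)
Lemma uniform_weighting_bounds : exists M eps : R,
  [/\ 0 < M, 0 < eps & forall t, weighting_bounds a Q M eps t].
Proof.
have /choice[me hme] t : exists me : R * R, 0 < me.2 /\ weighting_bounds a Q me.1 me.2 t.
  by have [M [eps h]] := Q_regular t; exists (M, eps).
pose M := 1 + \sum_t `|(me t).1|; pose E := 1 + \sum_t ((me t).2)^-1.
have i0 t : 0 < ((me t).2)^-1 by rewrite invr_gt0; have [] := hme t.
have sumM : 0 <= \sum_t `|(me t).1| by apply: sumr_ge0.
have sumE : 0 <= \sum_t ((me t).2)^-1 by apply: sumr_ge0 => t _; exact: ltW.
have E0 : 0 < E by rewrite /E; lra.
exists M, E^-1; split; first by rewrite /M; lra.
  by rewrite invr_gt0.
move=> t; have [e0 [h1 h2]] := hme t; split.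
  apply: filterS h1 => o /le_trans; apply; rewrite /M (bigD1 t)//=.
  have : 0 <= \sum_(i | i != t) `|(me i).1| by apply: sumr_ge0.
  by have := ler_norm (me t).1; lra.
apply: filterS h2 => o; apply: le_trans.
rewrite -[leRHS]invrK lef_pV2 ?posrE// /E (bigD1 t)//=.
have : 0 <= \sum_(i | i != t) ((me i).2)^-1 by apply: sumr_ge0 => i _; exact: ltW.
by lra.
Qed.

Local Notation phiQ := (phi a (psi a Q) (nuisance_true a Q)).

Lemma phi_influence : influence_function a Q (psi a) phiQ.
Proof.
have [M [eps [M0 eps0 hQ]]] := uniform_weighting_bounds.
have [|phi2 phi1 _] := phi_path_derivative calA_discrete (differentiable_path_cst Q) M0 eps0
    (C := \int[Q]_o (obsY o ^+ 2)) (filterE _ (fun th => hQ)).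
  by apply: filterE => th; rewrite EFin_Rintegral//; have [] := sY.
split => //; first exact/Lfun2P.
move=> s Pth [PQ /Lfun2P ss [nu [p [_ hp hd]]] [M' [eps' [C [eps'0 hb]]]]].
have QP B : measurable B -> Q B = Pth 0 B by move=> mB; rewrite PQ.
have dP := dqm_differentiable_path (eq_law_sqint QP ss) hp hd.
(* The bound in [regular_submodel] is not stated to be positive, so it is enlarged. *)
have M1 : 0 < 1 + `|M'| by rewrite ltr_pwDl.
have hw : \forall th \near (0 : R), forall t, weighting_bounds a (Pth th) (1 + `|M'|) eps' t.
  apply: filterS hb => th [h _] t; have [h1 h2] := h t; split => //.
  by apply: filterS h1 => o /le_trans; apply; rewrite (le_trans (ler_norm M'))// lerDr.
have hY : \forall th \near (0 : R), (\int[Pth th]_o ((obsY o) ^+ 2)%:E <= C%:E)%E.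
  by apply: filterS hb => th [].
have [_ _] := phi_path_derivative calA_discrete dP M1 eps'0 hw hY.
move=> /has_deriv0_is_derive.
by rewrite (eq_law_psi PQ) (eq_law_nuisance_true PQ) (eq_law_Rintegral PQ).
Qed.

(* Testing against the scores (f - E f) / 2 of the tilted submodels, f bounded,
   determines a mean-zero function almost everywhere. *)
Lemma influence_function_unique g : influence_function a Q (psi a) g ->
  {ae Q, forall o, g o = phiQ o}.
Proof.
move=> [/Lfun2P sg g0 gd]; have [/Lfun2P sphi phi0 phid] := phi_influence.
have [M [eps [M0 eps0 hQ]]] := uniform_weighting_bounds.
pose h o := g o - phiQ o.
have sh : sqint Q h := sqintB sg sphi.
have [ig iphi] := (sqint_int1 sg, sqint_int1 sphi).
have h0 : \int[Q]_o h o = 0 by rewrite (RintegralB _ ig iphi)// g0 phi0 subrr.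
suff : {ae Q, forall o, `|h o| <= 0}.
  by apply: filterS => o; rewrite normr_le0 subr_eq0 => /eqP.
(* With bound 0 the criterion asks that [h] be orthogonal to every measurable [f] bounded by 1. *)
apply: (@ae_le_of_test _ _ _ Q _ _ id); [by []|by have []:= sh|exact: sh|].
move=> f mf f1.
have bf : essbd Q f := essbd_le Q mf f1.
have if1 := sqint_int1 (essbd_sqint bf).
pose m := \int[Q]_o f o.
have m1 : `|m| <= 1.
  rewrite (le_trans (le_normr_Rintegral _ if1))//.
  rewrite -(Rintegral_prob_cst Q 1); apply: le_Rintegral => //.
  - exact: int1_norm.
  - exact: int1_cst.
pose s o := 2^-1 * (f o - m).
have ifm : int1 Q (fun o => f o - m) := int1B if1 (int1_cst Q m).
have ms : measurable_fun setT s.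
  by apply: measurable_funM => //; exact: measurable_funB.
have s1 o : `|s o| <= 1.
  rewrite /s normrM ger0_norm ?invr_ge0// ler_pdivrMl// mulr1.
  by rewrite (le_trans (ler_normB _ _))// -[2]/(1 + 1) lerD.
have Es : \int[Q]_o s o = 0.
  rewrite /s (RintegralZl _ _ ifm)// (RintegralB _ if1 (int1_cst Q m))//.
  by rewrite Rintegral_prob_cst subrr mulr0.
have [Pth rPth] := tilted_submodel calA_discrete M0 eps0 hQ sY ms s1 Es.
have := @derive_val _ _ _ _ _ _ _ (gd _ _ rPth).
rewrite (@derive_val _ _ _ _ _ _ _ (phid _ _ rPth)) => gphi.
have ss : sqint Q s := essbd_sqint (essbd_le Q ms s1).
have hs : \int[Q]_o (h o * s o) = 0.
  under eq_Rintegral do rewrite mulrBl.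
  rewrite (RintegralB _ (sqint_int1M sg ss) (sqint_int1M sphi ss))//.
  by rewrite gphi subrr.
have ihs := sqint_int1M sh ss; have ih := sqint_int1 sh.
(* f = 2 s + m, where [h] is orthogonal to the score [s], because both functions represent the same
   derivative, and to the constant [m], because both have mean zero. *)
rewrite mul0r normr_le0 (_ : \int[Q]_w _ = \int[Q]_w (2 * (h w * s w) + m * h w)).
  rewrite (RintegralD _ (int1Z 2 ihs) (int1Z m ih))//.
  by rewrite (RintegralZl _ _ ihs)// (RintegralZl _ _ ih)// hs h0 !mulr0 addr0.
by apply: eq_Rintegral => o _; rewrite /s; field.
Qed.

End efficiency.

Theorem theorem4p2 (R : realType) (T : nat)
  (dA dL dU : 'I_T.+1 -> measure_display)
  (calA : forall t, measurableType (dA t))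
  (calL : forall t, measurableType (dL t))
  (calU : forall t, measurableType (dU t))
  (calA_discrete : forall t, discrete_space (calA t))
  (d : measure_display) (Omega : measurableType d) (P : probability Omega R)
  (O : {RV P >-> (obs calA calL : measurableType _)})
  (U : forall t, {RV P >-> calU t})
  (Ypot : (forall t, calA t) -> {RV P >-> R})
  (consistency :
     {ae P, forall w, obsY (O w) = Ypot (fun t => obsA t (O w)) w})
  (latent_ignorability : forall (t : 'I_T.+1) (a : forall s, calA s),
     cond_indep P
       (fun w => (obsZ t (O w), obsA t (O w)) : measurableTypeR R * calA t)
       (fun w => Ypot (fun s => if (s < t)%N then obsA s (O w) else a s) w
                 : measurableTypeR R)
       (fun w => (obsH t (O w), (fun s : 'I_t.+1 => U (upto s) w))
                 : hist calA calL t * prod_space (fun s : 'I_t.+1 => calU (upto s))))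
  (iv_independence : forall t : 'I_T.+1,
     cond_indep P
       (fun w => obsZ t (O w) : measurableTypeR R)
       (fun w => (fun s : 'I_t.+1 => U (upto s) w)
                 : prod_space (fun s : 'I_t.+1 => calU (upto s)))
       (fun w => obsH t (O w) : hist calA calL t))
  (a : forall t, calA t)
  (Z_regular : forall t, regular_weighting a (distribution P O) t)
  (Y_square_integrable : obsY (calL := calL) \in Lfun (distribution P O) 2%:E) :
  efficient_influence_function a (distribution P O) (psi a)
    (phi a (psi a (distribution P O)) (nuisance_true a (distribution P O))).
Proof.
have sY : sqint (distribution P O) (obsY (calL := calL)) by exact/Lfun2P.
split; first exact: phi_influence.
by move=> g; exact: influence_function_unique.
Qed.
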